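(* Let $(\Omega,\rho)$ be a geometric homogeneous space and let $\Theta$ be a bounded domain with $\overline\Theta\subset\Omega$. Assume that both the local Poincaré inequality of order $p=2$ and the global weak Poincaré inequality with gain $\omega>1$ on $\Theta$ hold. Let $Xu=-\mathrm{div}(P\nabla u)+\mathbf{H}\mathbf{R}u+\mathbf{S}'(\mathbf{G}u)+Fu$ be a second order linear degenerate elliptic operator with rough coefficients in $\Theta$ that satisfies negativity condition (1). Assume that $F\in L^t(\Theta)$ with $t>\omega'=\frac{\omega}{\omega-1}$ and that $\mathbf{G},\mathbf{H}\in[L^q(\Theta)]^N$ with $q>2\omega'$. Then $0\notin\Sigma$ (where $\Sigma$ is the set of real eigenvalues of the $X$-Neumann problem), and the $X$-Neumann problem $$Xu=f+\mathbf{T}'\mathbf{g}\ \text{ in }\Theta,\qquad \langle\nu,P\nabla u+u\mathbf{G}\mathbf{S}-\mathbf{g}\mathbf{T}\rangle=0\ \text{ on }\partial\Theta$$ admits a unique weak solution $u\in QH^1(\Theta)$ for every $f\in L^2(\Theta)$, every $K\in\mathbb{N}$, every $K$-tuple $\mathbf{T}$ of subunit vector fields and every $\mathbf{g}\in[L^2(\Theta)]^K$. Moreover there exists a constant $C>0$, independent of $u,f,K,\mathbf{T}$ and $\mathbf{g}$, such that $$\|u\|_{QH^1(\Theta)}\le C\big(\|f\|_{L^2(\Theta)}+\sqrt{K}\,\|\,|\mathbf{g}|\,\|_{L^2(\Theta)}\big)$$ whenever $u\in QH^1(\Theta)$ is a weak solution of this problem.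
   Context: Geometric homogeneous space: $\Omega\subset\mathbb{R}^n$ is a bounded open set and $\rho:\Omega\times\Omega\to[0,\infty)$ is a symmetric quasimetric, i.e. for some $\kappa\ge1$ and all $x,y,z\in\Omega$: $\rho(x,y)=0$ iff $x=y$; $\rho(x,y)=\rho(y,x)$; $\rho(x,y)\le\kappa[\rho(x,z)+\rho(z,y)]$. Put $B(x,r)=\{y\in\Omega:\rho(x,y)<r\}$. $(\Omega,\rho)$ is a geometric homogeneous space if: (a) every $B(x,r)$, $x\in\Omega$, $r>0$, is open in the Euclidean topology; (b) for $x,y\in\Omega$, $|x-y|\to0$ if $\rho(x,y)\to0$ (equivalently, for every $x\in\Omega$ and $\epsilon>0$ there is $\delta>0$ with $B(x,\delta)\subset\{y\in\Omega:|x-y|<\epsilon\}$); (c) the $\rho$-balls are locally geometrically doubling: for every compact $E\subset\Omega$ there is $\delta=\delta(E)>0$ such that for all $x\in E$ and $0<r'\le r<\delta$, $B(x,r)$ contains at most $C(r/r')$ disjoint $\rho$-balls of radius $r'$, where $C(r/r')$ is independent of $x$ and $E$. Degenerate Sobolev space: $Q=Q(x)$ is a nonnegative definite symmetric $n\times n$ matrix of measurable functions on $\Omega$ with $|Q|\in L^\infty_{loc}(\Omega)$. For open $\Theta\subset\Omega$, $Lip_Q(\Theta)$ is the set of locally Lipschitz functions $\varphi$ on $\Theta$ with $\|\varphi\|_{QH^1(\Theta)}=\big(\int_\Theta|\varphi|^2dx+\int_\Theta|\sqrt{Q}\nabla\varphi|^2dx\big)^{1/2}<\infty$, and $QH^1(\Theta)$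 is its completion in this norm. Elements of $QH^1(\Theta)$ are identified with pairs $(u,\nabla u)$ (limits of pairs $(\varphi_j,\nabla\varphi_j)$), where $u\in L^2(\Theta)$ and $\nabla u$ is a measurable $\mathbb{R}^n$-valued function with $\sqrt{Q}\nabla u\in L^2$, two such functions being identified if $\sqrt{Q}$ times their difference vanishes a.e.; $\nabla u$ need not be determined by $u$. One writes $u$ for $(u,\nabla u)$. Local Poincaré inequality of order $p$: a continuous function $r_1:\Omega\to(0,\infty)$ is fixed, and there are $C_2>0$, $\mathfrak{b}\ge1$ such that for every $y\in\Omega$ and $r>0$ with $\mathfrak{b}r\in(0,r_1(y))$, writing $B_r=B(y,r)$ and $f_{B_r}=\frac1{|B_r|}\int_{B_r}f\,dx$, $$\Big(\tfrac{1}{|B_r|}\int_{B_r}|f-f_{B_r}|^pdx\Big)^{1/p}\le C_2\,r\Big(\tfrac{1}{|B_{\mathfrak{b}r}|}\int_{B_{\mathfrak{b}r}}|\sqrt{Q}\nabla f|^pdx\Big)^{1/p}\quad\text{for all } f\in Lip_{loc}(\Omega).$$ Global weak Poincaré inequality with gain $\omega>1$ on $\Theta$: there is $C_4>0$ with $\big(\int_\Theta|f|^{2\omega}dx\big)^{1/(2\omega)}\le C_4\big(\int_\Theta|\sqrt{Q}\nabla f|^2dx+\int_\Theta|f|^2dx\big)^{1/2}$ for all $f\in Lip_Q(\Theta)$. Subunit vector fields: a measurable vector field $W=(w_1,\dots,w_n)$ is subunit if $\big(\sum_iw_i(x)\xi_i\big)^2\le\langle\xi,Q(x)\xi\rangle$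 for all $\xi\in\mathbb{R}^n$ and a.e. $x\in\Theta$. For $(u,\nabla u)\in QH^1(\Theta)$, $Wu=\sum_iw_i(\nabla u)_i\in L^2(\Theta)$; for $u,v\in QH^1(\Theta)$, $W(uv)=uWv+vWu$. $W'u=-\sum_i\partial_{x_i}(w_iu)$ is the formal adjoint. For tuples, $\mathbf{G}\mathbf{W}u=\sum_ig_iW_iu$ and $\mathbf{W}'(\mathbf{G}u)=\sum_iW_i'(g_iu)$. Second order linear degenerate elliptic operator with rough coefficients: $Xu=-\mathrm{div}(P\nabla u)+\mathbf{H}\mathbf{R}u+\mathbf{S}'(\mathbf{G}u)+Fu$ in $\Theta$, where $P=P(x)$ is a bounded measurable nonnegative definite symmetric $n\times n$ matrix with $c_1\langle\xi,Q(x)\xi\rangle\le\langle\xi,P(x)\xi\rangle\le C_1\langle\xi,Q(x)\xi\rangle$ for some $c_1,C_1>0$, all $\xi\in\mathbb{R}^n$ and a.e. $x\in\Theta$; $\mathbf{R},\mathbf{S}$ are $N$-tuples of subunit vector fields; $\mathbf{G},\mathbf{H}$ are $\mathbb{R}^N$-valued measurable functions and $F$ is a real measurable function on $\Theta$. Its bilinear form is $$\mathcal{L}(u,v)=\int_\Theta\big[\langle\nabla v,P\nabla u\rangle+v\,\mathbf{H}\mathbf{R}u+u\,\mathbf{G}\mathbf{S}v+Fuv\big]dx,\quad u,v\in QH^1(\Theta).$$ Negativity condition (1): there exists $\varepsilon>0$ such that either (i) $\int_\Theta Fuv+\mathbf{G}\mathbf{S}(uv)\,dx\ge\varepsilon\int_\Theta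 uv\,dx$ for all $(u,\nabla u),(v,\nabla v)\in QH^1(\Theta)$ with $uv\ge0$ a.e. in $\Theta$; or (ii) $\int_\Theta Fuv+\mathbf{H}\mathbf{R}(uv)\,dx\ge\varepsilon\int_\Theta uv\,dx$ for all $(u,\nabla u),(v,\nabla v)\in QH^1(\Theta)$ with $uv\ge0$ a.e. in $\Theta$. Weak solutions and eigenvalues: $\nu$ denotes the outward unit normal; the boundary condition is only formal. $u\in QH^1(\Theta)$ is a weak solution of the displayed Neumann problem iff $\mathcal{L}(u,v)=\int_\Theta(fv+\mathbf{g}\mathbf{T}v)\,dx$ for every $v\in QH^1(\Theta)$. $\Sigma$ is the set of $\lambda\in\mathbb{R}$ for which it is not true that for every choice of $f,K,\mathbf{T},\mathbf{g}$ there is a unique $u\in QH^1(\Theta)$ with $\mathcal{L}(u,v)=\int_\Theta(\lambda uv+fv+\mathbf{g}\mathbf{T}v)\,dx$ for all $v\in QH^1(\Theta)$; equivalently, of those $\lambda$ for which there is a nontrivial $u\in QH^1(\Theta)\setminus\{(0,\mathbf{0})\}$ with $\mathcal{L}(u,v)=\lambda\int_\Theta uv\,dx$ for all $v\in QH^1(\Theta)$. *)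

(* Defs.v *)
From HB Require Import structures.
From mathcomp Require Import all_boot all_order all_algebra.
From mathcomp Require Import all_classical all_reals all_analysis.

Set Implicit Arguments.
Unset Strict Implicit.
Unset Printing Implicit Defensive.
Import Order.TTheory GRing.Theory Num.Theory.
Import numFieldNormedType.Exports.

Local Open Scope classical_set_scope.
Local Open Scope ring_scope.

(* R^n with n >= 1 is the type 'rV[R]_n.+1.  Its library norm is the max norm,
   which induces the Euclidean topology. *)

Section lebesgue_outer.
Local Open Scope ereal_scope.
Context {R : realType} {n : nat}.
Local Notation Rn := 'rV[R]_n.+1.

Definition box (a b : Rn) : set Rn :=
  [set x | forall i, (a ord0 i <= x ord0 i <= b ord0 i)%R].

Definition box_volume (a b : Rn) : \bar R :=
  (\prod_i Num.max 0 (b ord0 i - a ord0 i))%R%:E.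

Definition box_cover (A : set Rn) : set (nat -> Rn * Rn) :=
  [set B | A `<=` \bigcup_k box (B k).1 (B k).2].

Definition lebesgue_outer (A : set Rn) : \bar R :=
  ereal_inf [set \sum_(k <oo) box_volume (B k).1 (B k).2 | B in box_cover A].

Lemma box_volume_ge0 a b : 0 <= box_volume a b.
Proof. by rewrite lee_fin; apply: prodr_ge0 => i _; rewrite le_max lexx. Qed.

Lemma lebesgue_outer_ge0 A : 0 <= lebesgue_outer A.
Proof.
apply: le_ereal_inf_tmp => _ [B _ <-].
by apply: nneseries_ge0 => *; exact: box_volume_ge0.
Qed.

Lemma lebesgue_outer0 : lebesgue_outer set0 = 0.
Proof.
apply/eqP; rewrite eq_le lebesgue_outer_ge0 andbT.
apply: ereal_inf_lbound; exists (fun=> (0%R, 0%R)) => //=.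
apply: eseries0 => k _ _; rewrite /box_volume big_ord_recl.
by rewrite subrr maxxx mul0r.
Qed.

Lemma le_lebesgue_outer : {homo lebesgue_outer : A B / A `<=` B >-> A <= B}.
Proof.
move=> A B AB; apply/ereal_inf_le_tmp => x [C BC <-].
by exists C => //; exact: subset_trans AB BC.
Qed.

Lemma lebesgue_outer_sigma_subadditive : sigma_subadditive lebesgue_outer.
Proof.
pose vol (B : Rn * Rn) := box_volume B.1 B.2.
have vol0 B : 0 <= vol B by exact: box_volume_ge0.
move=> A; have [[i ioo]|] := pselect (exists i, lebesgue_outer (A i) = +oo).
  rewrite (eseries_pinfty _ _ ioo) ?leey// => k _.
  by rewrite -ltNye (lt_le_trans _ (lebesgue_outer_ge0 _)).
rewrite -forallNE => Aoo.
suff add2e (e : {posnum R}) : lebesgue_outer (\bigcup_n A n) <=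
    \sum_(i <oo) lebesgue_outer (A i) + e%:num%:E.
  by apply/lee_addgt0Pr => _/posnumP[].
rewrite (le_trans _ (epsilon_trick _ _ _))//; last first.
  by move=> k; exact: lebesgue_outer_ge0.
pose P k (B : nat -> Rn * Rn) := box_cover (A k) B /\
  \sum_(j <oo) vol (B j) <=
  lebesgue_outer (A k) + (e%:num / (2 ^ k.+1)%:R)%:E.
have [G PG] : {G : nat -> nat -> Rn * Rn & forall k, P k (G k)}.
  apply: (@choice _ _ P) => k; rewrite /P /lebesgue_outer.
  set S := (X in ereal_inf X); move infS : (ereal_inf S) => iS.
  case: iS infS => [r Sr|Soo|Soo].
  - have en1 : (0 < e%:num / (2 ^ k.+1)%:R)%R by [].
    have /(lb_ereal_inf_adherent en1) : ereal_inf S \is a fin_num by rewrite Sr.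
    move=> [x [B AnB muBx] xS].
    by exists B; split => //; rewrite muBx -Sr; exact/ltW.
  - by case: (Aoo k).
  - suff : lbound S 0 by move/le_ereal_inf_tmp; rewrite Soo.
    move=> /= _ [B AnB <-]; apply: nneseries_ge0 => k0 _ _; exact: vol0.
have volG_ge0 x : 0 <= (vol \o uncurry G) x by exact: vol0.
apply: (@le_trans _ _ (\esum_(i in setT) (vol \o uncurry G) i)).
  apply: ereal_inf_lbound => /=.
  have /card_esym/ppcard_eqP[f] := card_nat2.
  exists (uncurry G \o f).
    move=> t [i _ /(PG i).1[j _ Bijt]].
    by exists (f^-1%FUN (i, j)) => //=; rewrite invK ?inE.
  rewrite -(esum_pred_image (vol \o uncurry G) _ xpredT) ?[fun=> _]set_true//.
  by rewrite image_eq.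
rewrite (_ : esum _ _ = \sum_(i <oo) \sum_(j <oo) vol (G i j)); last first.
  pose J : nat -> set (nat * nat) := fun i => [set (i, j) | j in setT].
  rewrite (_ : setT = \bigcup_k J k); last first.
    by rewrite predeqE => -[a b]; split => // _; exists a => //; exists b.
  rewrite esum_bigcupT /=; last 2 first.
    - apply/trivIsetP => i j _ _ ij.
      rewrite predeqE => -[k m] /=; split => //= -[] [_] _ [<-{k} _].
      by move=> [m' _] [] /esym/eqP; rewrite (negbTE ij).
    - by move=> /= [k m]; exact: vol0.
  rewrite -(image_id [set: nat]) -fun_true esum_pred_image//; last first.
    by move=> k _; exact: esum_ge0.
  apply: eq_eseriesr => /= j _.
  rewrite -(esum_pred_image (vol \o uncurry G) (pair j) predT)//=; last first.
    by move=> ? ? _ _; exact: (@can_inj _ _ _ snd).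
  by congr esum; rewrite predeqE => -[a b]; split; move=> [i _ <-]; exists i.
apply: lee_lim.
- apply: is_cvg_nneseries => k *.
  by apply: nneseries_ge0 => m *; exact: (volG_ge0 (k, m)).
- apply: is_cvg_nneseries => k *.
  by apply: adde_ge0 => //; exact: lebesgue_outer_ge0.
- by near=> k; apply: lee_sum => i _; exact: (PG i).2.
Unshelve. all: by end_near. Qed.

HB.instance Definition _ := isOuterMeasure.Build R Rn lebesgue_outer
  lebesgue_outer0 lebesgue_outer_ge0 le_lebesgue_outer
  lebesgue_outer_sigma_subadditive.

End lebesgue_outer.

(* Measurable sets of R^n are the Lebesgue (= Caratheodory) measurable ones,
   so the measure below is complete. *)
HB.instance Definition _ (R : realType) (n : nat) :=
  Measurable.copy 'rV[R]_n.+1 (caratheodory_type (@lebesgue_outer R n)).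

Definition lebesgueRn {R : realType} {n : nat} : set 'rV[R]_n.+1 -> \bar R :=
  lebesgue_outer.

HB.instance Definition _ (R : realType) (n : nat) :=
  isMeasure.Build _ 'rV[R]_n.+1 R lebesgueRn
    (@caratheodory_measure0 R _ (@lebesgue_outer R n))
    (@caratheodory_measure_ge0 R _ (@lebesgue_outer R n))
    (@caratheodory_measure_sigma_additive R _ (@lebesgue_outer R n)).

Section euclidean.
Context {R : realType} {n : nat}.
Local Notation Rn := 'rV[R]_n.+1.
Implicit Types (u v : Rn) (A : 'M[R]_n.+1).

Definition dotv u v : R := \sum_i u ord0 i * v ord0 i.
Definition enorm v : R := Num.sqrt (dotv v v).

(* A v, with vectors stored as rows *)
Definition mxact A v : Rn := (A *m v^T)^T.

Definition nonneg_sym A : Prop := A^T = A /\ forall v, 0 <= dotv v (mxact A v).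

(* the unique nonnegative symmetric square root of a nonnegative symmetric A *)
Definition sqrtmx A : 'M[R]_n.+1 :=
  xget 0 [set S | nonneg_sym S /\ S *m S = A].

End euclidean.

Section homogeneous_space.
Context {R : realType} {n : nat}.
Local Notation Rn := 'rV[R]_n.+1.
Variables (Omega : set Rn) (rho : Rn -> Rn -> R).

(* rho is only used on Omega x Omega *)
Definition quasimetric : Prop :=
  [/\ forall x y, Omega x -> Omega y -> 0 <= rho x y,
      forall x y, Omega x -> Omega y -> rho x y = 0 <-> x = y,
      forall x y, Omega x -> Omega y -> rho x y = rho y x
    & exists2 kappa : R, 1 <= kappa &
        forall x y z, Omega x -> Omega y -> Omega z ->
          rho x y <= kappa * (rho x z + rho z y)].

Definition qball (x : Rn) (r : R) : set Rn := [set y | Omega y /\ rho x y < r].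

Definition locally_geometrically_doubling : Prop :=
  exists C : R -> R, forall E : set Rn, compact E -> E `<=` Omega ->
    exists2 delta : R, 0 < delta &
      forall (x : Rn) (r' r : R), E x -> 0 < r' -> r' <= r -> r < delta ->
      forall (k : nat) (y : 'I_k -> Rn),
        (forall i, Omega (y i) /\ qball (y i) r' `<=` qball x r) ->
        trivIset setT (fun i => qball (y i) r') ->
        k%:R <= C (r / r').

Definition geometric_homogeneous_space : Prop :=
  [/\ open Omega /\ bounded_set Omega,
      quasimetric,
      forall x r, Omega x -> 0 < r -> open (qball x r),
      forall x (eps : R), Omega x -> 0 < eps ->
        exists2 delta : R, 0 < delta &
          qball x delta `<=` [set y | enorm (x - y) < eps]
    & locally_geometrically_doubling].

End homogeneous_space.

Definition bounded_domain {R : realType} {n : nat} (D : set 'rV[R]_n.+1) :=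
  [/\ open D, connected D, D !=set0 & bounded_set D].

Section function_spaces.
Context {R : realType} {n : nat}.
Local Notation Rn := 'rV[R]_n.+1.
Local Notation mu := (@lebesgueRn R n).

Definition Lnorm_on (D : set Rn) (p : \bar R) (f : Rn -> R) : \bar R :=
  'N[mu]_p[(EFin \o f) \_ D].

Definition Lp_on (D : set Rn) (p : \bar R) (f : Rn -> R) : Prop :=
  measurable_fun D f /\ (Lnorm_on D p f < +oo)%E.

Definition measurable_field (D : set Rn) (U : Rn -> Rn) : Prop :=
  forall i, measurable_fun D (fun x => U x ord0 i).

Definition locally_lipschitz (D : set Rn) (f : Rn -> R) : Prop :=
  forall x, D x -> exists2 V, nbhs x V &
    [lipschitz (f y : R^o) | y in V `&` D].

(* G is the gradient of f, defined a.e. in the open set D.  By Rademacher's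
   theorem every locally Lipschitz f on D has a gradient in this sense, and it
   is unique up to null sets. *)
Definition is_gradient (D : set Rn) (f : Rn -> R) (G : Rn -> Rn) : Prop :=
  measurable_field D G /\
  {ae mu, forall x, D x -> differentiable (f : Rn -> R^o) x /\
     forall v, 'd (f : Rn -> R^o) x v = dotv (G x) v}.

(* pairs (f, grad f) with f locally Lipschitz in D *)
Definition Lip_loc (D : set Rn) : set ((Rn -> R) * (Rn -> Rn)) :=
  [set f | locally_lipschitz D f.1 /\ is_gradient D f.1 f.2].

Definition degenerate_matrix (Omega : set Rn) (Q : Rn -> 'M[R]_n.+1) : Prop :=
  [/\ forall x, Omega x -> nonneg_sym (Q x),
      forall i j, measurable_fun Omega (fun x => Q x i j)
    & forall E, compact E -> E `<=` Omega ->
        exists M : R, {ae mu, forall x, E x -> `|Q x| <= M}].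

Variable Q : Rn -> 'M[R]_n.+1.

Definition sqrtQ (U : Rn -> Rn) (x : Rn) : Rn := mxact (sqrtmx (Q x)) (U x).

Definition QH1norm (D : set Rn) (u : (Rn -> R) * (Rn -> Rn)) : \bar R :=
  ((\int[mu]_(x in D) (`|u.1 x| ^+ 2)%:E
    + \int[mu]_(x in D) (enorm (sqrtQ u.2 x) ^+ 2)%:E) `^ 2^-1)%E.

Definition Lip_Q (D : set Rn) : set ((Rn -> R) * (Rn -> Rn)) :=
  [set f | Lip_loc D f /\ (QH1norm D f < +oo)%E].

(* Representatives (u, grad u) of the elements of the completion of Lip_Q;
   two of them define the same element when QH1_eq holds. *)
Definition QH1 (D : set Rn) : set ((Rn -> R) * (Rn -> Rn)) :=
  [set u | [/\ measurable_fun D u.1, measurable_field D u.2,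
      (QH1norm D u < +oo)%E
    & exists phi : nat -> (Rn -> R) * (Rn -> Rn),
        (forall j, Lip_Q D (phi j)) /\
        (fun j => QH1norm D (u - phi j)) @ \oo --> 0%E]].

Definition QH1_eq (D : set Rn) (u v : (Rn -> R) * (Rn -> Rn)) : Prop :=
  {ae mu, forall x, D x -> u.1 x = v.1 x /\ sqrtQ (u.2 - v.2) x = 0}.

Definition local_poincare (Omega : set Rn) (rho : Rn -> Rn -> R)
    (r1 : Rn -> R) (p : R) : Prop :=
  exists C2 b : R, [/\ 0 < C2, 1 <= b &
    forall (y : Rn) (r : R), Omega y -> 0 < r -> b * r < r1 y ->
    let B := qball Omega rho y r in
    let bB := qball Omega rho y (b * r) in
    forall f, Lip_loc Omega f ->
    let fB := (fine (mu B))^-1 * \int[mu]_(x in B) f.1 x in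
    (((fine (mu B))^-1%:E *
        \int[mu]_(x in B) (`|f.1 x - fB| `^ p)%:E) `^ p^-1
     <= (C2 * r)%:E * ((fine (mu bB))^-1%:E *
        \int[mu]_(x in bB) (enorm (sqrtQ f.2 x) `^ p)%:E) `^ p^-1)%E].

Definition global_weak_poincare (D : set Rn) (omega : R) : Prop :=
  exists2 C4 : R, 0 < C4 & forall f, Lip_Q D f ->
    (Lnorm_on D (2 * omega)%:E f.1 <= C4%:E * QH1norm D f)%E.

Definition subunit (D : set Rn) (W : Rn -> Rn) : Prop :=
  measurable_field D W /\
  {ae mu, forall x, D x ->
     forall xi, dotv (W x) xi ^+ 2 <= dotv xi (mxact (Q x) xi)}.

(* W u, depending on the pair (u, grad u) *)
Definition vapp (W : Rn -> Rn) (u : (Rn -> R) * (Rn -> Rn)) (x : Rn) : R :=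
  dotv (W x) (u.2 x).

(* W (u v) *)
Definition vapp_mul (W : Rn -> Rn) (u v : (Rn -> R) * (Rn -> Rn)) (x : Rn) : R
  := u.1 x * vapp W v x + v.1 x * vapp W u x.

Definition tapp N (g : 'I_N -> Rn -> R) (W : 'I_N -> Rn -> Rn)
    (u : (Rn -> R) * (Rn -> Rn)) (x : Rn) : R :=
  \sum_i g i x * vapp (W i) u x.

Definition tapp_mul N (g : 'I_N -> Rn -> R) (W : 'I_N -> Rn -> Rn)
    (u v : (Rn -> R) * (Rn -> Rn)) (x : Rn) : R :=
  \sum_i g i x * vapp_mul (W i) u v x.

End function_spaces.

(* coefficients of X u = - div (P grad u) + H R u + S' (G u) + F u *)
Record operator (R : realType) (n N : nat) := Operator {
  opP : 'rV[R]_n.+1 -> 'M[R]_n.+1;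
  opH : 'I_N -> 'rV[R]_n.+1 -> R;
  opR : 'I_N -> 'rV[R]_n.+1 -> 'rV[R]_n.+1;
  opS : 'I_N -> 'rV[R]_n.+1 -> 'rV[R]_n.+1;
  opG : 'I_N -> 'rV[R]_n.+1 -> R;
  opF : 'rV[R]_n.+1 -> R
}.

Section neumann_problem.
Context {R : realType} {n N : nat}.
Local Notation Rn := 'rV[R]_n.+1.
Local Notation mu := (@lebesgueRn R n).
Variables (Q : Rn -> 'M[R]_n.+1) (Theta : set Rn) (X : operator R n N).

Definition rough_operator : Prop :=
  [/\ [/\ forall x, Theta x -> nonneg_sym (opP X x),
          forall i j, measurable_fun Theta (fun x => opP X x i j)
        & exists M : R, {ae mu, forall x, Theta x -> `|opP X x| <= M}],
      exists c1 C1 : R, [/\ 0 < c1, 0 < C1 &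
        {ae mu, forall x, Theta x -> forall xi,
           c1 * dotv xi (mxact (Q x) xi) <= dotv xi (mxact (opP X x) xi)
             <= C1 * dotv xi (mxact (Q x) xi)}],
      forall i, subunit Q Theta (opR X i) /\ subunit Q Theta (opS X i),
      forall i, measurable_fun Theta (opG X i) /\ measurable_fun Theta (opH X i)
    & measurable_fun Theta (opF X)].

Definition bilinear_form (u v : (Rn -> R) * (Rn -> Rn)) : R :=
  \int[mu]_(x in Theta)
    (dotv (v.2 x) (mxact (opP X x) (u.2 x))
     + v.1 x * tapp (opH X) (opR X) u x
     + u.1 x * tapp (opG X) (opS X) v x
     + opF X x * u.1 x * v.1 x).

Definition negativity_condition : Prop :=
  exists2 eps : R, 0 < eps &
    (forall u v, QH1 Q Theta u -> QH1 Q Theta v ->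
       {ae mu, forall x, Theta x -> 0 <= u.1 x * v.1 x} ->
       eps * \int[mu]_(x in Theta) (u.1 x * v.1 x) <=
       \int[mu]_(x in Theta)
         (opF X x * u.1 x * v.1 x + tapp_mul (opG X) (opS X) u v x))
    \/
    (forall u v, QH1 Q Theta u -> QH1 Q Theta v ->
       {ae mu, forall x, Theta x -> 0 <= u.1 x * v.1 x} ->
       eps * \int[mu]_(x in Theta) (u.1 x * v.1 x) <=
       \int[mu]_(x in Theta)
         (opF X x * u.1 x * v.1 x + tapp_mul (opH X) (opR X) u v x)).

Definition neumann_data (f : Rn -> R) (K : nat)
    (T : 'I_K -> Rn -> Rn) (g : 'I_K -> Rn -> R) : Prop :=
  [/\ Lp_on Theta 2%:E f, forall i, subunit Q Theta (T i)
    & forall i, Lp_on Theta 2%:E (g i)].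

Definition weak_solution (f : Rn -> R) (K : nat)
    (T : 'I_K -> Rn -> Rn) (g : 'I_K -> Rn -> R)
    (u : (Rn -> R) * (Rn -> Rn)) : Prop :=
  QH1 Q Theta u /\ forall v, QH1 Q Theta v ->
    bilinear_form u v = \int[mu]_(x in Theta) (f x * v.1 x + tapp g T v x).

(* weak solution of the same problem for X - lambda *)
Definition weak_solution_shift (lambda : R) (f : Rn -> R) (K : nat)
    (T : 'I_K -> Rn -> Rn) (g : 'I_K -> Rn -> R)
    (u : (Rn -> R) * (Rn -> Rn)) : Prop :=
  QH1 Q Theta u /\ forall v, QH1 Q Theta v ->
    bilinear_form u v = \int[mu]_(x in Theta)
      (lambda * u.1 x * v.1 x + f x * v.1 x + tapp g T v x).

Definition unique_in_QH1 (P : set ((Rn -> R) * (Rn -> Rn))) : Prop :=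
  exists2 u, P u & forall u', P u' -> QH1_eq Q Theta u u'.

Definition real_eigenvalues : set R :=
  [set lambda | ~ (forall f K (T : 'I_K -> Rn -> Rn) g,
     neumann_data f T g ->
     unique_in_QH1 (weak_solution_shift lambda f T g))].

End neumann_problem.

(* Main.v *)
From HB Require Import structures.
From mathcomp Require Import all_boot all_order all_algebra.
From mathcomp Require Import complex.
From mathcomp Require Import all_classical all_reals all_analysis.
From mathcomp Require Import measurable_realfun ess_sup_inf.
From mathcomp Require Import ring lra.
Require Import Defs.

Set Implicit Arguments.
Unset Strict Implicit.
Unset Printing Implicit Defensive.
Import Order.TTheory GRing.Theory Num.Theory.
Import numFieldNormedType.Exports.

Local Open Scope classical_set_scope.
Local Open Scope ring_scope.

(** The energy of a pair is [int (u^2 + <grad u, Q grad u>)], the square of a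
    norm with inner product [ip u v = int (u v + <grad u, Q grad v>)]. The
    space of pairs [QH1] is complete for it ([QH1_complete]): a fast Cauchy
    sequence converges pointwise almost everywhere modulo the kernel of [Q
    x], and a measurable representative of the limit gradient comes from
    Tikhonov regularization ([kernel_limitP], [measurable_tikhonov]). So the
    Riesz representation theorem holds in [QH1], and the bilinear form of
    the operator is bounded there: the global Poincare inequality with gain
    [omega] controls [int w u^2] by the energy for every weight [w] in
    [L^p], [p = omega / (omega - 1)] ([weight_QH1]), and the integrability
    assumptions put [w = |F| + (sum (|G| + |H|))^2] in this class.

    It is enough to treat the negativity condition in the form that involves [H]
    and [R]: exchanging the pairs [(H, R)] and [(G, S)] transposes the
    bilinear form and exchanges the two alternatives, while unique
    solvability with a lower bound passes to the transposed form
    ([bounded_below_transpose], [solvable_transpose]). The form then reads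
    [int <grad v, P grad u> + N(u, v) + int u (G S - H R) v], where [N(u, v)
    >= eps int u v] whenever [u v >= 0].

    The solution is reached by continuation along the forms [(1 - s) ip + s L],
    [0 <= s <= 1], starting from Riesz at [s = 0]; the number of steps is
    finite because the lower bound is uniform in [s]
    ([solvable_continuation]). The lower bound is an a priori estimate
    ([a_priori_bound]). Suppose that [u] tested against every [v] gives at
    most the norm of [v]. Testing with [v = atan u], which lies in [QH1] by
    the chain rule, makes the drift term harmless, since [w u^2 / (1 + u^2)
    <= w] is integrable; together with the negativity condition this bounds
    the measure of the sets [|u| > K] uniformly ([superlevel_bound]).
    Testing with [v = u] then leaves [int w u^2] to absorb, for the same
    [w]: where [w] or [|u|] is large, the restricted weight is small in
    [L^p] and its contribution is a small multiple of the energy; elsewhere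
    the integrand is bounded.

    This gives existence, the estimate, and hence uniqueness ([well_posed]); the
    right-hand side of the Neumann problem is a bounded functional whose
    norm carries the factor [sqrt K] ([I_data_bound], [data_norm]). *)

(** * Nonnegative symmetric matrices *)

Section quadratic_form.
Context {R : realType} {n : nat}.
Implicit Types (A : 'M[R]_n.+1) (u v w : 'rV[R]_n.+1).

Definition qform A u v : R := dotv u (mxact A v).

Lemma mxactE A v : mxact A v = v *m A^T.
Proof. by rewrite /mxact trmx_mul trmxK. Qed.

Lemma dotvE u v : dotv u v = (u *m v^T) 0 0.
Proof. by rewrite /dotv !mxE; apply: eq_bigr => i _; rewrite !mxE. Qed.

Lemma dotvC u v : dotv u v = dotv v u.
Proof. by apply: eq_bigr => i _; rewrite mulrC. Qed.

Lemma dotvDl u v w : dotv (u + v) w = dotv u w + dotv v w.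
Proof. by rewrite !dotvE mulmxDl mxE. Qed.

Lemma dotvZl a u v : dotv (a *: u) v = a * dotv u v.
Proof. by rewrite !dotvE -scalemxAl mxE. Qed.

Lemma dotvDr u v w : dotv w (u + v) = dotv w u + dotv w v.
Proof. by rewrite !(dotvC w) dotvDl. Qed.

Lemma dotvZr a u v : dotv v (a *: u) = a * dotv v u.
Proof. by rewrite !(dotvC v) dotvZl. Qed.

Lemma dotv_ge0 v : 0 <= dotv v v.
Proof. by apply: sumr_ge0 => i _; rewrite -expr2 sqr_ge0. Qed.

Lemma dotv_eq0 v : dotv v v = 0 -> v = 0.
Proof.
move=> /eqP; rewrite psumr_eq0; last by move=> i _; rewrite -expr2 sqr_ge0.
move=> /allP v0; apply/rowP => i; rewrite mxE; apply/eqP.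
by have := v0 i (mem_index_enum _); rewrite -expr2 sqrf_eq0.
Qed.

Lemma sqr_enorm v : enorm v ^+ 2 = dotv v v.
Proof. by rewrite /enorm sqr_sqrtr ?dotv_ge0. Qed.

Lemma qformE A u v : qform A u v = \sum_i \sum_j u 0 i * A i j * v 0 j.
Proof.
rewrite /qform /dotv; apply: eq_bigr => i _; rewrite !mxE mulr_sumr.
by apply: eq_bigr => j _; rewrite !mxE mulrA.
Qed.

Lemma qformDl A u v w : qform A (u + v) w = qform A u w + qform A v w.
Proof. exact: dotvDl. Qed.

Lemma qformZl A a u v : qform A (a *: u) v = a * qform A u v.
Proof. exact: dotvZl. Qed.

Lemma qformDr A u v w : qform A w (u + v) = qform A w u + qform A w v.
Proof. by rewrite /qform !mxactE mulmxDl dotvDr. Qed.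

Lemma qformZr A a u v : qform A v (a *: u) = a * qform A v u.
Proof. by rewrite /qform !mxactE -scalemxAl dotvZr. Qed.

Lemma qformNl A u v : qform A (- u) v = - qform A u v.
Proof. by rewrite -scaleN1r qformZl mulN1r. Qed.

Lemma qformNr A u v : qform A v (- u) = - qform A v u.
Proof. by rewrite -scaleN1r qformZr mulN1r. Qed.

Lemma dotv_mulmx A u v : dotv (u *m A) v = dotv u (v *m A^T).
Proof. by rewrite !dotvE trmx_mul trmxK mulmxA. Qed.

Lemma qformC A u v : A^T = A -> qform A u v = qform A v u.
Proof. by move=> sA; rewrite /qform !mxactE sA dotvC dotv_mulmx sA. Qed.

Lemma qform_ge0 A v : nonneg_sym A -> 0 <= qform A v v.
Proof. by case=> _; apply. Qed.

Lemma trinomial_ge0 (a b c : R) : 0 <= a ->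
  (forall t : R, 0 <= a * t ^+ 2 + 2 * b * t + c) -> b ^+ 2 <= a * c.
Proof.
rewrite le_eqVlt => /predU1P[<-|a_gt0] ge0.
  have [->|b0] := eqVneq b 0; first by rewrite mul0r expr0n.
  have := ge0 (- (c + 1) / (2 * b)).
  rewrite mul0r add0r [2 * b * _]mulrC divfK ?mulf_neq0// opprD addrAC addNr.
  by rewrite add0r oppr_ge0 ler10.
have := ge0 (- b / a).
have -> : a * (- b / a) ^+ 2 + 2 * b * (- b / a) + c = c - b ^+ 2 / a.
  by field; rewrite gt_eqF.
by rewrite subr_ge0 ler_pdivrMr// mulrC.
Qed.

Lemma qform_trinomial A u v t : nonneg_sym A ->
  qform A (t *: u + v) (t *: u + v) =
  qform A u u * t ^+ 2 + 2 * qform A u v * t + qform A v v.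
Proof.
move=> [sA _]; rewrite !(qformDl, qformDr, qformZl, qformZr).
by rewrite (qformC v u sA); ring.
Qed.

Lemma qform_cauchy_schwarz A u v : nonneg_sym A ->
  qform A u v ^+ 2 <= qform A u u * qform A v v.
Proof.
move=> pA; apply: trinomial_ge0 => [|t]; first exact: qform_ge0.
by rewrite -qform_trinomial//; exact: qform_ge0.
Qed.

Lemma qform_amgm A u v : nonneg_sym A ->
  `|qform A u v| <= (qform A u u + qform A v v) / 2.
Proof.
move=> pA; rewrite ler_norml.
have := qform_ge0 (1 *: u + v) pA; rewrite qform_trinomial//.
have := qform_ge0 (-1 *: u + v) pA; rewrite qform_trinomial//.
by move=> h1 h2; apply/andP; split; lra.
Qed.

Lemma qform_le_diag A u v : nonneg_sym A ->
  qform A (u + v) (u + v) <= 2 * qform A u u + 2 * qform A v v.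
Proof.
move=> pA; have := qform_ge0 (-1 *: u + v) pA; rewrite qform_trinomial//.
by have := qform_trinomial u v 1 pA; rewrite scale1r => ->; lra.
Qed.

End quadratic_form.

Section square_root.
Context {R : realType}.

(** A new node [a] is fitted by a multiple of the polynomial that vanishes at
    the earlier nodes. *)
Lemma interpolation (h : R -> R) (s : seq R) :
  exists p : {poly R}, forall x, x \in s -> p.[x] = h x.
Proof.
elim: s => [|a s [p ph]]; first by exists 0.
have [as_|as_] := boolP (a \in s).
  by exists p => x; rewrite inE => /predU1P[->|]; exact: ph.
pose w : {poly R} := \prod_(y <- s) ('X - y%:P).
have wE x : (w.[x] == 0) = (x \in s) by rewrite -root_prod_XsubC.
have wa : w.[a] != 0 by rewrite wE.
exists (p + ((h a - p.[a]) / w.[a]) *: w) => x; rewrite inE hornerD hornerZ.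
case/predU1P => [->|xs]; first by rewrite divfK// addrC subrK.
by have := wE x; rewrite xs => /eqP ->; rewrite mulr0 addr0 ph.
Qed.

Context {n : nat}.
Implicit Types (A : 'M[R]_n.+1).
Local Notation toC := (complex.real_complex R).

(** The spectral theorem for the complexification of [A], a Hermitian matrix:
    its eigenvalues are real, and the change of basis may stay complex. *)
Lemma sym_diagonalization A : A^T = A ->
  exists (P : 'M[complex.complex R]_n.+1) (d : 'rV[R]_n.+1),
    P \in unitmx /\
    map_mx toC A = invmx P *m diag_mx (map_mx toC d) *m P.
Proof.
move=> sA; pose B := map_mx toC A.
have Breal : B \is a mxOver Num.real.
  apply/mxOverP => i j; rewrite mxE; apply/complex.complex_realP.
  by exists (A i j).
have Bherm : B \is hermsymmx.
  apply: realsym_hermsym => //; apply/is_hermitianmxP.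
  by rewrite expr0 scale1r map_mx_id// /B map_trmx sA.
have /orthomx_spectralP BE := hermitian_normalmx Bherm.
have /mxOverP Dreal := hermitian_spectral_diag_real Bherm.
exists (spectralmx B), (map_mx (@complex.Re R) (spectral_diag B)).
split; first exact: spectral_unit.
apply: (etrans BE).
apply: (congr1 (fun D => invmx (spectralmx B) *m diag_mx D *m spectralmx B)).
apply/rowP => j; rewrite mxE mxE.
by have /complex.complex_realP[x ->] := Dreal 0 j.
Qed.

(** Polynomial evaluation commutes with conjugation by [P] and acts entrywise
    on diagonal matrices. *)
Lemma map_horner_mx_diag (F : fieldType) (f : {rmorphism R -> F}) A P
    (d : 'rV[R]_n.+1) (p : {poly R}) :
  P \in unitmx -> map_mx f A = invmx P *m diag_mx (map_mx f d) *m P ->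
  map_mx f (horner_mx A p) =
    invmx P *m diag_mx (map_mx f (map_mx (horner p) d)) *m P.
Proof.
move=> Pu AE; rewrite map_horner_mx AE horner_mx_uconjC// horner_mx_diag.
apply: (congr1 (fun D => invmx P *m diag_mx D *m P)).
by apply/rowP => j; rewrite !mxE horner_map.
Qed.

(** Although [P] is complex, the real eigenvalue [d 0 j] has a real eigenvector,
    on which the quadratic form takes its sign. *)
Lemma eigen_ge0 A P (d : 'rV[R]_n.+1) : nonneg_sym A ->
  P \in unitmx -> map_mx toC A = invmx P *m diag_mx (map_mx toC d) *m P ->
  forall j, 0 <= d 0 j.
Proof.
move=> [sA pA] Pu AE j; rewrite leNgt; apply/negP => dj.
have : \det (horner_mx A ('X - (d 0 j)%:P)) = 0.
  apply: (@complex.complexI R); rewrite -det_map_mx.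
  rewrite (map_horner_mx_diag _ Pu AE).
  have : map_mx toC (map_mx (horner ('X - (d 0 j)%:P)) d) 0 j = 0.
    by rewrite mxE mxE hornerXsubC subrr.
  move: (map_mx toC _) => e ej.
  have e0 : \det (diag_mx e) = 0 by rewrite det_diag (bigD1 j)//= ej mul0r.
  by rewrite det_mulmx det_mulmx e0 mulr0 mul0r.
move/eqP/det0P => [v v0].
rewrite rmorphB /= horner_mx_X horner_mx_C mulmxBr mul_mx_scalar.
move/eqP; rewrite subr_eq0 => /eqP vA.
have := pA v; rewrite mxactE sA vA dotvZr leNgt => /negP; apply.
by rewrite pmulr_llt0// lt_def dotv_ge0 andbT; apply: contra_neq v0 => /dotv_eq0.
Qed.

Lemma horner_mx_tr A (p : {poly R}) : A^T = A ->
  (horner_mx A p)^T = horner_mx A p.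
Proof.
move=> sA; elim/poly_ind: p => [|p c IH]; first by rewrite rmorph0 trmx0.
rewrite rmorphD rmorphM /= horner_mx_X horner_mx_C linearD /= tr_scalar_mx.
rewrite [X in X^T + _](_ : _ = horner_mx A p *m A)// trmx_mul IH sA.
congr (_ + _); have := comm_mx_horner p (erefl (A *m A)).
by rewrite /comm_mx => ->.
Qed.

(** A real polynomial [r] with [r(x) = x^(1/4)] on the spectrum of [A] gives the
    square root [r(A)^2], and [<v, r(A)^2 v> = |r(A) v|^2 >= 0]. *)
Lemma sqrtmxP A : nonneg_sym A ->
  nonneg_sym (sqrtmx A) /\ sqrtmx A *m sqrtmx A = A.
Proof.
move=> pA; have [sA _] := pA.
suff ex : exists S, nonneg_sym S /\ S *m S = A.
  exact: (@xgetPex _ 0 [set S | nonneg_sym S /\ S *m S = A] ex).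
have [P [d [Pu AE]]] := sym_diagonalization sA.
have d0 := eigen_ge0 pA Pu AE.
pose h (x : R) := Num.sqrt (Num.sqrt x).
have [r rh] := interpolation h [seq d 0 j | j <- enum 'I_n.+1].
have rd j : r.[d 0 j] = h (d 0 j) by apply/rh/map_f/mem_enum.
pose B := horner_mx A r; have sB : B^T = B by exact: horner_mx_tr.
exists (B *m B); split.
  split=> [|v]; first by rewrite trmx_mul sB.
  by rewrite mxactE trmx_mul sB mulmxA -{2}sB -dotv_mulmx dotv_ge0.
have -> : B *m B *m (B *m B) = horner_mx A ((r * r) * (r * r)).
  by rewrite !rmorphM.
apply: (@map_mx_inj _ _ toC).
rewrite (map_horner_mx_diag _ Pu AE); apply: (etrans _ (esym AE)).
apply: (congr1 (fun D => invmx P *m diag_mx (map_mx toC D) *m P)).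
apply/rowP => j; rewrite mxE !hornerM rd.
have hh : h (d 0 j) * h (d 0 j) = Num.sqrt (d 0 j).
  by rewrite -expr2 sqr_sqrtr// sqrtr_ge0.
by rewrite hh -expr2 sqr_sqrtr.
Qed.

Lemma sqr_enorm_sqrtmx A (v : 'rV[R]_n.+1) : nonneg_sym A ->
  enorm (mxact (sqrtmx A) v) ^+ 2 = qform A v v.
Proof.
move=> pA; have [[sS _] SS] := sqrtmxP pA.
by rewrite sqr_enorm /qform !mxactE dotv_mulmx trmxK -mulmxA sS SS pA.1.
Qed.

End square_root.

(** * Measurable limits modulo the kernel of a degenerate matrix *)

Section limit_modulo_kernel.
Context {R : realType} {n : nat}.
Implicit Types (A : 'M[R]_n.+1) (u v w : 'rV[R]_n.+1).

Lemma qform_mulmx A u v : A^T = A -> qform A u v = dotv u (v *m A).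
Proof. by move=> sA; rewrite /qform mxactE sA. Qed.

(** The range and the kernel of a symmetric matrix are orthogonal, hence
    complementary by a count of dimensions. *)
Lemma range_plus_kernel A v : A^T = A ->
  exists a w, v = a *m A + w /\ w *m A = 0.
Proof.
move=> sA.
have capA : (A :&: kermx A)%MS = 0.
  apply/eqP; rewrite -submx0; apply/rV_subP => x.
  rewrite sub_capmx => /andP[/submxP[b xb] /sub_kermxP xA].
  suff -> : x = 0 by rewrite sub0mx.
  by apply: dotv_eq0; rewrite {1}xb dotv_mulmx sA xA -(scale0r 0) dotvZr mul0r.
have full : (v <= A + kermx A)%MS.
  apply: submx_full; apply/eqP.
  have := mxrank_sum_cap A (kermx A); rewrite capA mxrank0 addn0 => ->.
  by rewrite mxrank_ker subnKC// rank_leq_row.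
have [[a b] ->] := sub_addsmxP full; exists a, (b *m kermx A); split => //.
by rewrite -mulmxA mulmx_ker mulmx0.
Qed.

(** Tikhonov approximations of the minimal solution [w] of [w A = v]: rational
    functions of the entries of [A] and [v], hence measurable in them. *)
Definition tikhonov A v (m : nat) := v *m invmx (A + (m.+1%:R^-1)%:M).

Lemma unit_shift A (e : R) : nonneg_sym A -> 0 < e -> A + e%:M \in unitmx.
Proof.
move=> [sA pA] e0; rewrite unitmxE unitfE; apply/negP => /det0P[x x0].
rewrite mulmxDr mul_mx_scalar => xA.
have : dotv x (x *m A + e *: x) = 0 by rewrite xA -(scale0r 0) dotvZr mul0r.
rewrite dotvDr dotvZr => /eqP.
have := pA x; rewrite mxactE sA => xAx.
rewrite paddr_eq0// ?mulr_ge0 ?dotv_ge0 ?ltW// => /andP[_].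
by rewrite mulf_eq0 gt_eqF//= => /eqP/dotv_eq0/eqP; rewrite (negbTE x0).
Qed.

Lemma sqr_coord_le v j : (v 0 j) ^+ 2 <= dotv v v.
Proof.
rewrite /dotv (bigD1 j)//= -expr2 lerDl.
by apply: sumr_ge0 => i _; rewrite -expr2 sqr_ge0.
Qed.

(** If [y (A + e) = a], the error is [- e y A], and [|y A| <= |a|] since [A >=
    0] makes the cross term of [|y A + e y|^2] nonnegative. *)
Lemma tikhonov_error A (e : R) (a : 'rV[R]_n.+1) j : nonneg_sym A -> 0 < e ->
  `|((a *m A *m A) *m invmx (A + e%:M) - a *m A) 0 j| <= e * enorm a.
Proof.
move=> pA e0; have U := unit_shift pA e0; have [sA _] := pA.
set B := A + _ in U *; pose y := a *m invmx B.
have yB : y *m A + e *: y = a.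
  by rewrite -mul_mx_scalar -mulmxDr -/B mulmxKV.
have comAB : A *m invmx B = invmx B *m A.
  apply: (canRL (mulKmx U)); rewrite mulmxA; apply: (canLR (mulmxK U)).
  by rewrite /B mulmxDr mulmxDl mul_mx_scalar mul_scalar_mx.
have -> : a *m A *m A *m invmx B - a *m A = - (e *: (y *m A)).
  rewrite -mulmxA comAB -mulmxA [A *m (_ *m A)]mulmxA comAB !mulmxA -/y.
  by rewrite -[in X in _ - X]yB mulmxDl -scalemxAl opprD addNKr.
rewrite mxE normrN mxE normrM gtr0_norm// ler_pM2l//.
rewrite -sqrtr_sqr ler_sqrt ?dotv_ge0//.
apply: (le_trans (sqr_coord_le _ _)); rewrite -[in leRHS]yB.
rewrite !(dotvDl, dotvDr, dotvZl, dotvZr) -addrA lerDl.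
have yAy : 0 <= dotv y (y *m A) by rewrite -qform_mulmx// qform_ge0.
have e0' := ltW e0; rewrite (dotvC (y *m A) y).
by rewrite !(addr_ge0, mulr_ge0, dotv_ge0).
Qed.

Lemma tikhonov_cvg A v : nonneg_sym A -> (v <= A)%MS ->
  exists2 w, w *m A = v & forall j, tikhonov A v m 0 j @[m --> \oo] --> w 0 j.
Proof.
move=> pA /submxP[z ->]; have [sA _] := pA.
have [a [w [-> wA]]] := range_plus_kernel z sA.
exists (a *m A) => [|j]; first by rewrite mulmxDl wA addr0.
rewrite mulmxDl wA addr0.
apply/cvgrPdist_le => /= e e0.
have lim0 : m.+1%:R^-1 * enorm a @[m --> \oo] --> (0 : R).
  rewrite -(mul0r (enorm a)); apply: cvgMl; exact: cvg_harmonic.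
have /cvgrPdist_le/(_ e e0) := lim0; apply: filterS => m.
rewrite sub0r normrN ger0_norm ?mulr_ge0 ?sqrtr_ge0//.
apply: le_trans; rewrite distrC; have := @tikhonov_error A (m.+1%:R^-1) a j pA.
by rewrite invr_gt0 ltr0Sn => /(_ isT); rewrite [X in `|X|]mxE [X in _ + X]mxE.
Qed.

Lemma cvg_mulmx p (x : nat -> 'rV[R]_n.+1) (y : 'rV[R]_n.+1) (M : 'M[R]_(n.+1, p)) i :
  (forall j, x k 0 j @[k --> \oo] --> y 0 j) ->
  (x k *m M) 0 i @[k --> \oo] --> (y *m M) 0 i.
Proof.
move=> xy; rewrite mxE.
under eq_cvg do rewrite mxE.
by apply: cvg_big => [|j _]; [exact: add_continuous | exact: cvgMl].
Qed.

Lemma cvg_dotv (x : nat -> 'rV[R]_n.+1) (y v : 'rV[R]_n.+1) :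
  (forall j, x k 0 j @[k --> \oo] --> y 0 j) ->
  dotv v (x k) @[k --> \oo] --> dotv v y.
Proof.
by move=> xy; apply: cvg_big => [|j _]; [exact: add_continuous | exact: cvgMr].
Qed.

(** The range of [A] is the kernel of its cokernel matrix, a closed condition.
    *)
Lemma cvg_in_range A (z : nat -> 'rV[R]_n.+1) (y : 'rV[R]_n.+1) :
  (forall j, (z k *m A) 0 j @[k --> \oo] --> y 0 j) -> (y <= A)%MS.
Proof.
move=> zy; rewrite submxE; apply/eqP/rowP => i.
rewrite [RHS]mxE; have := @cvg_mulmx _ _ _ (cokermx A) i zy.
under eq_cvg do rewrite -mulmxA mulmx_coker mulmx0 mxE.
by move=> /cvg_lim <- //; rewrite lim_cst.
Qed.

(** The limit of [z k] modulo the kernel of [A], for the seminorm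
    [sqrt <z, A z>]: [z k A] converges to a [y] in the range of [A], and the
    minimal solution of [w A = y] is chosen. *)
Definition kernel_limit A (z : nat -> 'rV[R]_n.+1) : 'rV[R]_n.+1 :=
  \row_j limn (fun m =>
    tikhonov A (\row_i limn (fun k => (z k *m A) 0 i)) m 0 j).

(** The sequence need not converge, but [z k A] does, by the Cauchy-Schwarz
    inequality for [<., A .>]. Writing [q] for this form and [w] for the limit,
    the rate passes to the limit in [l] of [q (z k - w) <= q (z k - z l) + 2 <z
    k - w, A (z l - w)>], where the last term vanishes because [z l A] tends to
    [w A]. *)
Lemma kernel_limitP A (z : nat -> 'rV[R]_n.+1) : nonneg_sym A ->
  (forall e : R, 0 < e -> exists K, forall k l, (K <= k)%N -> (K <= l)%N ->
     qform A (z k - z l) (z k - z l) <= e) ->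
  (forall i, cvgn (fun k => (z k *m A) 0 i)) /\
  (forall j, cvgn (fun m => tikhonov A
     (\row_i limn (fun k => (z k *m A) 0 i)) m 0 j)) /\
  (forall k e, (forall l, (k <= l)%N ->
       qform A (z k - z l) (z k - z l) <= e) ->
     qform A (z k - kernel_limit A z) (z k - kernel_limit A z) <= e).
Proof.
move=> pA cauchy; have [sA _] := pA.
have cvgzA i : cvgn (fun k => (z k *m A) 0 i).
  apply/cauchy_cvgP/cauchy_exP => e e0.
  have D0 : 0 <= qform A (delta_mx 0 i) (delta_mx 0 i) by exact: qform_ge0.
  set D := qform A _ _ in D0.
  have [K HK] := cauchy ((e / 2) ^+ 2 / (D + 1)) ltac:(by
    rewrite divr_gt0 ?exprn_gt0 ?divr_gt0// ltr_wpDl).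
  exists ((z K *m A) 0 i); exists K => // k /= Kk.
  rewrite /ball /=.
  have -> : (z K *m A) 0 i - (z k *m A) 0 i = qform A (delta_mx 0 i) (z K - z k).
    rewrite qform_mulmx// mulmxBl /dotv (bigD1 i)//= big1 ?addr0.
      by rewrite !mxE !eqxx mul1r.
    by move=> j ji; rewrite [delta_mx _ _ _ _]mxE (negbTE ji) andbF mul0r.
  apply: (@le_lt_trans _ _ (e / 2)); last by rewrite ltr_pdivrMr// ltr_pMr// ltr1n.
  have e20 : 0 <= e / 2 by rewrite divr_ge0// ltW.
  rewrite -ler_sqr ?nnegrE// real_normK ?num_real//.
  apply: (le_trans (qform_cauchy_schwarz _ _ pA)).
  apply: (@le_trans _ _ (D * ((e / 2) ^+ 2 / (D + 1)))).
    by rewrite ler_wpM2l// HK.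
  rewrite mulrCA ler_piMr ?exprn_ge0// ler_pdivrMr ?ltr_wpDl//.
  by rewrite mul1r lerDl.
set y := \row_i limn (fun k => (z k *m A) 0 i).
have zy i : (z k *m A) 0 i @[k --> \oo] --> y 0 i by rewrite mxE; exact: cvgzA.
have [w wA wcvg] := tikhonov_cvg pA (cvg_in_range zy).
split=> //; split=> [j|k e He]; first by apply/cvg_ex; exists (w 0 j).
have -> : kernel_limit A z = w.
  by apply/rowP => j; rewrite mxE; apply/cvg_lim => //; exact: wcvg.
set x := z k - w.
have lim : e + 2 * dotv x ((z l - w) *m A) @[l --> \oo] --> (e + 2 * dotv x 0).
  apply: cvgD; first exact: cvg_cst.
  apply: cvgMr; apply: cvg_dotv => j.
  rewrite mxE -(subrr ((w *m A) 0 j)).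
  under eq_cvg do rewrite mulmxBl mxE [X in _ + X]mxE.
  apply: cvgB; last exact: cvg_cst.
  by rewrite wA; exact: zy.
rewrite -(scale0r 0) dotvZr mul0r mulr0 addr0 in lim.
apply: (ler_cvg_to (cvg_cst _) lim).
exists k => // l /= kl.
have -> : e + 2 * dotv x ((z l - w) *m A) = e + 2 * qform A x (z l - w).
  by rewrite qform_mulmx.
have := He l kl; have := qform_ge0 (z l - w) pA.
have -> : z k - z l = x + (-1) *: (z l - w).
  by rewrite scaleN1r opprB /x addrA subrK.
clear lim; clearbody x; move: (z l - w) => x'; rewrite !(qformDl, qformDr, qformZl, qformZr).
by rewrite (qformC x' x sA); lra.
Qed.

End limit_modulo_kernel.

Section measurable_inverse.
Context d (T : measurableType d) (R : realType) (n : nat).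
Variable D : set T.

Lemma measurable_det m (A : T -> 'M[R]_m) :
  (forall i j, measurable_fun D (fun x => A x i j)) ->
  measurable_fun D (fun x => \det (A x)).
Proof.
move=> mA; apply: measurable_sum => s; apply: measurable_funM => //.
by apply: measurable_prod => i _; exact: mA.
Qed.

Lemma measurable_funV (f : T -> R) : measurable_fun D f ->
  (forall x, D x -> f x != 0) -> measurable_fun D (fun x => (f x)^-1).
Proof.
move=> mf f0.
apply: (@measurable_comp _ _ _ _ _ _ [set y : R | y != 0] GRing.inv) => //.
- exact: open_measurable.
- by move=> _ [x Dx <-]; exact: f0.
apply: open_continuous_measurable_fun => // y.
by rewrite inE => y0; exact: inv_continuous.
Qed.

(** By Cramer's rule. *)
Lemma measurable_tikhonov (A : T -> 'M[R]_n.+1) (y : T -> 'rV[R]_n.+1) m j :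
  (forall x, D x -> nonneg_sym (A x)) ->
  (forall i j, measurable_fun D (fun x => A x i j)) ->
  (forall i, measurable_fun D (fun x => y x 0 i)) ->
  measurable_fun D (fun x => tikhonov (A x) (y x) m 0 j).
Proof.
move=> pA mA my; pose B x := A x + (m.+1%:R^-1)%:M.
have Bu x : D x -> B x \in unitmx.
  by move=> Dx; apply: unit_shift; [exact: pA | rewrite invr_gt0 ltr0n].
have mB i k : measurable_fun D (fun x => B x i k).
  rewrite (_ : (fun _ => _) = fun x => A x i k + (m.+1%:R^-1)%:M i k).
    exact: measurable_funD.
  by apply/funext => x; rewrite mxE.
apply: (@eq_measurable_fun _ _ _ _ _ (fun x =>
    \sum_k y x 0 k * ((\det (B x))^-1 * cofactor (B x) j k))).
  move=> x /[!inE] Dx; rewrite /tikhonov mxE; apply: eq_bigr => k _.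
  by rewrite /invmx ifT ?Bu// !mxE.
apply: measurable_sum => k; apply: measurable_funM => //.
apply: measurable_funM.
  apply: measurable_funV; first exact: measurable_det.
  by move=> x Dx; rewrite -unitfE -unitmxE Bu.
apply: measurable_funM => //; apply: measurable_det => i l.
by under eq_fun do rewrite mxE mxE; exact: mB.
Qed.

End measurable_inverse.

(** * Continuation of solvability along a path of bilinear forms *)

Section hilbert.
Context {R : realType} {V : lmodType R}.
Variable ip : V -> V -> R.

Definition linear_form (l : V -> R) : Prop :=
  forall c u v, l (c *: u + v) = c * l u + l v.

Definition bilinear (a : V -> V -> R) : Prop :=
  (forall w, linear_form (a^~ w)) /\ (forall w, linear_form (a w)).

Definition ipnorm (u : V) : R := Num.sqrt (ip u u).

Definition bounded_form (a : V -> V -> R) (M : R) : Prop :=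
  forall u v, `|a u v| <= M * ipnorm u * ipnorm v.

(** Lower bound, with constant [C^-1], of the operator that [a] induces into
    the dual space. *)
Definition bounded_below (a : V -> V -> R) (C : R) : Prop :=
  forall u K, 0 <= K -> (forall v, `|a u v| <= K * ipnorm v) ->
    ipnorm u <= C * K.

Definition solvable_form (a : V -> V -> R) : Prop :=
  forall l, linear_form l -> (exists M, forall v, `|l v| <= M * ipnorm v) ->
    exists u, forall v, a u v = l v.

Lemma linear_form0 l : linear_form l -> l 0 = 0.
Proof. by move=> ll; have := ll (-1) 0 0; rewrite scaler0 addr0 mulN1r addNr. Qed.

Lemma linear_formZ l c u : linear_form l -> l (c *: u) = c * l u.
Proof. by move=> ll; have := ll c u 0; rewrite addr0 linear_form0 ?addr0. Qed.

Lemma linear_formB l u v : linear_form l -> l (u - v) = l u - l v.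
Proof.
by move=> ll; rewrite addrC -scaleN1r ll mulN1r addrC.
Qed.

Hypothesis ipC : forall u v, ip u v = ip v u.
Hypothesis ip_lin : forall w, linear_form (ip^~ w).
Hypothesis ip_ge0 : forall u, 0 <= ip u u.
(** Completeness along sequences with geometrically small increments, for a
    form that may be degenerate: vectors at distance [0] are not identified. *)
Hypothesis ip_complete : forall (z : nat -> V) (S : R),
  (forall j, ip (z j.+1 - z j) (z j.+1 - z j) <= S / 16 ^+ j) ->
  exists l, ip (z j - l) (z j - l) @[j --> \oo] --> (0 : R).

Lemma ip_linr w : linear_form (ip w).
Proof. by move=> c u v; rewrite !(ipC w) ip_lin. Qed.

Lemma ip_trinomial u v t :
  ip (t *: u + v) (t *: u + v) = ip u u * t ^+ 2 + 2 * ip u v * t + ip v v.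
Proof. by rewrite ip_lin !ip_linr (ipC v u); ring. Qed.

Lemma ip_cauchy_schwarz_sq u v : ip u v ^+ 2 <= ip u u * ip v v.
Proof. by apply: trinomial_ge0 => // t; rewrite -ip_trinomial. Qed.

Lemma ipnorm_ge0 u : 0 <= ipnorm u. Proof. exact: sqrtr_ge0. Qed.

Lemma sqr_ipnorm u : ipnorm u ^+ 2 = ip u u. Proof. exact: sqr_sqrtr. Qed.

Lemma ip_cauchy_schwarz u v : `|ip u v| <= ipnorm u * ipnorm v.
Proof.
rewrite -ler_sqr ?nnegrE ?mulr_ge0 ?ipnorm_ge0// exprMn !sqr_ipnorm.
by rewrite real_normK ?num_real// ip_cauchy_schwarz_sq.
Qed.

Lemma ipnormBC u v : ipnorm (u - v) = ipnorm (v - u).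
Proof.
have -> : u - v = -1 *: (v - u) by rewrite scaleN1r opprB.
congr Num.sqrt; set w := v - u.
have /= -> := linear_formZ (-1) w (ip_lin (-1 *: w)).
by have /= -> := linear_formZ (-1) w (ip_linr w); rewrite !mulN1r opprK.
Qed.

Lemma cvg_ipnorm (z : nat -> V) l :
  ip (z j - l) (z j - l) @[j --> \oo] --> (0 : R) ->
  ipnorm (z j - l) @[j --> \oo] --> (0 : R).
Proof.
move=> zl; rewrite -(@sqrtr0 R).
exact: (@continuous_cvg _ _ _ _ _ _ (@Num.sqrt R) _ (@sqrt_continuous R 0) zl).
Qed.

(** Minimize [J u = <u, u> - 2 l u]. The parallelogram identity makes a
    minimizing sequence of rate [16^-k] fast Cauchy, and the discriminant of [t
    |-> J (t v + u) - inf J] bounds [<v, u> - l v] by the defect [J u - inf J].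
    *)
Lemma riesz : solvable_form ip.
Proof.
move=> l ll [M lM].
pose J u := ip u u - 2 * l u.
have Jge u : - M ^+ 2 <= J u.
  rewrite /J -sqr_ipnorm; have := lM u; rewrite ler_norml => /andP[_ lu].
  by have := sqr_ge0 (M - ipnorm u); rewrite sqrrB mulr2n; lra.
have infJ : has_inf (range J).
  split; first by exists (J 0), 0.
  by exists (- M ^+ 2) => _ [u _ <-].
pose m := inf (range J).
have mJ u : m <= J u by apply: ge_inf; [case: infJ | exists u].
have [z zP] : {z : nat -> V & forall k, J (z k) < m + (16 ^+ k)^-1}.
  apply: (@choice _ _ (fun k u => J u < m + (16 ^+ k)^-1)) => k.
  have e0 : 0 < (16 ^+ k)^-1 :> R by rewrite invr_gt0 exprn_gt0.
  by have [_ [u _ <-] ?] := inf_adherent e0 infJ; exists u.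
have quad (u v : V) t : J (t *: v + u) - m =
    ip v v * t ^+ 2 + 2 * (ip v u - l v) * t + (J u - m).
  by rewrite /J ip_trinomial ll; ring.
have disc u v : (ip v u - l v) ^+ 2 <= ip v v * (J u - m).
  by apply: trinomial_ge0 => // t; rewrite -quad subr_ge0.
have para u v : ip (u - v) (u - v) <= 2 * (J u - m) + 2 * (J v - m).
  have := mJ (2^-1 *: (u - v) + v); rewrite -subr_ge0 quad.
  rewrite /J.
  have -> : ip u u = ip (1 *: (u - v) + v) (1 *: (u - v) + v).
    by rewrite scale1r subrK.
  have -> : l u = l (u - v) + l v by rewrite linear_formB// subrK.
  rewrite ip_trinomial; set d := u - v; lra.
have [|u uP] := @ip_complete z 4; last first.
  exists u => v; apply/eqP; rewrite -subr_eq0 -sqrf_eq0 eq_le sqr_ge0 andbT.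
  have lim : 2 * ip v v * (ip (z k - u) (z k - u) + (16 ^+ k)^-1) @[k --> \oo]
      --> 2 * ip v v * (0 + 0).
    apply: cvgMr; apply: cvgD => //.
    under eq_cvg do rewrite -exprVn.
    apply: cvg_expr; rewrite ger0_norm ?invr_ge0// invf_lt1//; lra.
  rewrite addr0 mulr0 in lim; apply: (ler_cvg_to (cvg_cst _) lim).
  apply: nearW => k /=.
  have -> : ip u v - l v = (ip v (z k) - l v) - ip v (z k - u).
    by rewrite (linear_formB _ _ (ip_linr v)) (ipC v u); ring.
  have h1 := disc (z k) v; have h2 := ip_cauchy_schwarz_sq v (z k - u).
  have h3 : ip v v * (J (z k) - m) <= ip v v * (16 ^+ k)^-1.
    by rewrite ler_wpM2l// ltW// ltrBlDl.
  rewrite -mulrA mulrDr; move: h1 h2 h3.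
  move: (ip v _ * (_ - m)) (ip v _ * ip _ _) (ip v _ * _^-1) => x y w.
  move: (ip v _ - _) (ip v (_ - _)) => a b h1 h2 h3.
  by have := sqr_ge0 (a + b); rewrite sqrrD sqrrB; lra.
move=> k; apply: (le_trans (para _ _)).
have p1 := zP k; have p2 := zP k.+1.
have : (16 ^+ k.+1)^-1 <= (16 ^+ k)^-1 :> R.
  have : 0 <= (16 ^+ k)^-1 :> R by rewrite invr_ge0 exprn_ge0.
  by rewrite exprS invfM; lra.
by lra.
Qed.

Lemma bounded_form_cvg a M (z : nat -> V) u v : bounded_form a M ->
  ip (z j - u) (z j - u) @[j --> \oo] --> (0 : R) ->
  a (u - z j) v @[j --> \oo] --> (0 : R).
Proof.
move=> aM /cvg_ipnorm zu; apply/norm_cvg0P.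
have lim : M * ipnorm (z j - u) * ipnorm v @[j --> \oo] --> (0 : R).
  rewrite -(mul0r (ipnorm v)); apply: cvgMl; rewrite -(mulr0 M).
  exact: cvgMr.
apply: (squeeze_cvgr _ (cvg_cst 0) lim); apply: nearW => j /=.
by rewrite normr_ge0 ipnormBC aM.
Qed.

(** Fixed-point iteration [a (z (k+1)) = l - b (z k)], a contraction of ratio
    [C Mb <= 1/4]. *)
Lemma solvable_perturbation a b C Ma Mb : bilinear a -> bilinear b ->
  bounded_form a Ma -> bounded_form b Mb -> 0 <= Mb -> 0 <= C ->
  bounded_below a C -> solvable_form a -> 4 * (C * Mb) <= 1 ->
  solvable_form (fun u v => a u v + b u v).
Proof.
move=> [al ar] [bl br] aM bM Mb0 C0 aC asol small l ll [M lM].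
have /choice[T TP] : forall u, exists u', forall v, a u' v = l v - b u v.
  move=> u; apply: asol.
    by move=> c v w; rewrite ll br; ring.
  exists (M + Mb * ipnorm u) => v; rewrite mulrDl.
  by apply: (le_trans (ler_normB _ _)); apply: lerD.
pose z k := iter k T 0.
have zS k v : a (z k.+1) v = l v - b (z k) v by rewrite /z iterS TP.
have contr k : ipnorm (z k.+2 - z k.+1) <= 4^-1 * ipnorm (z k.+1 - z k).
  apply: (@le_trans _ _ (C * (Mb * ipnorm (z k.+1 - z k)))).
    apply: aC => [|v]; first by rewrite mulr_ge0 ?ipnorm_ge0.
    rewrite (linear_formB _ _ (al v)) !zS.
    have -> : l v - b (z k.+1) v - (l v - b (z k) v) = - b (z k.+1 - z k) v.
      by rewrite (linear_formB _ _ (bl v)); ring.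
    by rewrite normrN.
  by rewrite mulrA ler_wpM2r ?ipnorm_ge0//; lra.
have [|u uP] := @ip_complete z (ip (z 1%N - z 0%N) (z 1%N - z 0%N)); last first.
  exists u => v; apply/eqP; rewrite -subr_eq0; apply/eqP.
  have uP1 : ip (z j.+1 - u) (z j.+1 - u) @[j --> \oo] --> (0 : R).
    by rewrite (@cvg_shiftS _ (fun j => ip (z j - u) (z j - u))).
  have lim : a (u - z k.+1) v + b (u - z k) v @[k --> \oo] --> (0 + 0 : R).
    by apply: cvgD; apply: bounded_form_cvg; eassumption.
  rewrite addr0 in lim; apply: (@cvg_unique _ (@Rhausdorff R) _ _ _ _ _ lim).
  apply: cvg_near_cst; apply: nearW => k.
  by rewrite (linear_formB _ _ (al v)) (linear_formB _ _ (bl v)) zS; ring.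
elim=> [|k IH]; first by rewrite expr0 divr1.
rewrite -!sqr_ipnorm in IH *.
have : ipnorm (z k.+2 - z k.+1) ^+ 2 <= (4^-1 * ipnorm (z k.+1 - z k)) ^+ 2.
  by rewrite ler_sqr ?nnegrE ?mulr_ge0 ?ipnorm_ge0.
move=> /le_trans; apply; rewrite exprMn [16 ^+ _]exprS invfM.
rewrite [leRHS]mulrCA -[leRHS]/(_ * _); apply: ler_pM; rewrite ?sqr_ge0//.
by lra.
Qed.

(** The forms [(1 - s) ip + s a] pass from Riesz representation at [s = 0] to
    [a] at [s = 1] in finitely many steps whose length is fixed by the uniform
    lower bound. *)
Lemma solvable_continuation a M C : bilinear a -> bounded_form a M ->
  0 <= M -> 0 <= C ->
  (forall s, 0 <= s <= 1 ->
     bounded_below (fun u v => (1 - s) * ip u v + s * a u v) C) ->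
  solvable_form a.
Proof.
move=> [al ar] aM M0 C0 lower.
pose path s u v := (1 - s) * ip u v + s * a u v.
have path_bilin s : bilinear (path s).
  split=> w c u v; rewrite /path.
    by rewrite ip_lin al; ring.
  by rewrite ip_linr ar; ring.
(* Steps of length [1 / N] satisfy the smallness condition of the perturbation
   lemma, since the increment [(a - ip) / N] has norm at most [(M + 1) / N]. *)
pose N := (Num.truncn (4 * (C * (M + 1)))).+1.
have N0 : 0 < N%:R :> R by rewrite ltr0n.
have big : 4 * (C * (M + 1)) <= N%:R.
  by apply: ltW; rewrite /N truncnS_gt.
have nn u v : 0 <= ipnorm u * ipnorm v by rewrite mulr_ge0 ?ipnorm_ge0.
have path_bound s : 0 <= s <= 1 -> bounded_form (path s) (1 + M).
  move=> /andP[s0 s1] u v; apply: (le_trans (ler_normD _ _)).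
  rewrite !normrM (ger0_norm s0) ger0_norm ?subr_ge0//.
  have := ip_cauchy_schwarz u v; have := aM u v; rewrite -!mulrA.
  have := nn u v; move: (ipnorm u * _) (`|ip _ _|) (`|a _ _|) => p x y p0 yp xp.
  have h1 : (1 - s) * x <= (1 - s) * p by rewrite ler_wpM2l// subr_ge0.
  have h2 : s * y <= s * (M * p) by rewrite ler_wpM2l.
  have h3 : s * (M * p) <= M * p by rewrite ler_piMl ?mulr_ge0.
  have h4 : 0 <= s * p by rewrite mulr_ge0.
  by rewrite mulrDl mul1r; lra.
have step k : (k <= N)%N -> solvable_form (path (k%:R / N%:R)).
  elim: k => [|k IH] kN.
    have -> : path (0%:R / N%:R) = ip.
      by apply/funext => u; apply/funext => v; rewrite /path mul0r subr0 mul1r mul0r addr0.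
    exact: riesz.
  have s01 : 0 <= (k%:R / N%:R : R) <= 1.
    by rewrite divr_ge0//= ler_pdivrMr// mul1r ler_nat ltnW.
  pose b u v := N%:R^-1 * (a u v - ip u v).
  have -> : path (k.+1%:R / N%:R) = fun u v => path (k%:R / N%:R) u v + b u v.
    apply/funext => u; apply/funext => v; rewrite /path /b -natr1; field.
    by rewrite gt_eqF.
  apply: (@solvable_perturbation _ _ C (1 + M) (N%:R^-1 * (M + 1))) => //.
  - split=> w c u v; rewrite /b.
      by rewrite al ip_lin; ring.
    by rewrite ar ip_linr; ring.
  - exact: path_bound.
  - move=> u v; rewrite normrM ger0_norm ?invr_ge0// -!mulrA ler_pM2l ?invr_gt0//.
    apply: (le_trans (ler_normB _ _)); rewrite mulrDl mul1r mulrA lerD//.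
    exact: ip_cauchy_schwarz.
  - by rewrite mulr_ge0 ?invr_ge0// addr_ge0.
  - exact: lower.
  - by apply: IH; exact: ltnW.
  - have -> : 4 * (C * (N%:R^-1 * (M + 1))) = N%:R^-1 * (4 * (C * (M + 1))).
      by ring.
    by rewrite ler_pdivrMl// mulr1.
have -> : a = path (N%:R / N%:R).
  apply/funext => u; apply/funext => v; rewrite /path divff ?gt_eqF//.
  by rewrite subrr mul0r add0r mul1r.
exact: step.
Qed.

Lemma ipnormZ c u : ipnorm (c *: u) = `|c| * ipnorm u.
Proof.
rewrite /ipnorm (_ : ip (c *: u) (c *: u) = c ^+ 2 * ip u u).
  by rewrite sqrtrM ?sqr_ge0// sqrtr_sqr.
have := ip_trinomial u 0 c; rewrite addr0 => ->.
have /= -> := linear_form0 (ip_linr u); have /= -> := linear_form0 (ip_linr 0).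
by rewrite mulr0 mul0r !addr0 mulrC.
Qed.

(** By homogeneity; if [K = 0] every multiple of [u] satisfies the hypothesis,
    which forces [ipnorm u = 0]. *)
Lemma bounded_below_normalized a C : (forall w, linear_form (a^~ w)) -> 0 <= C ->
  (forall u, (forall v, `|a u v| <= ipnorm v) -> ipnorm u <= C) ->
  bounded_below a C.
Proof.
move=> al C0 aC u K; rewrite le_eqVlt => /predU1P[<- | K0] uK.
  rewrite mulr0 leNgt; apply/negP => u0.
  have : ipnorm (((C + 1) / ipnorm u) *: u) <= C.
    apply: aC => v; have /= -> := linear_formZ ((C + 1) / ipnorm u) u (al v).
    have := uK v; rewrite mul0r normr_le0 => /eqP ->.
    by rewrite mulr0 normr0 ipnorm_ge0.
  rewrite ipnormZ ger0_norm ?divr_ge0 ?addr_ge0 ?ipnorm_ge0//.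
  by rewrite divfK ?gt_eqF// gerDl ler10.
have : ipnorm (K^-1 *: u) <= C.
  apply: aC => v; have /= -> := linear_formZ K^-1 u (al v).
  by rewrite normrM gtr0_norm ?invr_gt0// ler_pdivrMl.
by rewrite ipnormZ gtr0_norm ?invr_gt0// ler_pdivrMl// mulrC.
Qed.

(** Apply the hypothesis to unit vectors, or to arbitrarily large multiples of
    a vector of norm [0]. *)
Lemma bounded_form_quadratic a K : bilinear a -> 0 <= K ->
  (forall u v, `|a u v| <= K * (ip u u + ip v v)) -> bounded_form a (2 * K).
Proof.
move=> [al ar] K0 aK.
have scale x B : (forall t : R, 0 < t -> t * x <= B) -> x <= 0.
  move=> h; rewrite leNgt; apply/negP => x0.
  have := h ((`|B| + 1) / x); rewrite divr_gt0// ?ltr_wpDl// => /(_ isT).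
  by rewrite divfK ?gt_eqF//; have := ler_norm B; lra.
move=> u v; have [u0|u0] := eqVneq (ipnorm u) 0.
  rewrite u0 mulr0 mul0r; apply: (scale _ (K * ip v v)) => t t0.
  have := aK (t *: u) v; have /= -> := linear_formZ t u (al v).
  by rewrite normrM gtr0_norm// -(sqr_ipnorm (t *: u)) ipnormZ u0 mulr0 expr0n add0r.
have [v0|v0] := eqVneq (ipnorm v) 0.
  rewrite v0 mulr0; apply: (scale _ (K * ip u u)) => t t0.
  have := aK u (t *: v); have /= -> := linear_formZ t v (ar u).
  by rewrite normrM gtr0_norm// -(sqr_ipnorm (t *: v)) ipnormZ v0 mulr0 expr0n addr0.
have up : 0 < ipnorm u by rewrite lt_def u0 ipnorm_ge0.
have vp : 0 < ipnorm v by rewrite lt_def v0 ipnorm_ge0.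
have := aK ((ipnorm u)^-1 *: u) ((ipnorm v)^-1 *: v).
have /= -> := linear_formZ (ipnorm u)^-1 u (al ((ipnorm v)^-1 *: v)).
have /= -> := linear_formZ (ipnorm v)^-1 v (ar u).
have nu : `|(ipnorm u)^-1| = (ipnorm u)^-1 by rewrite gtr0_norm ?invr_gt0.
have nv : `|(ipnorm v)^-1| = (ipnorm v)^-1 by rewrite gtr0_norm ?invr_gt0.
rewrite -!sqr_ipnorm !ipnormZ !normrM nu nv !mulVf// !expr1n mulrA -invfM.
rewrite ler_pdivrMl ?mulr_gt0// => h; apply: (le_trans h).
by rewrite [leRHS]mulrAC -mulrA [leRHS]mulrC; lra.
Qed.

Section transpose.
Variables (a : V -> V -> R) (M C : R).
Hypotheses (abil : bilinear a) (aM : bounded_form a M) (C0 : 0 <= C).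
Hypotheses (aC : bounded_below a C) (asol : solvable_form a).

(** If [a w = <u, .>] then [|u|^2 = a w u <= K |w| <= C K |u|]. *)
Lemma bounded_below_transpose : bounded_below (fun u v => a v u) C.
Proof.
move=> u K K0 uK.
have [w wP] : exists w, forall v, a w v = ip u v.
  apply: asol; first exact: ip_linr.
  by exists (ipnorm u) => v; exact: ip_cauchy_schwarz.
have wC : ipnorm w <= C * ipnorm u.
  by apply: aC => [|v]; rewrite ?ipnorm_ge0// wP ip_cauchy_schwarz.
have := uK w; rewrite wP ger0_norm// -sqr_ipnorm => uw.
have [->|u0] := eqVneq (ipnorm u) 0; first by rewrite mulr_ge0.
have u_gt0 : 0 < ipnorm u by rewrite lt_def u0 ipnorm_ge0.
rewrite -(ler_pM2r u_gt0) -expr2; apply: (le_trans uw).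
by rewrite [C * K]mulrC -mulrA ler_wpM2l.
Qed.

(** If [a (S h) = ip h] then the Riesz representative of [h |-> l (S h)] solves
    the transposed equation with right-hand side [l]. *)
Lemma solvable_transpose : solvable_form (fun u v => a v u).
Proof.
case: abil => al ar l ll [L lL].
have /choice[S SP] : forall h, exists w, forall v, a w v = ip h v.
  move=> h; apply: asol; first exact: ip_linr.
  by exists (ipnorm h) => v; exact: ip_cauchy_schwarz.
have l_ker x : (forall v, a x v = 0) -> l x = 0.
  move=> x0; have := @aC x 0 (lexx 0).
  rewrite mulr0 => /(_ _)/wrap[|x_le0].
    by move=> v; rewrite x0 normr0 mul0r.
  have x00 : ipnorm x = 0 by apply/eqP; rewrite eq_le x_le0 ipnorm_ge0.
  by apply/eqP; rewrite -normr_le0; have := lL x; rewrite x00 mulr0.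
have [u uP] : exists u, forall h, ip u h = l (S h).
  apply: riesz.
    move=> c h k; rewrite -[RHS]ll; apply/eqP; rewrite -subr_eq0 -linear_formB//.
    apply/eqP/l_ker => v.
    by rewrite (linear_formB _ _ (al v)) al !SP ip_lin subrr.
  exists (`|L| * C) => h; apply: (le_trans (lL _)).
  apply: (@le_trans _ _ (`|L| * ipnorm (S h))).
    by rewrite ler_wpM2r ?ipnorm_ge0// ler_norm.
  rewrite -mulrA ler_wpM2l//; apply: aC; rewrite ?ipnorm_ge0// => v.
  by rewrite SP ip_cauchy_schwarz.
exists u => v.
have [h hP] : exists h, forall w, ip h w = a v w.
  by apply: riesz => //; exists (M * ipnorm v) => w; exact: aM.
rewrite -hP ipC uP; apply/eqP; rewrite -subr_eq0 -linear_formB//.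
apply/eqP/l_ker => w; rewrite (linear_formB _ _ (al w)) SP hP subrr//.
Qed.

End transpose.

End hilbert.

(** * Lebesgue measurability of open sets and of continuous functions *)

Section lebesgue_open.
Context {R : realType} {n : nat}.
Local Notation Rn := 'rV[R]_n.+1.
Local Notation mu := (@lebesgueRn R n).

Definition set_coord (v : Rn) (i : 'I_n.+1) (c : R) : Rn :=
  \row_j if j == i then c else v ord0 j.

(** Cutting all boxes of a cover along [x_i = c] leaves the total volume
    unchanged, which is Caratheodory's criterion for the half-space. *)
Lemma box_volume_cut (a b : Rn) i c :
  (box_volume a b = box_volume a (set_coord b i (Num.min (b ord0 i) c))
                  + box_volume (set_coord a i (Num.max (a ord0 i) c)) b)%E.
Proof.
rewrite /box_volume -EFinD; congr _%:E.
rewrite (bigD1 i)//= [X in _ = X + _](bigD1 i)//= [X in _ = _ + X](bigD1 i)//=.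
rewrite !mxE !eqxx.
set p := \prod_(j | j != i) _.
have -> : \prod_(j | j != i)
   Num.max 0 (set_coord b i (Num.min (b ord0 i) c) ord0 j - a ord0 j) = p.
  by apply: eq_bigr => j /negbTE ji; rewrite mxE ji.
have -> : \prod_(j | j != i)
   Num.max 0 (b ord0 j - set_coord a i (Num.max (a ord0 i) c) ord0 j) = p.
  by apply: eq_bigr => j /negbTE ji; rewrite mxE ji.
rewrite -mulrDl; congr (_ * _).
move: (a ord0 i) (b ord0 i) => x y.
by rewrite /Num.max /Num.min; do ! case: ifPn; rewrite -?leNgt => *; lra.
Qed.

Lemma box_cut_le (a b : Rn) i c x : box a b x -> x ord0 i <= c ->
  box a (set_coord b i (Num.min (b ord0 i) c)) x.
Proof.
move=> abx xc j; rewrite mxE; have := abx j.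
case: eqP => // -> /andP[-> /= xb].
by rewrite le_min xb.
Qed.

Lemma box_cut_ge (a b : Rn) i c x : box a b x -> c <= x ord0 i ->
  box (set_coord a i (Num.max (a ord0 i) c)) b x.
Proof.
move=> abx xc j; rewrite mxE; have := abx j.
case: eqP => // -> /andP[ax ->] /=.
by rewrite andbT ge_max ax.
Qed.

Lemma measurable_halfspace i (c : R) : measurable [set x : Rn | x ord0 i <= c].
Proof.
apply: (@le_caratheodory_measurable R Rn (@lebesgue_outer R n)) => X.
apply: le_ereal_inf_tmp => _ [B BX <-].
pose B1 k := ((B k).1, set_coord (B k).2 i (Num.min ((B k).2 ord0 i) c)).
pose B2 k := (set_coord (B k).1 i (Num.max ((B k).1 ord0 i) c), (B k).2).
have -> : (\sum_(k <oo) box_volume (B k).1 (B k).2 =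
    \sum_(k <oo) box_volume (B1 k).1 (B1 k).2 +
    \sum_(k <oo) box_volume (B2 k).1 (B2 k).2)%E.
  rewrite -nneseriesD; [|by move=> *; exact: box_volume_ge0..].
  by apply: eq_eseriesr => k _; exact: box_volume_cut.
apply: leeD; apply: ereal_inf_lbound.
  exists B1 => // x [Xx xc]; have [k _ Bkx] := BX _ Xx.
  by exists k => //; exact: box_cut_le.
exists B2 => // x [Xx xc]; have [k _ Bkx] := BX _ Xx.
exists k => //; apply: box_cut_ge => //.
by apply: ltW; rewrite ltNge; exact/negP.
Qed.

Lemma measurable_halfopen_box (a b : Rn) :
  measurable [set x : Rn | forall i, a ord0 i < x ord0 i <= b ord0 i].
Proof.
have -> : [set x : Rn | forall i, a ord0 i < x ord0 i <= b ord0 i] =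
    \bigcap_(i in [set: 'I_n.+1])
      ([set x : Rn | x ord0 i <= b ord0 i] `\` [set x : Rn | x ord0 i <= a ord0 i]).
  apply/seteqP; split=> [x abx i _|x abx i].
    by have /andP[ax xb] := abx i; split => //=; apply/negP; rewrite -ltNge.
  by have [/= -> /negP] := abx i I; rewrite -ltNge => ->.
apply: fin_bigcap_measurable => [|i _]; first exact: finite_finset.
by apply: measurableD; exact: measurable_halfspace.
Qed.

(** An open set is the union of the countably many half-open boxes with
    rational vertices that it contains. *)
Lemma open_measurableRn (U : set Rn) : open U -> measurable U.
Proof.
move=> oU.
pose hb (p : 'rV[rat]_n.+1 * 'rV[rat]_n.+1) := [set x : Rn |
  forall i, map_mx ratr p.1 ord0 i < x ord0 i <= map_mx ratr p.2 ord0 i].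
pose F k := if unpickle k is Some p then
   (if `[< hb p `<=` U >] then hb p else set0) else set0.
have -> : U = \bigcup_k F k.
  apply/seteqP; split=> [x Ux|x [k _]]; last first.
    rewrite /F; case: unpickle => // p; case: asboolP => // pU; exact: pU.
  have /nbhs_ballP[e /= e0 eU] := open_nbhs_nbhs (conj oU Ux).
  have /choice[a aP] : forall i : 'I_n.+1, exists q : rat,
      ratr q \in `]x ord0 i - e, x ord0 i[ by move=> i; apply: rat_in_itvoo; lra.
  have /choice[b bP] : forall i : 'I_n.+1, exists q : rat,
      ratr q \in `]x ord0 i, x ord0 i + e[ by move=> i; apply: rat_in_itvoo; lra.
  pose p := (\row_i a i, \row_i b i).
  have pU : hb p `<=` U.
    move=> y yp; apply: eU; split => // j i; rewrite ord1.
    have := yp i; rewrite !mxE => /andP[h1 h2].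
    have := aP i; have := bP i; rewrite !in_itv/= => /andP[h3 h4] /andP[h5 h6].
    by rewrite /ball /= ltr_norml; apply/andP; split; lra.
  exists (pickle p) => //; rewrite /F pickleK asboolT// => i; rewrite !mxE.
  have := aP i; have := bP i; rewrite !in_itv/= => /andP[h3 h4] /andP[h5 h6].
  by rewrite h6 ltW.
apply: bigcupT_measurable => k; rewrite /F; case: unpickle => [p|//].
by case: ifP => // _; exact: measurable_halfopen_box.
Qed.

Lemma lebesgue_bounded (D : set Rn) : bounded_set D -> (mu D < +oo)%E.
Proof.
move=> [M [_ HM]].
have {}HM x : D x -> `|x| <= M + 1 by apply: HM; rewrite ltrDl.
pose B (k : nat) : Rn * Rn :=
  if k is 0 then (const_mx (- (M + 1)), const_mx (M + 1)) else (0, 0).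
apply: (@le_lt_trans _ _ (\sum_(k <oo) box_volume (B k).1 (B k).2)%E).
  apply: ereal_inf_lbound; exists B => // x Dx; exists 0 => // i.
  rewrite !mxE -ler_norml; apply: le_trans (HM x Dx).
  rewrite [leRHS]mx_normrE.
  exact: (@le_bigmax _ _ _ 0 (fun ij => `|x ij.1 ij.2|) (ord0, i)).
rewrite (nneseries_split 0 1)//; last by move=> *; exact: box_volume_ge0.
rewrite big_nat1 add0n eseries0 ?adde0 ?ltry// => -[//|k] _ _.
by rewrite /box_volume big_ord_recl subrr maxxx mul0r.
Qed.

Lemma continuous_measurable_funRn (D : set Rn) (f : Rn -> R) : open D ->
  (forall x, D x -> {for x, continuous (f : Rn -> R^o)}) -> measurable_fun D f.
Proof.
move=> oD cf; apply: (measurability _ (measurable_realfun.RGenOInfty.measurableE R)).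
move=> _ [_ [c ->] <-].
apply: open_measurableRn; rewrite openE => x [Dx fx].
apply: filterI; first exact: (open_nbhs_nbhs (conj oD Dx)).
by apply: (cf x Dx); apply: open_nbhs_nbhs; split.
Qed.

End lebesgue_open.

Section locally_lipschitz.
Context {R : realType} {n : nat}.
Local Notation Rn := 'rV[R]_n.+1.

Lemma lipschitzP (A : set Rn) (f : Rn -> R) :
  [lipschitz (f x : R^o) | x in A] <->
  exists2 k, 0 <= k & forall x y, A x -> A y -> `|f x - f y| <= k * `|x - y|.
Proof.
split=> [[M [_ HM]]|[k k0 Hk]].
  exists (`|M| + 1) => [|x y Ax Ay]; first by rewrite addr_ge0.
  have M1 : M < `|M| + 1 by rewrite (le_lt_trans (ler_norm _))// ltrDl.
  exact: (HM _ M1 (x, y) (conj Ax Ay)).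
exists k; split; first exact: num_real.
move=> M kM [x y] [/= Ax Ay]; apply: (le_trans (Hk _ _ Ax Ay)).
by rewrite ler_wpM2r// ltW.
Qed.

Lemma locally_lipschitz_continuous (D : set Rn) f x : open D ->
  locally_lipschitz D f -> D x -> {for x, continuous (f : Rn -> R^o)}.
Proof.
move=> oD lf Dx; have [V Vx /lipschitzP[k k0 Hk]] := lf x Dx.
move=> W /nbhs_ballP[e /= e0 eW].
have VD : nbhs x (V `&` D).
  by apply: filterI => //; exact: (open_nbhs_nbhs (conj oD Dx)).
have VDx : (V `&` D) x by exact: nbhs_singleton.
have d0 : 0 < e / (k + 1) by rewrite divr_gt0 ?ltr_wpDl.
have near_x : nbhs x [set y | `|x - y| < e / (k + 1)].
  by apply/nbhs_ballP; exists (e / (k + 1)) => // y; rewrite mx_norm_ball.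
apply: filterS (filterI VD near_x) => y [VDy /ltW xy].
apply: eW; apply: (le_lt_trans (Hk x y VDx VDy)).
apply: (@le_lt_trans _ _ (k * (e / (k + 1)))); first by rewrite ler_wpM2l.
by rewrite mulrCA gtr_pMr// ltr_pdivrMr ?ltr_wpDl// mul1r ltrDl.
Qed.

End locally_lipschitz.

(** * Real-valued integrals over a measurable set *)

Section integral_toolbox.
Context d (T : measurableType d) (R : realType).
Variables (mu : {measure set T -> \bar R}) (D : set T).
Hypothesis mD : measurable D.
Implicit Types f g h : T -> R.

Definition Intg f := mu.-integrable D (EFin \o f).
Definition I f : R := \int[mu]_(x in D) f x.

Lemma Intg_measurable f : Intg f -> measurable_fun D f.
Proof. by move=> /integrableP[/measurable_EFinP]. Qed.

Lemma EFin_I f : Intg f -> ((I f)%:E = \int[mu]_(x in D) (f x)%:E)%E.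
Proof. by move=> If; rewrite /I /Rintegral fineK//; exact: integrable_fin_num. Qed.

Lemma Intg_le_ae f g : measurable_fun D f -> Intg g ->
  {ae mu, forall x, D x -> `|f x| <= g x} -> Intg f.
Proof.
move=> mf Ig fg; apply/integrableP; split; first exact/measurable_EFinP.
have /integrableP[mg] := Ig; apply: le_lt_trans.
apply: ae_ge0_le_integral => //.
- by apply: measurableT_comp => //; exact/measurable_EFinP.
- exact: measurableT_comp.
apply: filterS fg => x + Dx => /(_ Dx) /= h.
by rewrite lee_fin (le_trans h)// ler_norm.
Qed.

Lemma Intg_le f g : measurable_fun D f -> Intg g ->
  (forall x, D x -> `|f x| <= g x) -> Intg f.
Proof. by move=> mf Ig fg; apply: Intg_le_ae Ig _ => //; exact: aeW. Qed.

Lemma IntgD f g : Intg f -> Intg g -> Intg (fun x => f x + g x).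
Proof. by move=> If Ig; exact: (integrableD mD If Ig). Qed.

Lemma IntgZ c f : Intg f -> Intg (fun x => c * f x).
Proof. by move=> If; exact: (integrableZl mD c If). Qed.

Lemma IntgB f g : Intg f -> Intg g -> Intg (fun x => f x - g x).
Proof. by move=> If Ig; exact: (integrableB mD If Ig). Qed.

Lemma ID f g : Intg f -> Intg g -> I (fun x => f x + g x) = I f + I g.
Proof. by move=> If Ig; exact: RintegralD. Qed.

Lemma IZ c f : Intg f -> I (fun x => c * f x) = c * I f.
Proof. by move=> If; exact: RintegralZl. Qed.

Lemma IB f g : Intg f -> Intg g -> I (fun x => f x - g x) = I f - I g.
Proof. by move=> If Ig; exact: RintegralB. Qed.

Lemma eq_I f g : (forall x, D x -> f x = g x) -> I f = I g.
Proof. by move=> fg; apply: eq_Rintegral => x; rewrite inE => /fg. Qed.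

Lemma eq_Intg f g : (forall x, D x -> f x = g x) -> Intg f -> Intg g.
Proof.
move=> fg; apply: eq_integrable => // x; rewrite inE => Dx.
by rewrite /= fg.
Qed.

Lemma I_ge0_ae f : measurable_fun D f ->
  {ae mu, forall x, D x -> 0 <= f x} -> 0 <= I f.
Proof.
move=> mf f0; suff -> : I f = I (fun x => `|f x|) by apply: Rintegral_ge0.
rewrite /I /Rintegral; congr fine; apply: ae_eq_integral => //.
- exact/measurable_EFinP.
- by apply/measurable_EFinP; exact: measurableT_comp.
by apply: filterS f0 => x + Dx => /(_ Dx) fx; rewrite ger0_norm.
Qed.

Lemma I_ge0 f : (forall x, D x -> 0 <= f x) -> 0 <= I f.
Proof. exact: Rintegral_ge0. Qed.

Lemma le_I_ae f g : Intg f -> Intg g ->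
  {ae mu, forall x, D x -> f x <= g x} -> I f <= I g.
Proof.
move=> If Ig fg; rewrite -subr_ge0 -IB//; apply: I_ge0_ae.
  by apply: Intg_measurable; exact: IntgB.
by apply: filterS fg => x + Dx => /(_ Dx); rewrite subr_ge0.
Qed.

Lemma le_I f g : Intg f -> Intg g -> (forall x, D x -> f x <= g x) -> I f <= I g.
Proof. by move=> If Ig fg; apply: le_I_ae => //; exact: aeW. Qed.

Lemma norm_I_le f : Intg f -> `|I f| <= I (fun x => `|f x|).
Proof. exact: le_normr_Rintegral. Qed.

Lemma Intg_cst c : (mu D < +oo)%E -> Intg (cst c).
Proof.
move=> Doo; apply/integrableP; split; first by apply/measurable_EFinP; exact: measurable_cst.
rewrite (_ : (fun _ => _) = cst `|c|%:E)//.
by rewrite integral_cst// lte_mul_pinfty.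
Qed.

Lemma I_cst c : I (cst c) = c * fine (mu D).
Proof. exact: Rintegral_cst. Qed.

Lemma I_eq0_ae f : Intg f -> (forall x, D x -> 0 <= f x) -> I f = 0 ->
  {ae mu, forall x, D x -> f x = 0}.
Proof.
move=> If f0 I0.
have : (\int[mu]_(x in D) `|(f x)%:E| = 0)%E.
  under eq_integral => x /[!inE] Dx do rewrite gee0_abs ?lee_fin ?f0//.
  by rewrite -EFin_I// I0.
have mf : measurable_fun D (EFin \o f) by exact/measurable_EFinP/Intg_measurable.
move/(ae_eq_integral_abs mu mD mf); apply: filterS => x + Dx => /(_ Dx).
by case.
Qed.

Lemma measurable_superlevel f (c : R) : measurable_fun D f ->
  measurable_fun D (fun x => (c < f x)%R%:R : R).
Proof.
move=> mf.
apply: (@measurableT_comp _ _ _ _ _ _ (fun b : bool => b%:R : R)) => //.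
exact: measurable_fun_ltr.
Qed.

Lemma measurable_sublevel f (c : R) : measurable_fun D f ->
  measurable_fun D (fun x => (f x <= c)%R%:R : R).
Proof.
move=> mf.
apply: (@measurableT_comp _ _ _ _ _ _ (fun b : bool => b%:R : R)) => //.
exact: measurable_fun_ler.
Qed.

Lemma Intg_superlevel f g (c : R) : measurable_fun D f -> Intg g ->
  (forall x, D x -> 0 <= g x) -> Intg (fun x => (c < f x)%R%:R * g x).
Proof.
move=> mf Ig g0; apply: (Intg_le _ Ig).
  exact: measurable_funM (measurable_superlevel c mf) (Intg_measurable Ig).
move=> x Dx; rewrite ger0_norm ?mulr_ge0 ?g0//.
by rewrite ler_piMl ?g0// lern1 leq_b1.
Qed.

(** Monotone convergence of the truncations to the sets [f <= m], which
    exhaust [D]. *)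
Lemma Intg_sublevel f h (K : R) : measurable_fun D f -> measurable_fun D h ->
  (forall x, D x -> 0 <= h x) ->
  (forall m : nat, Intg (fun x => (f x <= m%:R)%R%:R * h x) /\
     I (fun x => (f x <= m%:R)%R%:R * h x) <= K) ->
  Intg h /\ I h <= K.
Proof.
move=> mf mh h0 hK.
have : (\int[mu]_(x in D) (h x)%:E <= K%:E)%E.
  pose g (m : nat) x : \bar R := ((f x <= m%:R)%R%:R * h x)%:E.
  have -> : (\int[mu]_(x in D) (h x)%:E =
      \int[mu]_(x in D) limn (g ^~ x))%E.
    apply: eq_integral => x _; apply/esym/cvg_lim => //.
    apply: cvg_near_cst; exists (Num.truncn `|f x|).+1 => // m /= fm.
    rewrite /g (_ : f x <= m%:R) ?mul1r//; apply: (le_trans (ler_norm _)).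
    by apply/ltW/(lt_le_trans (truncnS_gt _)); rewrite ler_nat.
  rewrite monotone_convergence//.
  - apply: lime_le; last first.
      by apply: nearW => m; have [i1 i2] := hK m; rewrite -EFin_I// lee_fin.
    apply: ereal_nondecreasing_is_cvgn => m1 m2 m12.
    apply: ge0_le_integral => //.
    + by move=> x Dx; rewrite lee_fin mulr_ge0// h0.
    + exact/measurable_EFinP/(Intg_measurable (hK m1).1).
    + exact/measurable_EFinP/(Intg_measurable (hK m2).1).
    + move=> x Dx; rewrite lee_fin ler_wpM2r ?h0// ler_nat.
      by case: (leP (f x)) => //= fm; rewrite (le_trans fm)// ler_nat.
  - by move=> m; exact/measurable_EFinP/(Intg_measurable (hK m).1).
  - by move=> m x Dx; rewrite lee_fin mulr_ge0// h0.
  - move=> x Dx m1 m2 m12; rewrite lee_fin ler_wpM2r ?h0// ler_nat.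
    by case: (leP (f x)) => //= fm; rewrite (le_trans fm)// ler_nat.
move=> hle; have Ih : Intg h.
  apply/integrableP; split; first exact/measurable_EFinP.
  under eq_integral => x /[!inE] Dx do rewrite gee0_abs ?lee_fin ?h0//.
  exact: le_lt_trans hle (ltry _).
by split=> //; rewrite -lee_fin EFin_I.
Qed.

(** Dominated convergence: the sets [m < f] decrease to the empty set. *)
Lemma I_superlevel_small f g e : measurable_fun D f -> Intg g ->
  (forall x, D x -> 0 <= g x) -> 0 < e ->
  exists m : nat, I (fun x => (m%:R < f x)%R%:R * g x) <= e.
Proof.
move=> mf Ig g0 e0.
pose h (m : nat) x : R := (m%:R < f x)%R%:R * g x.
have mh m : measurable_fun D (h m).
  exact: Intg_measurable (Intg_superlevel _ mf Ig g0).
have h0 x : D x -> (h m x)%:E @[m --> \oo] --> (0 : \bar R)%E.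
  move=> Dx; apply: cvg_near_cst; exists (Num.truncn `|f x|).+1 => // m /= fm.
  rewrite /h ltNge (le_trans (ler_norm _)) ?mul0r//.
  by apply/ltW/(lt_le_trans (truncnS_gt _)); rewrite ler_nat.
have hg x (m : nat) : D x -> (`|(EFin \o h m) x| <= (EFin \o g) x)%E.
  move=> Dx; rewrite lee_fin ger0_norm ?mulr_ge0 ?g0//.
  by rewrite ler_piMl ?g0// lern1 leq_b1.
have [_ _] := @dominated_convergence _ _ _ mu D mD (fun m => EFin \o h m)
   (cst 0)%E (EFin \o g) (fun m => (measurable_EFinP D (h m)).2 (mh m))
   (measurable_cst _) (aeW mu h0) Ig
   (aeW mu hg).
rewrite integral0 => /fine_cvgP[_ lim].
have /cvgrPdist_le/(_ e e0)[m _ /(_ m (leqnn m))] := lim.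
by rewrite sub0r normrN => /(le_trans (ler_norm _)) ?; exists m.
Qed.

End integral_toolbox.

(** * The degenerate Sobolev space as a space of pairs with finite energy *)

Section energy.
Context {R : realType} {n : nat}.
Local Notation Rn := 'rV[R]_n.+1.
Local Notation mu := (@lebesgueRn R n).
Variables (D : set Rn) (Q : Rn -> 'M[R]_n.+1).
Local Notation pair := ((Rn -> R) * (Rn -> Rn))%type.
Implicit Types u v : pair.

Definition measurable_pair u : Prop := measurable_fun D u.1 /\ measurable_field D u.2.

Definition energy_dens u (x : Rn) : R :=
  u.1 x ^+ 2 + qform (Q x) (u.2 x) (u.2 x).

Definition ip_dens u v (x : Rn) : R :=
  u.1 x * v.1 x + qform (Q x) (u.2 x) (v.2 x).

Lemma energy_densE u x :
  energy_dens u x = u.1 x ^+ 2 + qform (Q x) (u.2 x) (u.2 x).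
Proof. by []. Qed.

Lemma ip_densE u v x :
  ip_dens u v x = u.1 x * v.1 x + qform (Q x) (u.2 x) (v.2 x).
Proof. by []. Qed.

Definition energy u : R := I mu D (energy_dens u).

Lemma energyE u : energy u = I mu D (energy_dens u). Proof. by []. Qed.

Definition finite_energy u : Prop := measurable_pair u /\ Intg mu D (energy_dens u).

Lemma measurable_qform (A : Rn -> 'M[R]_n.+1) (U V : Rn -> Rn) :
  (forall i j, measurable_fun D (fun x => A x i j)) ->
  measurable_field D U -> measurable_field D V ->
  measurable_fun D (fun x => qform (A x) (U x) (V x)).
Proof.
move=> mA mU mV; under eq_fun do rewrite qformE.
apply: measurable_sum => i; apply: measurable_sum => j.
exact: measurable_funM (measurable_funM (mU i) (mA i j)) (mV j).
Qed.

Lemma measurable_dotv (U V : Rn -> Rn) :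
  measurable_field D U -> measurable_field D V ->
  measurable_fun D (fun x => dotv (U x) (V x)).
Proof.
move=> mU mV; apply: measurable_sum => i.
exact: measurable_funM (mU i) (mV i).
Qed.

Lemma measurable_pair_lin c u v : measurable_pair u -> measurable_pair v ->
  measurable_pair (c *: u + v).
Proof.
move=> [mu1 mu2] [mv1 mv2]; split.
  exact: measurable_funD (measurable_funM (measurable_cst c) mu1) mv1.
move=> i.
rewrite (_ : (fun _ => _) = fun x => c * u.2 x ord0 i + v.2 x ord0 i).
  exact: measurable_funD (measurable_funM (measurable_cst c) (mu2 i)) (mv2 i).
by apply/funext => x; rewrite mxE [in X in X + _]mxE.
Qed.

Lemma measurable_pairB u v : measurable_pair u -> measurable_pair v -> measurable_pair (u - v).
Proof. by move=> mu_ mv; rewrite addrC -scaleN1r; exact: measurable_pair_lin. Qed.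

Hypothesis oD : open D.
Hypothesis pQ : forall x, D x -> nonneg_sym (Q x).
Hypothesis mQ : forall i j, measurable_fun D (fun x => Q x i j).

Let mD : measurable D. Proof. exact: open_measurableRn. Qed.

Lemma energy_dens_ge0 u x : D x -> 0 <= energy_dens u x.
Proof. by move=> Dx; rewrite addr_ge0 ?sqr_ge0 ?qform_ge0//; exact: pQ. Qed.

Lemma energy_ge0 u : 0 <= energy u.
Proof. by apply: I_ge0 => x; exact: energy_dens_ge0. Qed.

Lemma measurable_ip_dens u v : measurable_pair u -> measurable_pair v ->
  measurable_fun D (ip_dens u v).
Proof.
move=> [mu1 mu2] [mv1 mv2].
exact: measurable_funD (measurable_funM mu1 mv1) (measurable_qform mQ mu2 mv2).
Qed.

Lemma measurable_energy_dens u : measurable_pair u -> measurable_fun D (energy_dens u).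
Proof. by move=> mu_; exact: measurable_ip_dens. Qed.

(** The square root disappears: [|sqrt Q xi|^2 = <xi, Q xi>]. *)
Lemma QH1normE u : measurable_pair u -> (QH1norm Q D u =
  (\int[mu]_(x in D) (energy_dens u x)%:E) `^ 2^-1)%E.
Proof.
move=> [mu1 mu2]; rewrite /QH1norm; congr (_ `^ _)%E.
rewrite -(ge0_integralD mu mD).
- apply: eq_integral => x /[!inE] Dx; rewrite -EFinD /energy_dens.
  by rewrite real_normK ?num_real// sqr_enorm_sqrtmx//; exact: pQ.
- by move=> x _; rewrite lee_fin sqr_ge0.
- apply/measurable_EFinP; under eq_fun do rewrite real_normK ?num_real//.
  exact: measurable_funX.
- by move=> x _; rewrite lee_fin sqr_ge0.
- apply/measurable_EFinP.
  apply: (@eq_measurable_fun _ _ _ _ _ (fun x => qform (Q x) (u.2 x) (u.2 x))).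
    by move=> x /[!inE] Dx; rewrite sqr_enorm_sqrtmx//; exact: pQ.
  exact: measurable_qform.
Qed.

Lemma QH1norm_real u : finite_energy u ->
  QH1norm Q D u = (Num.sqrt (energy u))%:E.
Proof.
move=> [mu_ iu]; rewrite QH1normE// -EFin_I// poweR_EFin powR12_sqrt//.
exact: energy_ge0.
Qed.

Lemma QH1norm_fin u : measurable_pair u -> (QH1norm Q D u < +oo)%E <-> finite_energy u.
Proof.
move=> mu_; split=> [|fu]; last by rewrite QH1norm_real// ltry.
rewrite QH1normE// => h; split=> //.
apply/integrableP; split; first exact/measurable_EFinP/measurable_energy_dens.
under eq_integral => x /[!inE] Dx
  do rewrite gee0_abs ?lee_fin ?energy_dens_ge0//.
by apply: lty_poweRy h; rewrite invr_neq0.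
Qed.

Lemma energy_dens_lin c u v x : D x ->
  energy_dens (c *: u + v) x <= 2 * (c ^+ 2 * energy_dens u x) + 2 * energy_dens v x.
Proof.
move=> Dx; rewrite /energy_dens.
rewrite -[(c *: u + v).1 x]/(c * u.1 x + v.1 x).
rewrite -[(c *: u + v).2 x]/(c *: u.2 x + v.2 x).
have := qform_le_diag (c *: u.2 x) (v.2 x) (pQ Dx).
rewrite [qform _ (c *: _) (c *: _)]qformZl [qform _ _ (c *: _)]qformZr.
have := sqr_ge0 (c * u.1 x - v.1 x).
move: (qform _ (_ + _) _) (qform _ (u.2 x) _) (qform _ (v.2 x) _) => a b d.
by rewrite sqrrB sqrrD !exprMn => h1 h2; lra.
Qed.

Lemma finite_energy_lin c u v : finite_energy u -> finite_energy v ->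
  finite_energy (c *: u + v).
Proof.
move=> [mu_ iu] [mv_ iv]; split; first exact: measurable_pair_lin.
apply: (@Intg_le _ _ _ _ _ mD _
  (fun x => 2 * (c ^+ 2 * energy_dens u x) + 2 * energy_dens v x)).
- by apply: measurable_energy_dens; exact: measurable_pair_lin.
- by apply: IntgD => //; do ! apply: IntgZ.
move=> x Dx; rewrite ger0_norm ?energy_dens_ge0//; exact: energy_dens_lin.
Qed.

Lemma energy_lin c u v : finite_energy u -> finite_energy v ->
  energy (c *: u + v) <= 2 * (c ^+ 2 * energy u) + 2 * energy v.
Proof.
move=> fu fv; have [mu_ iu] := fu; have [mv_ iv] := fv.
have i1 : Intg mu D (fun x => 2 * (c ^+ 2 * energy_dens u x)).
  by do ! apply: IntgZ.
have i2 : Intg mu D (fun x => 2 * energy_dens v x) by exact: IntgZ.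
have -> : 2 * (c ^+ 2 * energy u) + 2 * energy v =
    I mu D (fun x => 2 * (c ^+ 2 * energy_dens u x) + 2 * energy_dens v x).
  by rewrite (ID mD i1 i2) !IZ//; exact: IntgZ.
apply: le_I => //.
- by have [] := finite_energy_lin c fu fv.
- exact: IntgD.
by move=> x Dx; exact: energy_dens_lin.
Qed.

Lemma finite_energyB u v : finite_energy u -> finite_energy v ->
  finite_energy (u - v).
Proof. by move=> fu fv; rewrite addrC -scaleN1r; exact: finite_energy_lin. Qed.

Lemma energyB u v : finite_energy u -> finite_energy v ->
  energy (u - v) <= 2 * energy u + 2 * energy v.
Proof.
move=> fu fv; rewrite addrC -scaleN1r; apply: (le_trans (energy_lin _ fv fu)).
by rewrite sqrrN expr1n mul1r addrC.
Qed.

Lemma energyD u v : finite_energy u -> finite_energy v ->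
  energy (u + v) <= 2 * energy u + 2 * energy v.
Proof.
move=> fu fv; rewrite -[u]scale1r; apply: (le_trans (energy_lin _ fu fv)).
by rewrite expr1n mul1r scale1r.
Qed.

Lemma energy_densBC u v x : energy_dens (u - v) x = energy_dens (v - u) x.
Proof.
rewrite /energy_dens.
rewrite -[(u - v).1 x]/(u.1 x - v.1 x) -[(v - u).1 x]/(v.1 x - u.1 x).
rewrite -[(u - v).2 x]/(u.2 x - v.2 x) -[(v - u).2 x]/(v.2 x - u.2 x).
by rewrite -(opprB (u.2 x)) qformNl qformNr opprK -sqrrN opprB.
Qed.

Lemma energyBC u v : energy (u - v) = energy (v - u).
Proof. by apply: eq_I => x _; exact: energy_densBC. Qed.

Lemma ip_dens_le u v x : D x ->
  `|ip_dens u v x| <= energy_dens u x + energy_dens v x.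
Proof.
move=> Dx; rewrite /ip_dens /energy_dens; apply: (le_trans (ler_normD _ _)).
have := qform_amgm (u.2 x) (v.2 x) (pQ Dx).
have eu := qform_ge0 (u.2 x) (pQ Dx); have ev := qform_ge0 (v.2 x) (pQ Dx).
rewrite normrM; have := sqr_ge0 (`|u.1 x| - `|v.1 x|).
rewrite sqrrB !real_normK ?num_real// => h1 h2.
have := sqr_ge0 (u.1 x); have := sqr_ge0 (v.1 x); lra.
Qed.

Lemma Intg_ip_dens u v : finite_energy u -> finite_energy v ->
  Intg mu D (ip_dens u v).
Proof.
move=> [mu_ iu] [mv_ iv].
apply: (@Intg_le _ _ _ _ _ mD _ (fun x => energy_dens u x + energy_dens v x)).
- exact: measurable_ip_dens.
- exact: IntgD.
by move=> x Dx; exact: ip_dens_le.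
Qed.

Lemma Lip_Q_finite phi : Lip_Q Q D phi -> finite_energy phi.
Proof.
move=> [[lphi [mphi _]] fphi].
have mp : measurable_pair phi.
  split=> //; apply: continuous_measurable_funRn => // x Dx.
  exact: (locally_lipschitz_continuous oD lphi Dx).
exact/(QH1norm_fin mp).
Qed.

(** Replaces the approximating sequence and its extended-real norms by an
    [epsilon]-statement about real energies, which is easier to combine. *)
Lemma QH1P u : QH1 Q D u <-> finite_energy u /\
  forall e : R, 0 < e -> exists2 phi, Lip_Q Q D phi & energy (u - phi) <= e.
Proof.
split=> [[mu1 mu2 fu [phi [Lphi lim]]]|[fu approx]].
  have {}fu : finite_energy u by apply/QH1norm_fin.
  split=> // e e0.
  have : (fun j => (Num.sqrt (energy (u - phi j)))%:E) @ \oo --> 0%E.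
    suff <- : (fun j => QH1norm Q D (u - phi j)) =
              (fun j => (Num.sqrt (energy (u - phi j)))%:E) by [].
    apply/funext => j; apply: QH1norm_real; apply: finite_energyB => //.
    exact: Lip_Q_finite.
  move=> /fine_cvgP[_ /cvgrPdist_le/(_ (Num.sqrt e))].
  rewrite sqrtr_gt0 => /(_ e0)[j _ /(_ j (leqnn j))] /=.
  rewrite sub0r normrN ger0_norm ?sqrtr_ge0// ler_sqrt ?(ltW e0)// => h.
  by exists (phi j).
have [[mu1 mu2] _] := fu.
have /choice[phi Hphi] : forall j : nat, exists phi,
    Lip_Q Q D phi /\ energy (u - phi) <= (j.+1%:R^-1) ^+ 2.
  move=> j; have [|phi ? ?] := approx (j.+1%:R^-1 ^+ 2); last by exists phi.
  by rewrite exprn_gt0// invr_gt0 ltr0n.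
have fB j : finite_energy (u - phi j).
  by apply: finite_energyB => //; exact: Lip_Q_finite (Hphi j).1.
split=> //; first by apply/QH1norm_fin.
exists phi; split=> [j|]; first by have [] := Hphi j.
rewrite (_ : (fun j => _) = (fun j => (Num.sqrt (energy (u - phi j)))%:E)); last first.
  by apply/funext => j; exact: QH1norm_real.
apply: cvg_EFin; first exact: nearW.
apply: (squeeze_cvgr _ (cvg_cst 0) (@cvg_harmonic R)); apply: nearW => j /=.
rewrite sqrtr_ge0 -[leRHS]ger0_norm ?invr_ge0// -sqrtr_sqr.
by rewrite ler_sqrt ?exprn_ge0 ?invr_ge0// (Hphi j).2.
Qed.

End energy.

(** * Completeness of the degenerate Sobolev space *)

Section completeness.
Context {R : realType} {n : nat}.
Local Notation Rn := 'rV[R]_n.+1.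
Local Notation mu := (@lebesgueRn R n).
Variables (D : set Rn) (Q : Rn -> 'M[R]_n.+1).
Local Notation pair := ((Rn -> R) * (Rn -> Rn))%type.
Implicit Types u v : pair.
Hypothesis oD : open D.
Hypothesis pQ : forall x, D x -> nonneg_sym (Q x).
Hypothesis mQ : forall i j, measurable_fun D (fun x => Q x i j).
Let mD : measurable D. Proof. exact: open_measurableRn. Qed.
Local Notation energy := (energy D Q).
Local Notation energy_dens := (energy_dens Q).
Local Notation finite_energy := (finite_energy D Q).

(** A quasi-triangle inequality with constant 2 is enough to sum increments
    that decay like [4^-j]. *)
Lemma geometric_increments (V : zmodType) (d : V -> R) (z : nat -> V) (S : R) :
  d 0 = 0 -> 0 <= S -> (forall a b, d (a + b) <= 2 * d a + 2 * d b) ->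
  (forall j, d (z j.+1 - z j) <= S / 4 ^+ j) ->
  forall i k, d (z (k + i)%N - z k) <= 4 * (S / 4 ^+ k).
Proof.
move=> d0 S0 dD dz; elim=> [|i IH] k.
  by rewrite addn0 subrr d0 mulr_ge0// divr_ge0// exprn_ge0.
have -> : z (k + i.+1)%N - z k = (z k.+1 - z k) + (z (k.+1 + i)%N - z k.+1).
  by rewrite addnS addSn [RHS]addrC subrKA.
apply: (le_trans (dD _ _)); have := dz k; have := IH k.+1.
have : 0 <= S / 4 ^+ k by rewrite divr_ge0// exprn_ge0.
by rewrite exprS invfM mulrCA; lra.
Qed.

Lemma energy_dens0 x : energy_dens 0 x = 0.
Proof.
rewrite /energy_dens -[(0 : pair).1 x]/(0 : R) -[(0 : pair).2 x]/(0 : Rn).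
by rewrite expr0n add0r -(scale0r 0) qformZl mul0r.
Qed.

Lemma energy_densD u v x : D x ->
  energy_dens (u + v) x <= 2 * energy_dens u x + 2 * energy_dens v x.
Proof.
move=> Dx; have := energy_dens_lin pQ 1 u v Dx.
by rewrite scale1r expr1n mul1r.
Qed.

(** Where the weighted series of the increments is finite, a fast Cauchy
    sequence converges pointwise, at a geometric rate. *)
Lemma increments_series (z : nat -> pair) (S : R) :
  (forall j, finite_energy (z j)) ->
  (forall j, energy (z j.+1 - z j) <= S / 16 ^+ j) ->
  exists (G : set Rn) (s : Rn -> R), [/\ measurable G, G `<=` D,
    {ae mu, forall x, D x -> G x}, Intg mu D s &
    (forall x, 0 <= s x) /\
    (forall x j, G x -> energy_dens (z j.+1 - z j) x <= s x / 4 ^+ j)].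
Proof.
move=> fz zS.
(* Half of the decay [16^-j = 4^-j 4^-j] pays for the summability of the
   weights [4^j], the other half is left as the pointwise rate. *)
pose f (j : nat) x : \bar R := (4 ^+ j * energy_dens (z j.+1 - z j) x)%:E.
have f0 j x : D x -> (0 <= f j x)%E.
  by move=> Dx; rewrite lee_fin mulr_ge0 ?exprn_ge0// (energy_dens_ge0 pQ).
have fB j : finite_energy (z j.+1 - z j) by exact: finite_energyB.
have If j : Intg mu D (fun x => 4 ^+ j * energy_dens (z j.+1 - z j) x).
  by apply: IntgZ => //; have [] := fB j.
have mf j : measurable_fun D (f j) by exact/measurable_EFinP/(Intg_measurable (If j)).
pose F x : \bar R := (\sum_(0 <= j <oo) f j x)%E.
have cF x : D x -> cvgn (fun k => \sum_(0 <= j < k) f j x)%E.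
  by move=> Dx; apply: is_cvg_nneseries => j _ _; exact: f0.
have mF : measurable_fun D F.
  apply: (emeasurable_fun_cvg (fun k x => \sum_(0 <= j < k) f j x)%E).
    by move=> k; exact: emeasurable_sum.
  by move=> x Dx; exact: cF.
have F0 x : D x -> (0 <= F x)%E by move=> Dx; apply: nneseries_ge0 => j _ _; exact: f0.
have IF : mu.-integrable D F.
  apply/integrableP; split=> //.
  under eq_integral => x /[!inE] Dx do rewrite gee0_abs ?F0//.
  rewrite /F integral_nneseries//.
  have S0 : 0 <= S.
    by have := le_trans (energy_ge0 pQ _) (zS 0); rewrite expr0 divr1.
  apply: (@le_lt_trans _ _ (\sum_(0 <= j <oo) (S * 4^-1 ^+ j)%:E)%E).
    apply: lee_nneseries => j _.
      by move=> _; apply: integral_ge0 => x Dx; exact: f0.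
    rewrite -EFin_I// lee_fin IZ//; last by have [] := fB j.
    have p4 : 0 < 4 ^+ j :> R by rewrite exprn_gt0.
    have zSj := zS j; rewrite -(ler_pM2l p4) in zSj; apply: (le_trans zSj).
    rewrite mulrCA -exprVn -exprMn.
    by rewrite (_ : 4 * 16^-1 = 4^-1 :> R)//; lra.
  have partial k : \sum_(0 <= j < k) S * 4^-1 ^+ j <= 2 * S - 2 * (S * 4^-1 ^+ k).
    elim: k => [|k IH]; first by rewrite big_nil expr0; lra.
    rewrite big_nat_recr//= exprS.
    have : 0 <= S * 4^-1 ^+ k by rewrite mulr_ge0// exprn_ge0.
    by lra.
  apply: (@le_lt_trans _ _ (2 * S)%:E); last exact: ltry.
  apply: lime_le.
    by apply: is_cvg_nneseries => j _ _; rewrite lee_fin mulr_ge0// exprn_ge0.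
  apply: nearW => k; rewrite sumEFin lee_fin (le_trans (partial k))//.
  by rewrite gerBl !mulr_ge0// exprn_ge0.
pose s x := fine (F x).
exists (D `&` F @^-1` [set r | r \is a fin_num]), (fun x => `|s x|); split.
- exact: emeasurable_fin_num.
- by move=> x [].
- by apply: filterS (integrable_ae mD IF) => x + Dx => /(_ Dx).
- apply: (le_integrable mD _ _ IF).
    apply/measurable_EFinP; apply: measurableT_comp => //.
    by apply: measurableT_comp mF; exact: fine_measurable.
  move=> x Dx; rewrite /s /= normr_id; have := F0 x Dx.
  by case: (F x) => [r _|_|//] /=; rewrite ?normr0 ?leey// lexx.
split=> [x|x j [Dx /= Fx]]; first exact: normr_ge0.
rewrite ger0_norm ?fine_ge0 ?F0// ler_pdivlMr ?exprn_gt0// mulrC -lee_fin fineK//.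
apply: (le_trans _ (nneseries_lim_ge j.+1 _)); last by move=> *; exact: f0.
rewrite big_nat_recr//= leeDr//.
by apply: sume_ge0 => i _; exact: f0.
Qed.

Lemma eq_energy_dens u v x : u.1 x = v.1 x -> u.2 x = v.2 x ->
  energy_dens u x = energy_dens v x.
Proof. by rewrite /energy_dens => -> ->. Qed.

Lemma geometric_small (a e : R) : 0 < e ->
  exists K : nat, forall k, (K <= k)%N -> a / 4 ^+ k <= e.
Proof.
move=> e0; have lim : a * 4^-1 ^+ k @[k --> \oo] --> (0 : R).
  rewrite -(mulr0 a); apply: cvgMr; apply: cvg_expr.
  by rewrite ger0_norm ?invr_ge0// invf_lt1//; lra.
have /cvgrPdist_le/(_ e e0)[K _ HK] := lim.
exists K => k Kk; have := HK k Kk.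
by rewrite sub0r normrN exprVn => /(le_trans (ler_norm _)).
Qed.

(** The pointwise limit is taken modulo the kernel of [Q x], which is all that
    the energy sees. *)
Lemma finite_energy_complete (z : nat -> pair) (S : R) :
  (forall j, finite_energy (z j)) ->
  (forall j, energy (z j.+1 - z j) <= S / 16 ^+ j) ->
  exists u C, finite_energy u /\ forall j, energy (z j - u) <= C / 4 ^+ j.
Proof.
move=> fz zS; have [G [s [mG GD aeG Is [s0 sP]]]] := increments_series fz zS.
(* Vanishing outside [G] makes the sequence Cauchy at every point of [D]. *)
pose zc k : pair := (fun x => \1_G x * (z k).1 x, fun x => \1_G x *: (z k).2 x).
have zcG k x : G x -> (zc k).1 x = (z k).1 x /\ (zc k).2 x = (z k).2 x.
  by move=> Gx; rewrite /= indicE mem_set// mul1r scale1r.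
have zcB x k l : D x -> (k <= l)%N ->
    energy_dens (zc k - zc l) x <= 4 * (s x / 4 ^+ k).
  move=> Dx kl; have [Gx|Gx] := pselect (G x); last first.
    rewrite (@eq_energy_dens _ 0) ?energy_dens0.
    - by rewrite mulr_ge0// divr_ge0// exprn_ge0.
    - rewrite -[LHS]/((zc k).1 x - (zc l).1 x) /= indicE memNset//.
      by rewrite !mul0r subrr.
    - rewrite -[LHS]/((zc k).2 x - (zc l).2 x) /= indicE memNset//.
      by rewrite !scale0r subrr.
  have [zk1 zk2] := zcG k x Gx; have [zl1 zl2] := zcG l x Gx.
  rewrite (@eq_energy_dens _ (z k - z l)).
  - rewrite energy_densBC -(subnKC kl).
    apply: (@geometric_increments _ (energy_dens ^~ x) z (s x)) => //.
    + exact: energy_dens0.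
    + by move=> a b; exact: energy_densD.
    + by move=> j; exact: sP.
  - by rewrite -[LHS]/((zc k).1 x - (zc l).1 x) zk1 zl1.
  - by rewrite -[LHS]/((zc k).2 x - (zc l).2 x) zk2 zl2.
have zcauchy x e : D x -> 0 < e -> exists K, forall k l, (K <= k)%N -> (K <= l)%N ->
    energy_dens (zc k - zc l) x <= e.
  move=> Dx e0; have [K HK] := geometric_small (4 * s x) e0.
  exists K => k l Kk Kl; case: (leqP k l) => [kl|/ltnW lk].
    by apply: (le_trans (zcB x k l Dx kl)); rewrite mulrA HK.
  by rewrite energy_densBC; apply: (le_trans (zcB x l k Dx lk)); rewrite mulrA HK.
have split_le u x : D x -> u.1 x ^+ 2 <= energy_dens u x /\
    qform (Q x) (u.2 x) (u.2 x) <= energy_dens u x.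
  move=> Dx; rewrite /energy_dens; have := qform_ge0 (u.2 x) (pQ Dx).
  by have := sqr_ge0 (u.1 x); split; lra.
have cvg1 x : D x -> cvgn (fun k => (zc k).1 x).
  move=> Dx; apply/cauchy_cvgP/cauchy_exP => e e0.
  have [K HK] := zcauchy x ((e / 2) ^+ 2) Dx ltac:(by
    rewrite exprn_gt0// divr_gt0).
  exists ((zc K).1 x); exists K => // k /= Kk; rewrite /ball /=.
  apply: (@le_lt_trans _ _ (e / 2)); last by rewrite ltr_pdivrMr// ltr_pMr// ltr1n.
  have e20 : 0 <= e / 2 by rewrite divr_ge0// ltW.
  rewrite -ler_sqr ?nnegrE// real_normK ?num_real//.
  exact: le_trans (split_le (zc K - zc k) x Dx).1 (HK _ _ (leqnn K) Kk).
have kl x : D x -> _ := fun Dx => @kernel_limitP R n (Q x)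
  (fun k => (zc k).2 x) (pQ Dx)
  (fun e e0 => let: ex_intro K HK := zcauchy x e Dx e0 in ex_intro _ K
     (fun k l Kk Kl => le_trans (split_le (zc k - zc l) x Dx).2 (HK k l Kk Kl))).
pose u : pair := (fun x => limn (fun k => (zc k).1 x),
                  fun x => kernel_limit (Q x) (fun k => (zc k).2 x)).
have mzc k : measurable_pair D (zc k).
  have [[mz1 mz2] _] := fz k.
  have m1 : measurable_fun D (\1_G : Rn -> R) by exact: measurable_indic.
  split; first exact: measurable_funM.
  move=> i; rewrite (_ : (fun _ => _) = fun x => \1_G x * (z k).2 x ord0 i).
    exact: measurable_funM (mz2 i).
  by apply/funext => x; rewrite mxE.
have mu_ : measurable_pair D u.
  split.
    apply: (measurable_fun_cvg (fun k => (mzc k).1)) => x Dx.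
    exact: cvg1.
  move=> j.
  pose y x : Rn := \row_i limn (fun k => ((zc k).2 x *m Q x) 0 i).
  apply: (@measurable_fun_cvg _ _ _ _ (fun m x => tikhonov (Q x) (y x) m 0 j)).
    move=> m; apply: (measurable_tikhonov m j pQ mQ) => i.
    apply: (@measurable_fun_cvg _ _ _ _ (fun k x => ((zc k).2 x *m Q x) 0 i)).
      move=> k; under eq_fun do rewrite mxE.
      apply: measurable_sum => l; exact: measurable_funM ((mzc k).2 l) (mQ l i).
    move=> x Dx; rewrite /y mxE; have [h _] := kl x Dx; exact: h.
  move=> x Dx; rewrite /u /kernel_limit mxE; have [_ [h _]] := kl x Dx; exact: h.
have zcu x k : D x -> energy_dens (zc k - u) x <= 8 * (s x / 4 ^+ k).
  move=> Dx; rewrite /energy_dens.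
  have b2 : qform (Q x) ((zc k - u).2 x) ((zc k - u).2 x) <= 4 * (s x / 4 ^+ k).
    have [_ [_ h]] := kl x Dx; apply: h => l kl_.
    exact: le_trans (split_le (zc k - zc l) x Dx).2 (zcB x k l Dx kl_).
  have b1 : (zc k - u).1 x ^+ 2 <= 4 * (s x / 4 ^+ k).
    have lim : ((zc k).1 x - (zc l).1 x) ^+ 2 @[l --> \oo] -->
        ((zc k).1 x - u.1 x) ^+ 2.
      apply: (@cvg_comp _ _ _ _ (fun t : R => t ^+ 2) _
        (nbhs ((zc k).1 x - u.1 x))); last exact: exprn_continuous.
      apply: cvgB; first exact: cvg_cst.
      exact: cvg1.
    apply: (ler_cvg_to lim (cvg_cst _)); exists k => // l /= kl_.
    exact: le_trans (split_le (zc k - zc l) x Dx).1 (zcB x k l Dx kl_).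
  by apply: (le_trans (lerD b1 b2)); lra.
have zu k : {ae mu, forall x, D x ->
    energy_dens (z k - u) x <= 8 * (4 ^+ k)^-1 * s x}.
  apply: filterS aeG => x + Dx => /(_ Dx) Gx; have [e1 e2] := zcG k x Gx.
  rewrite (@eq_energy_dens _ (zc k - u)).
  - by apply: (le_trans (zcu x k Dx)); rewrite -mulrA [s x / _]mulrC.
  - by rewrite -[LHS]/((z k).1 x - u.1 x) -e1.
  - by rewrite -[LHS]/((z k).2 x - u.2 x) -e2.
have fzu k : finite_energy (z k - u).
  have mzu : measurable_pair D (z k - u).
    by apply: measurable_pairB => //; have [] := fz k.
  split=> //; apply: (Intg_le_ae mD (measurable_energy_dens mQ mzu)
    (IntgZ mD (8 * (4 ^+ k)^-1) Is)).
  apply: filterS (zu k) => x + Dx => /(_ Dx).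
  by rewrite ger0_norm// (energy_dens_ge0 pQ).
exists u, (8 * I mu D s); split.
  rewrite -[u](subKr (z 0)); exact: finite_energyB.
move=> k; rewrite energyE mulrAC -IZ//.
apply: le_I_ae => //; first by have [] := fzu k.
exact: IntgZ.
Qed.

Lemma QH1_complete (z : nat -> pair) (S : R) : (forall j, QH1 Q D (z j)) ->
  (forall j, energy (z j.+1 - z j) <= S / 16 ^+ j) ->
  exists u C, QH1 Q D u /\ forall j, energy (z j - u) <= C / 4 ^+ j.
Proof.
move=> qz zS.
have fz j : finite_energy (z j) by have /QH1P[] := qz j.
have [u [C [fu zu]]] := finite_energy_complete fz zS.
exists u, C; split=> //; apply/QH1P => //; split=> // e e0.
have [K /(_ K (leqnn K)) HK] := geometric_small C (divr_gt0 e0 (ltr0n _ 4)).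
have e4 : 0 < e / 4 by rewrite divr_gt0.
have [_ /(_ _ e4)[phi Lphi phiz]] := (QH1P oD pQ mQ (z K)).1 (qz K).
exists phi => //; rewrite -(subrKA (z K)).
have fphi := Lip_Q_finite oD pQ mQ Lphi.
have f1 : finite_energy (u - z K) by exact: finite_energyB.
have f2 : finite_energy (z K - phi) by exact: finite_energyB.
apply: (le_trans (energyD oD pQ mQ f1 f2)).
rewrite energyBC; move: (zu K) HK phiz.
by move: (energy _) (energy _) (C / _) => a b c; lra.
Qed.

End completeness.

(** * Linear combinations and chain rule *)

Lemma diff_lin (R : realType) (V : normedModType R) (f g : V -> R^o) (c : R) x :
  differentiable f x -> differentiable g x ->
  differentiable (c *: f + g) x /\
  forall w, 'd (c *: f + g) x w = c * 'd f x w + 'd g x w.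
Proof.
move=> df dg; have dcf := differentiableZ c df.
split=> [|w]; first exact: (differentiableD dcf dg).
apply: (etrans (congr1 (fun h => h w) (diffD dcf dg))); congr (_ + _).
exact: (congr1 (fun h => h w) (diffZ c df)).
Qed.

Section lip_loc.
Context {R : realType} {n : nat}.
Local Notation Rn := 'rV[R]_n.+1.
Local Notation pair := ((Rn -> R) * (Rn -> Rn))%type.
Variable D : set Rn.
Implicit Types u v : pair.

Lemma Lip_loc_lin c u v : Lip_loc D u -> Lip_loc D v -> Lip_loc D (c *: u + v).
Proof.
move=> [lu [mu_ du]] [lv [mv dv]]; split.
  move=> x Dx; have [U Ux /lipschitzP[k k0 Hk]] := lu x Dx.
  have [V Vx /lipschitzP[l l0 Hl]] := lv x Dx.
  exists (U `&` V); first exact: filterI.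
  apply/lipschitzP; exists (`|c| * k + l) => [|y z [[Uy Vy] Dy] [[Uz Vz] Dz]].
    by rewrite addr_ge0 ?mulr_ge0.
  rewrite -[(c *: u + v).1 y]/(c * u.1 y + v.1 y).
  rewrite -[(c *: u + v).1 z]/(c * u.1 z + v.1 z).
  have -> : c * u.1 y + v.1 y - (c * u.1 z + v.1 z) =
    c * (u.1 y - u.1 z) + (v.1 y - v.1 z) by ring.
  apply: (le_trans (ler_normD _ _)); rewrite normrM mulrDl -mulrA lerD//.
    by rewrite ler_wpM2l// Hk.
  exact: Hl.
split.
  move=> i.
  rewrite (_ : (fun _ => _) = fun x => c * u.2 x ord0 i + v.2 x ord0 i).
    exact: measurable_funD (measurable_funM (measurable_cst c) (mu_ i)) (mv i).
  by apply/funext => x; rewrite mxE [in X in X + _]mxE.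
apply: filterS2 du dv => x hu hv Dx; have [du eu] := hu Dx; have [dv ev] := hv Dx.
have [dcuv ecuv] := diff_lin c du dv.
split; first exact: dcuv.
move=> w; apply: (etrans (ecuv w)); rewrite (eu w) (ev w).
by rewrite -[(c *: u + v).2 x]/(c *: u.2 x + v.2 x) dotvDl dotvZl.
Qed.

Variables Phi phi : R -> R.
Hypothesis dPhi : forall y : R, is_derive y 1 (Phi : R -> R^o) (phi y).
Hypothesis Phi_lip : forall y z, `|Phi y - Phi z| <= `|y - z|.
Hypothesis mphi : measurable_fun [set: R] phi.

Definition chain u : pair := (Phi \o u.1, fun x => phi (u.1 x) *: u.2 x).

Lemma measurable_chain_grad u : measurable_fun D u.1 -> measurable_field D u.2 ->
  measurable_field D (chain u).2.
Proof.
move=> mu1 mu2 i; rewrite (_ : (fun _ => _) =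
    fun x => phi (u.1 x) * u.2 x ord0 i); last by apply/funext => x; rewrite mxE.
exact: measurable_funM (measurableT_comp mphi mu1) (mu2 i).
Qed.

Lemma Lip_loc_chain u : measurable_fun D u.1 -> Lip_loc D u -> Lip_loc D (chain u).
Proof.
move=> mu1 [lu [mu2 du]]; split.
  move=> x Dx; have [U Ux /lipschitzP[k k0 Hk]] := lu x Dx.
  exists U => //; apply/lipschitzP; exists k => // y z Uy Uz.
  by apply: (le_trans (Phi_lip _ _)); exact: Hk.
split; first exact: measurable_chain_grad.
apply: filterS du => x hu Dx; have [du eu] := hu Dx.
have dP : differentiable (Phi : R^o -> R^o) (u.1 x).
  by apply/derivable1_diffP; have := dPhi (u.1 x); case.
split; first exact: (differentiable_comp du dP).
move=> w; rewrite /chain /= (diff_comp du dP) /= eu.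
rewrite diff1E// derive1E dotvZl mulrC.
by rewrite (@derive_val _ _ _ _ _ _ _ (dPhi (u.1 x))).
Qed.

End lip_loc.

Section sobolev_algebra.
Context {R : realType} {n : nat}.
Local Notation Rn := 'rV[R]_n.+1.
Local Notation mu := (@lebesgueRn R n).
Variables (D : set Rn) (Q : Rn -> 'M[R]_n.+1).
Local Notation pair := ((Rn -> R) * (Rn -> Rn))%type.
Implicit Types u v : pair.
Hypothesis oD : open D.
Hypothesis pQ : forall x, D x -> nonneg_sym (Q x).
Hypothesis mQ : forall i j, measurable_fun D (fun x => Q x i j).
Let mD : measurable D. Proof. exact: open_measurableRn. Qed.
Local Notation energy := (energy D Q).
Local Notation energy_dens := (energy_dens Q).
Local Notation finite_energy := (finite_energy D Q).

Lemma Lip_Q_lin c u v : Lip_Q Q D u -> Lip_Q Q D v -> Lip_Q Q D (c *: u + v).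
Proof.
move=> Lu Lv; split; first exact: Lip_loc_lin Lu.1 Lv.1.
have fuv : finite_energy (c *: u + v).
  exact: (finite_energy_lin oD pQ mQ c (Lip_Q_finite oD pQ mQ Lu)
    (Lip_Q_finite oD pQ mQ Lv)).
by rewrite (QH1norm_real oD pQ mQ fuv) ltry.
Qed.

Lemma QH1_finite u : QH1 Q D u -> finite_energy u.
Proof. by move=> /(QH1P oD pQ mQ)[]. Qed.

Lemma QH1_lin c u v : QH1 Q D u -> QH1 Q D v -> QH1 Q D (c *: u + v).
Proof.
move=> /(QH1P oD pQ mQ)[fu au] /(QH1P oD pQ mQ)[fv av].
apply/(QH1P oD pQ mQ); split; first exact: finite_energy_lin.
move=> e e0; have c1 : 0 < c ^+ 2 + 1 by rewrite ltr_wpDl ?sqr_ge0.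
have [p Lp pu] := au (e / 4 / (c ^+ 2 + 1)) ltac:(by rewrite !divr_gt0).
have [q Lq qv] := av (e / 4) ltac:(by rewrite divr_gt0).
exists (c *: p + q); first exact: Lip_Q_lin.
have -> : c *: u + v - (c *: p + q) = c *: (u - p) + (v - q).
  by rewrite scalerBr opprD addrACA.
have f1 : finite_energy (u - p).
  exact: (finite_energyB oD pQ mQ fu (Lip_Q_finite oD pQ mQ Lp)).
have f2 : finite_energy (v - q).
  exact: (finite_energyB oD pQ mQ fv (Lip_Q_finite oD pQ mQ Lq)).
apply: (le_trans (energy_lin oD pQ mQ c f1 f2)).
have : c ^+ 2 * energy (u - p) <= e / 4.
  apply: (@le_trans _ _ (c ^+ 2 * (e / 4 / (c ^+ 2 + 1)))).
    by rewrite ler_wpM2l ?sqr_ge0.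
  rewrite mulrCA ler_piMr ?divr_ge0 ?(ltW e0)// ler_pdivrMr// mul1r lerDl//.
by move: qv; move: (energy (v - q)) (c ^+ 2 * _) => a b; lra.
Qed.

Lemma QH1_0 : QH1 Q D 0.
Proof.
have e0 := energy_dens0 Q.
have m0 : measurable_pair D (0 : pair).
  split; first exact: measurable_cst.
  by move=> i; under eq_fun do rewrite mxE; exact: measurable_cst.
have f0 : finite_energy 0.
  split=> //; apply: (eq_Intg mD (f := cst 0)) => [x _|]; first by rewrite e0.
  exact: integrable0.
apply/(QH1P oD pQ mQ); split=> // e e_gt0.
exists 0; last first.
  rewrite subr0 energyE (@eq_I _ _ _ _ _ _ (cst 0)) => [|x _]; last exact: e0.
  by rewrite /I /Rintegral integral0 ltW.
split; last by rewrite (QH1norm_real oD pQ mQ f0) ltry.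
split.
  move=> x Dx; exists setT; first exact: filterT.
  by apply/lipschitzP; exists 0 => // y z _ _; rewrite mul0r subrr normr0.
split; first by have [] := m0.
apply: aeW => x Dx; split; first exact: differentiable_cst.
move=> v; rewrite (_ : dotv _ _ = 0); last by rewrite -(scale0r 0) dotvZl mul0r.
by rewrite diff_cst.
Qed.

Variables Phi phi : R -> R.
Hypothesis dPhi : forall y : R, is_derive y 1 (Phi : R -> R^o) (phi y).
Hypothesis Phi0 : Phi 0 = 0.
Hypothesis Phi_lip : forall y z, `|Phi y - Phi z| <= `|y - z|.
Hypothesis mPhi : measurable_fun [set: R] Phi.
Hypothesis mphi : measurable_fun [set: R] phi.
Hypothesis phi01 : forall y, 0 <= phi y <= 1.
Hypothesis phi_lip : forall y z, `|phi y - phi z| <= `|y - z|.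
Local Notation chain := (chain Phi phi).

Lemma energy_dens_chain u x : D x -> energy_dens (chain u) x <= energy_dens u x.
Proof.
move=> Dx; rewrite /energy_dens /= qformZl qformZr.
have eu := qform_ge0 (u.2 x) (pQ Dx).
have /andP[p0 p1] := phi01 (u.1 x).
apply: lerD.
  rewrite -[leRHS]real_normK ?num_real// -[leLHS]real_normK ?num_real//.
  by rewrite ler_sqr ?nnegrE//; have := Phi_lip (u.1 x) 0; rewrite Phi0 !subr0.
by rewrite mulrA ler_piMl// -(mulr1 1) ler_pM.
Qed.

Lemma measurable_pair_chain u : measurable_pair D u -> measurable_pair D (chain u).
Proof.
move=> [mu1 mu2]; split; first exact: measurableT_comp.
exact: measurable_chain_grad.
Qed.

Lemma finite_energy_chain u : finite_energy u -> finite_energy (chain u).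
Proof.
move=> [mu_ iu]; split; first exact: measurable_pair_chain.
apply: (Intg_le mD _ iu).
  exact: (measurable_energy_dens mQ (measurable_pair_chain mu_)).
move=> x Dx; rewrite ger0_norm ?(energy_dens_ge0 pQ)//.
exact: energy_dens_chain.
Qed.

(** Where [phi (u) - phi (v)] meets a large gradient of [u] it is merely
    bounded; where the gradient is at most [m] it is controlled by [u - v]. *)
Lemma energy_dens_chainB u v x (m : R) : D x -> 0 <= m ->
  energy_dens (chain u - chain v) x <=
  (3 + 2 * m) * energy_dens (u - v) x +
  2 * ((m < qform (Q x) (u.2 x) (u.2 x))%R%:R * qform (Q x) (u.2 x) (u.2 x)).
Proof.
move=> Dx m0; rewrite /energy_dens.
rewrite -[(chain u - chain v).1 x]/(Phi (u.1 x) - Phi (v.1 x)).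
rewrite -[(u - v).1 x]/(u.1 x - v.1 x).
have -> : (chain u - chain v).2 x =
  phi (v.1 x) *: (u.2 x - v.2 x) + (phi (u.1 x) - phi (v.1 x)) *: u.2 x.
  rewrite -[LHS]/(phi (u.1 x) *: u.2 x - phi (v.1 x) *: v.2 x).
  by rewrite scalerBr scalerBl [RHS]addrC subrKA.
rewrite -[(u - v).2 x]/(u.2 x - v.2 x).
apply: (le_trans (lerD (lexx _) (qform_le_diag _ _ (pQ Dx)))).
rewrite !qformZl !qformZr.
have e1 := qform_ge0 (u.2 x) (pQ Dx).
have e2 := qform_ge0 (u.2 x - v.2 x) (pQ Dx).
have /andP[p0 p1] := phi01 (u.1 x); have /andP[q0 q1] := phi01 (v.1 x).
have Ph : (Phi (u.1 x) - Phi (v.1 x)) ^+ 2 <= (u.1 x - v.1 x) ^+ 2.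
  rewrite -[leRHS]real_normK ?num_real// -[leLHS]real_normK ?num_real//.
  by rewrite ler_sqr ?nnegrE.
have ph : (phi (u.1 x) - phi (v.1 x)) ^+ 2 <= (u.1 x - v.1 x) ^+ 2.
  rewrite -[leRHS]real_normK ?num_real// -[leLHS]real_normK ?num_real//.
  by rewrite ler_sqr ?nnegrE.
have ph1 : (phi (u.1 x) - phi (v.1 x)) ^+ 2 <= 1.
  move: (phi _) (phi _) p0 p1 q0 q1 => a b *.
  have : 0 <= (1 - (a - b)) * (1 + (a - b)) by rewrite mulr_ge0//; lra.
  by rewrite expr2; lra.
have qq : phi (v.1 x) * (phi (v.1 x) * qform (Q x) (u.2 x - v.2 x) (u.2 x - v.2 x))
    <= qform (Q x) (u.2 x - v.2 x) (u.2 x - v.2 x).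
  by rewrite mulrA ler_piMl// -(mulr1 1) ler_pM.
rewrite (mulrA (_ - _)) -expr2.
move: (qform _ (u.2 x) _) (qform _ (_ - _) _) e1 e2 qq => a b a0 b0 qq.
move: Ph ph ph1; set s := (Phi _ - _) ^+ 2; set t := (phi _ - _) ^+ 2; set w := (_ - _) ^+ 2.
move=> sw tw t1; have s0 : 0 <= s by exact: sqr_ge0.
have t0 : 0 <= t by exact: sqr_ge0.
have w0 : 0 <= w by exact: sqr_ge0.
(* Either the gradient is large and [t <= 1], or [a <= m] and [t <= w]. *)
have ta : t * a <= m * w + (m < a)%R%:R * a.
  case: ltP => [_|am] /=.
    rewrite mul1r; apply: (@le_trans _ _ a); first by rewrite ler_piMl.
    by rewrite lerDr mulr_ge0.
  rewrite mul0r addr0 mulrC; exact: ler_pM.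
have mb : 0 <= m * b by exact: mulr_ge0.
move: (_ * (_ * b)) qq ta => qb qq; move: (t * a) (_%:R * a) => ta ia.
by lra.
Qed.

(** Approximate [u] by locally Lipschitz [p] after choosing [m] so that the
    energy of [u] over the set of gradients larger than [m] is small. *)
Lemma QH1_chain u : QH1 Q D u -> QH1 Q D (chain u).
Proof.
move=> /(QH1P oD pQ mQ)[fu au]; have fcu := finite_energy_chain fu.
apply/(QH1P oD pQ mQ); split; first exact: fcu.
move=> e e0.
have [[mu1 mu2] iu] := fu.
pose g x := qform (Q x) (u.2 x) (u.2 x).
have mg : measurable_fun D g by exact: measurable_qform.
have g0 x : D x -> 0 <= g x by move=> Dx; exact: qform_ge0 (pQ Dx).
have ig : Intg mu D g.
  apply: (Intg_le mD mg iu) => x Dx; rewrite ger0_norm ?g0//.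
  by rewrite lerDr sqr_ge0.
have e4 : 0 < e / 4 by rewrite divr_gt0.
have [m Hm] := I_superlevel_small mD mg ig g0 e4.
have m0 : 0 <= m%:R :> R by exact: ler0n.
have m3 : 0 < 3 + 2 * m%:R :> R by lra.
have [p Lp pu] := au (e / 2 / (3 + 2 * m%:R)) ltac:(by rewrite !divr_gt0).
have fp := Lip_Q_finite oD pQ mQ Lp; have fcp := finite_energy_chain fp.
exists (chain p).
  split; last by rewrite (QH1norm_real oD pQ mQ fcp) ltry.
  exact: (Lip_loc_chain dPhi Phi_lip mphi fp.1.1 Lp.1).
have i1 := Intg_superlevel mD m%:R mg ig g0.
have fB := finite_energyB oD pQ mQ fu fp.
have i2 : Intg mu D (fun x => (3 + 2 * m%:R) * energy_dens (u - p) x).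
  by apply: IntgZ => //; have [] := fB.
have i3 := IntgZ mD 2 i1.
apply: (@le_trans _ _ (I mu D (fun x => (3 + 2 * m%:R) * energy_dens (u - p) x
   + 2 * ((m%:R < g x)%R%:R * g x)))).
  apply: le_I => //.
  - by have [] := finite_energyB oD pQ mQ fcu fcp.
  - exact: IntgD.
  by move=> x Dx; exact: energy_dens_chainB.
rewrite (ID mD i2 i3) (IZ mD _ i1) (IZ mD _ fB.2).
have : (3 + 2 * m%:R) * energy (u - p) <= e / 2.
  by rewrite mulrC -ler_pdivlMr.
move: Hm; rewrite energyE.
by move: (I mu D _) (_ * I mu D _) => a b; lra.
Qed.

End sobolev_algebra.

(** * Weighted integrals from the global Sobolev inequality *)

Section lnorm.
Context {R : realType} {n : nat}.
Local Notation Rn := 'rV[R]_n.+1.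
Local Notation mu := (@lebesgueRn R n).
Variable D : set Rn.
Hypothesis mD : measurable D.
Implicit Types f g : Rn -> R.

Lemma Lnorm_onE f (r : R) : 0 < r ->
  (Lnorm_on D r%:E f = (\int[mu]_(x in D) (`|f x| `^ r)%:E) `^ r^-1)%E.
Proof.
move=> r0; rewrite /Lnorm_on unlock; congr (_ `^ _)%E.
rewrite [RHS]integral_mkcond; apply: eq_integral => x _.
rewrite !patchE; case: ifP => // _.
by rewrite abse0 poweR0r// gt_eqF.
Qed.

Lemma measurable_norm_powR f (r : R) : measurable_fun D f ->
  measurable_fun D (fun x => `|f x| `^ r).
Proof.
move=> mf; have mn : measurable_fun D (fun x => `|f x|) by exact: measurableT_comp.
exact: (measurableT_comp (measurable_powR r) mn).
Qed.

Lemma Lnorm_on_Intg f (r c : R) : 0 < r -> 0 <= c -> measurable_fun D f ->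
  (Lnorm_on D r%:E f <= c%:E)%E ->
  Intg mu D (fun x => `|f x| `^ r) /\ I mu D (fun x => `|f x| `^ r) <= c `^ r.
Proof.
move=> r0 c0 mf; rewrite Lnorm_onE//.
set J := (\int[mu]_(x in D) _)%E => hJ.
have J0 : (0 <= J)%E by apply: integral_ge0 => x _; rewrite lee_fin powR_ge0.
have {}hJ : (J <= (c `^ r)%:E)%E.
  rewrite -[J]poweRe1// -(@mulVf _ r) ?gt_eqF// poweRrM -poweR_EFin.
  by apply: (gt0_ler_poweR (ltW r0)) => //; rewrite in_itv/= leey andbT// poweR_ge0.
have iJ : Intg mu D (fun x => `|f x| `^ r).
  apply/integrableP; split; first exact/measurable_EFinP/measurable_norm_powR.
  under eq_integral => x _ do rewrite gee0_abs ?lee_fin ?powR_ge0//.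
  exact: le_lt_trans hJ (ltry _).
by split=> //; rewrite -lee_fin EFin_I.
Qed.

Lemma Lp_on_Intg f (r : R) : 0 < r -> Lp_on D r%:E f ->
  Intg mu D (fun x => `|f x| `^ r).
Proof.
move=> r0 [mf fr].
have L0 : (0 <= Lnorm_on D r%:E f)%E by exact: Lnorm_ge0.
have Lf : Lnorm_on D r%:E f \is a fin_num by rewrite ge0_fin_numE.
have [] := @Lnorm_on_Intg f r (fine (Lnorm_on D r%:E f)) r0 _ mf _ => //.
  exact: fine_ge0.
by rewrite fineK.
Qed.

Lemma Lnorm_on2 f : Lp_on D 2%:E f ->
  Intg mu D (fun x => f x ^+ 2) /\
  Lnorm_on D 2%:E f = (Num.sqrt (I mu D (fun x => f x ^+ 2)))%:E.
Proof.
move=> Lf.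
have E x : `|f x| `^ 2 = f x ^+ 2 by rewrite powR_mulrn// real_normK ?num_real.
have If : Intg mu D (fun x => f x ^+ 2).
  by apply: eq_Intg (Lp_on_Intg _ Lf) => // x _; rewrite E.
split=> //; rewrite Lnorm_onE//.
under eq_integral do rewrite E.
by rewrite -EFin_I// poweR_EFin powR12_sqrt// I_ge0// => x _; rewrite sqr_ge0.
Qed.

Lemma powR_le_powR (a r s : R) : 0 <= a -> 0 < r -> r <= s ->
  a `^ r <= 1 + a `^ s.
Proof.
move=> a0 r0 rs; have [a1|a1] := leP a 1.
  apply: (@le_trans _ _ 1); last by rewrite lerDl powR_ge0.
  have -> : 1 = 1 `^ r :> R by rewrite powR1.
  by apply: (ge0_ler_powR (ltW r0)); rewrite ?nnegrE.
apply: (@le_trans _ _ (a `^ s)); last by rewrite lerDr.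
by apply: ler_powR => //; exact: ltW.
Qed.

(** The measure of [D] is finite: [a^r <= 1 + a^s] for finite exponents, and an
    essentially bounded function is dominated by a constant. *)
Lemma Lp_on_Intg_lower f (r : R) (t : \bar R) : (mu D < +oo)%E -> 0 < r ->
  (r%:E < t)%E -> Lp_on D t f -> Intg mu D (fun x => `|f x| `^ r).
Proof.
move=> Doo r0; case: t => [s|_|//].
  rewrite lte_fin => rs Lf; have s0 := lt_trans r0 rs.
  have [mf _] := Lf.
  apply: (Intg_le mD (measurable_norm_powR _ mf)
    (IntgD mD (Intg_cst mD 1 Doo) (Lp_on_Intg s0 Lf))) => x _.
  by rewrite ger0_norm ?powR_ge0// powR_le_powR// ltW.
move=> [mf]; rewrite /Lnorm_on unlock.
case: ifPn => [muT|muT] fin; last first.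
  have muD : mu D = 0%E.
    apply/eqP; rewrite eq_le measure_ge0 andbT.
    rewrite -leNgt in muT; apply: le_trans muT.
    by apply: le_measure; rewrite ?inE.
  apply: (Intg_le_ae mD (measurable_norm_powR _ mf) (Intg_cst mD 0 Doo)).
  by exists D; split => // x /= h; apply: contrapT => nD; apply: h.
set h : Rn -> \bar R := (abse \o _) in fin.
have [M hM] : exists M : R, {ae mu, forall x, (h x <= M%:E)%E}.
  have : ess_sup mu h \is a fin_num.
    by rewrite ge0_fin_numE//; apply: ess_sup_gee => //; apply: aeW => x; exact: abse_ge0.
  move=> hf; exists (fine (ess_sup mu h)); rewrite fineK//.
  exact: ess_sup_ge.
apply: (Intg_le_ae mD (measurable_norm_powR _ mf) (Intg_cst mD (`|M| `^ r) Doo)).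
apply: filterS hM => x hx Dx; rewrite ger0_norm ?powR_ge0//.
apply: ge0_ler_powR => //; rewrite ?nnegrE ?(ltW r0)//.
move: hx; rewrite /h /= patchE mem_set//= lee_fin => /le_trans; apply.
exact: ler_norm.
Qed.

End lnorm.

Lemma sqr_split_le (R : realType) (a b c : R) : 0 <= a ->
  a * c ^+ 2 <= 2 * (a * b ^+ 2) + 2 * (a * (c - b) ^+ 2).
Proof.
by move=> a0; have := mulr_ge0 a0 (sqr_ge0 (2 * b - c)); rewrite !sqrrB; lra.
Qed.

Lemma weight_absorb (R : realType) (th z a x y w k e : R) :
  a <= th * (1 + z) * x ->
  th * (1 + z) * x <= th * (1 + z) * (2 * y + 2 * w) ->
  (th * (4 * (1 + z)) + 2 * k) * w <= e ->
  2 * a + 2 * k * w <= 4 * (1 + z) * th * y + e.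
Proof. by lra. Qed.

Section sobolev_weight.
Context {R : realType} {n : nat}.
Local Notation Rn := 'rV[R]_n.+1.
Local Notation mu := (@lebesgueRn R n).
Variables (D : set Rn) (Q : Rn -> 'M[R]_n.+1).
Local Notation pair := ((Rn -> R) * (Rn -> Rn))%type.
Implicit Types u v : pair.
Hypothesis oD : open D.
Hypothesis pQ : forall x, D x -> nonneg_sym (Q x).
Hypothesis mQ : forall i j, measurable_fun D (fun x => Q x i j).
Let mD : measurable D. Proof. exact: open_measurableRn. Qed.
Local Notation energy := (energy D Q).
Local Notation energy_dens := (energy_dens Q).

Variables (omega C4 : R).
Hypothesis omega1 : 1 < omega.
Hypothesis C40 : 0 < C4.
Hypothesis sobolev : forall f, Lip_Q Q D f ->
  (Lnorm_on D (2 * omega)%:E f.1 <= C4%:E * QH1norm Q D f)%E.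

Let p := omega / (omega - 1).

Let o0 : 0 < omega. Proof. by rewrite (lt_trans _ omega1). Qed.
Let o10 : 0 < omega - 1. Proof. by rewrite subr_gt0. Qed.
Let p0 : 0 < p. Proof. by rewrite divr_gt0. Qed.

(** One of the two terms already dominates, according to the side of the curve
    [a = b^(omega - 1)] on which [(a, b)] lies. *)
Lemma crude_young (a b : R) : 0 <= a -> 0 <= b -> a * b <= a `^ p + b `^ omega.
Proof.
move=> a0 b0; have [ab|ba] := leP a (b `^ (omega - 1)).
  apply: (@le_trans _ _ (b `^ omega)); last by rewrite lerDr powR_ge0.
  have -> : b `^ omega = b `^ (omega - 1) * b `^ 1.
    by rewrite -powRD ?subrK// gt_eqF.
  by rewrite powRr1// ler_wpM2r.
apply: (@le_trans _ _ (a `^ p)); last by rewrite lerDl powR_ge0.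
have bE : b <= a `^ (p - 1).
  have -> : b = (b `^ (omega - 1)) `^ (p - 1).
    rewrite -powRrM (_ : (omega - 1) * (p - 1) = 1) ?powRr1//.
    by rewrite /p; field; rewrite gt_eqF.
  apply: ge0_ler_powR; rewrite ?nnegrE ?powR_ge0 ?(ltW ba)//.
  by rewrite /p subr_ge0 ler_pdivlMr// mul1r gerBl.
have -> : a `^ p = a `^ 1 * a `^ (p - 1).
  by rewrite -powRD addrC ?subrK// gt_eqF.
by rewrite powRr1// ler_wpM2l.
Qed.

Lemma sobolev_Lip phi : Lip_Q Q D phi ->
  Intg mu D (fun x => `|phi.1 x| `^ (2 * omega)) /\
  I mu D (fun x => `|phi.1 x| `^ (2 * omega))
    <= (C4 * Num.sqrt (energy phi)) `^ (2 * omega).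
Proof.
move=> Lphi; have fphi := Lip_Q_finite oD pQ mQ Lphi.
apply: (Lnorm_on_Intg mD).
- by rewrite mulr_gt0.
- by rewrite mulr_ge0 ?sqrtr_ge0// ltW.
- by case: fphi => [[]].
by have := sobolev Lphi; rewrite (QH1norm_real oD pQ mQ fphi) -EFinM.
Qed.

(** The factor [4] comes from using [(a + b)^2 <= 2 a^2 + 2 b^2] twice in the
    passage from Lipschitz functions to [QH1]. *)
Definition weight_const : R := 4 * (1 + C4 `^ (2 * omega)).

Lemma weight_const_gt0 : 0 < weight_const.
Proof. by rewrite mulr_gt0// ltr_pwDl// powR_ge0. Qed.

Section weight.
Variables (g : Rn -> R) (theta : R).
Hypothesis mg : measurable_fun D g.
Hypothesis g0 : forall x, D x -> 0 <= g x.
Hypothesis th0 : 0 < theta.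
Hypothesis ig : Intg mu D (fun x => g x `^ p).
Hypothesis gtheta : I mu D (fun x => g x `^ p) <= theta `^ p.

(** Young's inequality for [g / theta] and [phi^2 / E], with the conjugate
    exponents [p] and [omega]; [E] slightly exceeds the energy of [phi], which
    may be [0]. *)
Lemma weight_Lip phi : Lip_Q Q D phi ->
  Intg mu D (fun x => g x * phi.1 x ^+ 2) /\
  I mu D (fun x => g x * phi.1 x ^+ 2)
    <= theta * (1 + C4 `^ (2 * omega)) * energy phi.
Proof.
move=> Lphi; have [iS S] := sobolev_Lip Lphi.
have fphi := Lip_Q_finite oD pQ mQ Lphi.
have mp : measurable_fun D phi.1 by case: fphi => [[]].
have E0 : 0 <= energy phi by exact: energy_ge0.
have c0 : 0 <= 1 + C4 `^ (2 * omega) by rewrite addr_ge0 ?powR_ge0.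
have key E : energy phi < E -> Intg mu D (fun x => g x * phi.1 x ^+ 2) /\
    I mu D (fun x => g x * phi.1 x ^+ 2) <= theta * (1 + C4 `^ (2 * omega)) * E.
  move=> pE; have E_gt0 : 0 < E by exact: le_lt_trans pE.
  pose h x := theta * E * ((theta `^ p)^-1 * g x `^ p +
                 (E `^ omega)^-1 * `|phi.1 x| `^ (2 * omega)).
  have i1 := IntgZ mD (theta `^ p)^-1 ig.
  have i2 := IntgZ mD (E `^ omega)^-1 iS.
  have ih : Intg mu D h by apply: IntgZ => //; exact: IntgD.
  have le_h x : D x -> g x * phi.1 x ^+ 2 <= h x.
    move=> Dx; have gx := g0 Dx.
    have -> : g x * phi.1 x ^+ 2 = theta * E * ((g x / theta) * (phi.1 x ^+ 2 / E)).
      by field; rewrite !gt_eqF.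
    rewrite ler_pM2l ?mulr_gt0//.
    have := @crude_young (g x / theta) (phi.1 x ^+ 2 / E).
    rewrite !divr_ge0 ?sqr_ge0 ?(ltW th0) ?(ltW E_gt0)// => /(_ isT isT).
    move/le_trans; apply.
    rewrite (@powRM _ (g x)) ?invr_ge0 ?(ltW th0)//.
    rewrite (@powRM _ (phi.1 x ^+ 2)) ?invr_ge0 ?sqr_ge0 ?(ltW E_gt0)//.
    have invpow (y r : R) : 0 <= y -> y^-1 `^ r = (y `^ r)^-1.
      by move=> y0; rewrite -powR_inv1// -powRrM mulN1r powRN.
    rewrite !invpow ?(ltW th0) ?(ltW E_gt0)// powRrM powR_mulrn//.
    by rewrite real_normK ?num_real// ![_^-1 * _]mulrC.
  have igp : Intg mu D (fun x => g x * phi.1 x ^+ 2).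
    apply: (Intg_le mD _ ih).
      exact: measurable_funM mg (measurable_funX 2 mp).
    move=> x Dx; rewrite ger0_norm; first exact: le_h.
    by rewrite mulr_ge0 ?sqr_ge0 ?g0.
  split=> //; apply: (le_trans (le_I mD igp ih le_h)).
  rewrite (IZ mD _ (IntgD mD i1 i2)) (ID mD i1 i2) (IZ mD _ ig) (IZ mD _ iS).
  rewrite [leRHS]mulrAC ler_pM2l ?mulr_gt0//.
  apply: lerD; first by rewrite mulrC ler_pdivrMr ?powR_gt0// mul1r.
  rewrite mulrC ler_pdivrMr ?powR_gt0//; apply: (le_trans S).
  rewrite powRM ?sqrtr_ge0 ?(ltW C40)// ler_wpM2l ?powR_ge0//.
  rewrite powRrM powR_mulrn ?sqrtr_ge0// sqr_sqrtr//.
  by apply: ge0_ler_powR; rewrite ?nnegrE ?(ltW o0)// ltW.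
have [ii _] := key (energy phi + 1) ltac:(by rewrite ltrDl).
split=> //; apply/ler_addgt0Pr => e e0.
pose c := theta * (1 + C4 `^ (2 * omega)) + 1.
have c_gt0 : 0 < c by rewrite ltr_wpDl ?mulr_ge0// ltW.
have [_] := key (energy phi + e / c) ltac:(by rewrite ltrDl divr_gt0).
move/le_trans; apply; rewrite mulrDr lerD2l mulrCA ler_piMr ?(ltW e0)//.
by rewrite ler_pdivrMr// mul1r lerDl.
Qed.

(** The bound for Lipschitz functions passes to the limit after truncation of
    [g], since the energy alone controls [int g u^2] only for bounded [g]. *)
Lemma weight_QH1 u : QH1 Q D u ->
  Intg mu D (fun x => g x * u.1 x ^+ 2) /\
  I mu D (fun x => g x * u.1 x ^+ 2) <= weight_const * theta * energy u.
Proof.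
move=> /(QH1P oD pQ mQ)[fu au]; have [[mu1 _] iu] := fu.
have mgu : measurable_fun D (fun x => g x * u.1 x ^+ 2).
  exact: measurable_funM mg (measurable_funX 2 mu1).
have gu0 x : D x -> 0 <= g x * u.1 x ^+ 2.
  by move=> Dx; rewrite mulr_ge0 ?g0 ?sqr_ge0.
apply: (Intg_sublevel mD mg mgu gu0) => m.
have sq_le v x : D x -> v.1 x ^+ 2 <= energy_dens v x.
  by move=> Dx; rewrite lerDl qform_ge0//; exact: pQ.
have trunc v x : D x -> (g x <= m%:R)%R%:R * (g x * v.1 x ^+ 2) <=
    m%:R * energy_dens v x.
  move=> Dx; have gx := g0 Dx; have s0 := sqr_ge0 (v.1 x).
  have ev := sq_le v x Dx.
  case: (leP (g x) m%:R) => gm /=; rewrite ?mul1r ?mul0r; last first.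
    by rewrite mulr_ge0// (le_trans s0).
  by rewrite ler_pM.
have mtr : measurable_fun D (fun x => (g x <= m%:R)%R%:R * (g x * u.1 x ^+ 2)).
  exact: measurable_funM (measurable_sublevel _ mg) mgu.
have itr : Intg mu D (fun x => (g x <= m%:R)%R%:R * (g x * u.1 x ^+ 2)).
  apply: (Intg_le mD mtr (IntgZ mD m%:R iu)) => x Dx.
  rewrite ger0_norm; first exact: trunc.
  by rewrite mulr_ge0// gu0.
split=> //; apply/ler_addgt0Pr => e e0.
have wc0 := weight_const_gt0.
pose c := theta * weight_const + 2 * m%:R.
have wt0 : 0 < theta * weight_const by rewrite mulr_gt0.
have m0 : 0 <= m%:R :> R by exact: ler0n.
have c_gt0 : 0 < c by rewrite ltr_pwDl// mulr_ge0.
have [phi Lphi du] := au (e / c) ltac:(by rewrite divr_gt0).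
have fphi := Lip_Q_finite oD pQ mQ Lphi.
have [ip wp] := weight_Lip Lphi.
have fB := finite_energyB oD pQ mQ fu fphi.
have i1 := IntgZ mD 2 ip; have i2 := IntgZ mD (2 * m%:R) fB.2.
have le1 : I mu D (fun x => (g x <= m%:R)%R%:R * (g x * u.1 x ^+ 2)) <=
    2 * I mu D (fun x => g x * phi.1 x ^+ 2) + 2 * m%:R * energy (u - phi).
  rewrite -(IZ mD _ ip) energyE -(IZ mD _ fB.2) -(ID mD i1 i2).
  apply: le_I => //; first exact: IntgD.
  move=> x Dx; have := trunc (u - phi) x Dx.
  have gx := g0 Dx; have gp : 0 <= g x * phi.1 x ^+ 2 by rewrite mulr_ge0 ?sqr_ge0.
  have ev := sq_le (u - phi) x Dx; have s0 := sqr_ge0 ((u - phi).1 x).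
  have me : 0 <= m%:R * energy_dens (u - phi) x.
    by rewrite mulr_ge0// (le_trans s0).
  case: (leP (g x) m%:R) => gm /= h; rewrite ?mul1r ?mul0r in h *; last first.
    by apply: addr_ge0; [exact: mulr_ge0 | rewrite -mulrA; exact: mulr_ge0].
  rewrite -[2 * m%:R * _]mulrA.
  apply: (@le_trans _ _ (2 * (g x * phi.1 x ^+ 2) + 2 * (g x * (u - phi).1 x ^+ 2))).
    exact: (sqr_split_le (phi.1 x) (u.1 x) gx).
  by rewrite lerD2l ler_pM2l.
apply: (le_trans le1).
have := energyB oD pQ mQ fu fB; rewrite subKr => Ephi.
have : c * energy (u - phi) <= e by rewrite mulrC -ler_pdivlMr.
have : theta * (1 + C4 `^ (2 * omega)) * energy phi <=
   theta * (1 + C4 `^ (2 * omega)) * (2 * energy u + 2 * energy (u - phi)).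
  by rewrite ler_wpM2l// mulr_ge0 ?addr_ge0 ?powR_ge0// ltW.
by move: wp; rewrite /c /weight_const; exact: weight_absorb.
Qed.

End weight.
End sobolev_weight.

(** * The bilinear form of the operator *)

Section swap.
Context {R : realType} {n N : nat}.

(** The operator whose bilinear form is the transposed one. *)
Definition swap_operator (X : operator R n N) : operator R n N :=
  Operator (opP X) (opG X) (opS X) (opR X) (opH X) (opF X).

End swap.

Section form.
Context {R : realType} {n N : nat}.
Local Notation Rn := 'rV[R]_n.+1.
Local Notation mu := (@lebesgueRn R n).
Variables (D : set Rn) (Q : Rn -> 'M[R]_n.+1) (X : operator R n N).
Local Notation pair := ((Rn -> R) * (Rn -> Rn))%type.
Implicit Types u v : pair.
Local Notation energy_dens := (energy_dens Q).

Definition form_dens u v (x : Rn) : R :=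
  dotv (v.2 x) (mxact (opP X x) (u.2 x))
  + v.1 x * tapp (opH X) (opR X) u x
  + u.1 x * tapp (opG X) (opS X) v x
  + opF X x * u.1 x * v.1 x.

Definition neg_dens u v (x : Rn) : R :=
  opF X x * u.1 x * v.1 x + tapp_mul (opH X) (opR X) u v x.

(** The first-order part of the form that the negativity condition for [H] and
    [R] leaves out. *)
Definition drift u (x : Rn) : R :=
  tapp (opG X) (opS X) u x - tapp (opH X) (opR X) u x.

Definition coef (x : Rn) : R := \sum_i (`|opG X i x| + `|opH X i x|).

(** Zero-order weight that dominates all lower-order terms. *)
Definition weight (x : Rn) : R := `|opF X x| + coef x ^+ 2.

Definition dominant u x : R := energy_dens u x + weight x * u.1 x ^+ 2.

Lemma tapp_mulE u v x : tapp_mul (opH X) (opR X) u v x =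
  u.1 x * tapp (opH X) (opR X) v x + v.1 x * tapp (opH X) (opR X) u x.
Proof.
rewrite /tapp_mul /tapp !mulr_sumr -big_split /=; apply: eq_bigr => i _.
by rewrite /vapp_mul; ring.
Qed.

(** In the last term only [v] is differentiated: a test function whose gradient
    is a multiple of [grad u] makes it comparable with the principal part. *)
Lemma form_densE u v x : form_dens u v x =
  qform (opP X x) (v.2 x) (u.2 x) + neg_dens u v x + u.1 x * drift v x.
Proof. by rewrite /form_dens /neg_dens tapp_mulE /drift /qform; ring. Qed.

Lemma neg_densE u v x : neg_dens u v x = opF X x * u.1 x * v.1 x +
  (u.1 x * tapp (opH X) (opR X) v x + v.1 x * tapp (opH X) (opR X) u x).
Proof. by rewrite /neg_dens tapp_mulE. Qed.

Lemma driftE u x :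
  drift u x = tapp (opG X) (opS X) u x - tapp (opH X) (opR X) u x.
Proof. by []. Qed.

Lemma tapp_lin (g : 'I_N -> Rn -> R) (W : 'I_N -> Rn -> Rn) c u v x :
  tapp g W (c *: u + v) x = c * tapp g W u x + tapp g W v x.
Proof.
rewrite /tapp mulr_sumr -big_split /=; apply: eq_bigr => i _.
rewrite /vapp -[(c *: u + v).2 x]/(c *: u.2 x + v.2 x) dotvDr dotvZr; ring.
Qed.

Lemma form_dens_linl c u v w x :
  form_dens (c *: u + v) w x = c * form_dens u w x + form_dens v w x.
Proof.
rewrite /form_dens tapp_lin.
rewrite -[(c *: u + v).1 x]/(c * u.1 x + v.1 x).
rewrite -[(c *: u + v).2 x]/(c *: u.2 x + v.2 x).
rewrite -![dotv _ (mxact _ _)]/(qform _ _ _) qformDr qformZr; ring.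
Qed.

Lemma form_dens_linr c u v w x :
  form_dens w (c *: u + v) x = c * form_dens w u x + form_dens w v x.
Proof.
rewrite /form_dens tapp_lin.
rewrite -[(c *: u + v).1 x]/(c * u.1 x + v.1 x).
rewrite -[(c *: u + v).2 x]/(c *: u.2 x + v.2 x).
rewrite -![dotv _ (mxact _ _)]/(qform _ _ _) qformDl qformZl; ring.
Qed.

Lemma coef_ge0 x : 0 <= coef x.
Proof. by apply: sumr_ge0 => i _; rewrite addr_ge0. Qed.

Lemma weight_ge0 x : 0 <= weight x.
Proof. by rewrite addr_ge0 ?sqr_ge0. Qed.

Definition grad_norm u x : R := Num.sqrt (qform (Q x) (u.2 x) (u.2 x)).

(** Collects the conditions at [x] that hold almost everywhere, so that the
    pointwise estimates can be proved before integration. *)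
Definition structure_at (c1 C1 : R) (x : Rn) : Prop :=
  (forall xi, c1 * qform (Q x) xi xi <= qform (opP X x) xi xi
                <= C1 * qform (Q x) xi xi) /\
  (forall i xi, dotv (opR X i x) xi ^+ 2 <= qform (Q x) xi xi /\
                dotv (opS X i x) xi ^+ 2 <= qform (Q x) xi xi).

Hypothesis oD : open D.
Hypothesis pQ : forall x, D x -> nonneg_sym (Q x).
Hypothesis mQ : forall i j, measurable_fun D (fun x => Q x i j).
Let mD : measurable D. Proof. exact: open_measurableRn. Qed.

Lemma sqr_grad_norm u x : D x ->
  grad_norm u x ^+ 2 = qform (Q x) (u.2 x) (u.2 x).
Proof. by move=> Dx; rewrite sqr_sqrtr// qform_ge0//; exact: pQ. Qed.

Hypothesis hX : rough_operator Q D X.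

Lemma structure_ae : exists c1 C1, [/\ 0 < c1, 0 < C1 &
  {ae mu, forall x, D x -> structure_at c1 C1 x}].
Proof.
have [_ [c1 [C1 [c10 C10 PQ]]] RS _ _] := hX.
exists c1, C1; split=> //.
have aeRS : {ae mu, forall x, forall i, D x ->
    forall xi, dotv (opR X i x) xi ^+ 2 <= qform (Q x) xi xi /\
               dotv (opS X i x) xi ^+ 2 <= qform (Q x) xi xi}.
  apply: filter_forall => i; have [[_ hR] [_ hS]] := RS i.
  by apply: filterS2 hR hS => x h1 h2 Dx xi; split; [exact: h1|exact: h2].
apply: filterS2 PQ aeRS => x h1 h2 Dx; split; first exact: h1.
by move=> i xi; exact: h2.
Qed.

Lemma norm_dotv_le (W : Rn) u x : D x ->
  (forall xi, dotv W xi ^+ 2 <= qform (Q x) xi xi) ->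
  `|dotv W (u.2 x)| <= grad_norm u x.
Proof.
move=> Dx hW; rewrite -ler_sqr ?nnegrE ?sqrtr_ge0// sqr_grad_norm//.
by rewrite real_normK ?num_real//.
Qed.

Section structured_point.
Variables (c1 C1 : R) (x : Rn).
Hypotheses (Dx : D x) (sx : structure_at c1 C1 x).

Lemma drift_le u : `|drift u x| <= coef x * grad_norm u x.
Proof.
rewrite /drift /tapp -sumrB /coef mulr_suml.
apply: (le_trans (ler_norm_sum _ _ _)); apply: ler_sum => i _.
apply: (le_trans (ler_normB _ _)); rewrite !normrM mulrDl.
by apply: lerD; rewrite ler_wpM2l//; apply: norm_dotv_le => // xi; have [] := sx.2 i xi.
Qed.

Lemma tappHR_le u : `|tapp (opH X) (opR X) u x| <= coef x * grad_norm u x.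
Proof.
rewrite /tapp /coef mulr_suml.
apply: (le_trans (ler_norm_sum _ _ _)); apply: ler_sum => i _.
rewrite normrM mulrDl ler_wpDl ?mulr_ge0 ?sqrtr_ge0// ler_wpM2l//.
by apply: norm_dotv_le => // xi; have [] := sx.2 i xi.
Qed.

Lemma young_drift (y t : R) u : `|t| <= coef x * grad_norm u x ->
  `|y * t| <= (coef x ^+ 2 * y ^+ 2 + qform (Q x) (u.2 x) (u.2 x)) / 2.
Proof.
move=> ht; rewrite normrM; have b0 := coef_ge0 x.
apply: (@le_trans _ _ (`|y| * (coef x * grad_norm u x))).
  by rewrite ler_wpM2l.
rewrite -sqr_grad_norm// -[y ^+ 2]real_normK ?num_real//.
have := sqr_ge0 (coef x * `|y| - grad_norm u x).
by move: (coef x) (`|y|) (grad_norm u x) => a b d; rewrite sqrrB; lra.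
Qed.

Lemma normF_le u v : `|opF X x * u.1 x * v.1 x| <=
  (`|opF X x| * u.1 x ^+ 2 + `|opF X x| * v.1 x ^+ 2) / 2.
Proof.
rewrite !normrM -[u.1 x ^+ 2]real_normK ?num_real// -[v.1 x ^+ 2]real_normK ?num_real//.
have := mulr_ge0 (normr_ge0 (opF X x)) (sqr_ge0 (`|u.1 x| - `|v.1 x|)).
by rewrite sqrrB; move: (`|opF X x|) (`|u.1 x|) (`|v.1 x|) => a b d; lra.
Qed.

Lemma neg_dens_le u v : `|neg_dens u v x| <= dominant u x + dominant v x.
Proof.
rewrite /neg_dens tapp_mulE.
have h1 := normF_le u v.
have h2 := young_drift (u.1 x) (tappHR_le v).
have h3 := young_drift (v.1 x) (tappHR_le u).
apply: (le_trans (ler_normD _ _)).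
apply: (le_trans (lerD h1 (ler_normD _ _))).
apply: (le_trans (lerD (lexx _) (lerD h2 h3))).
have eu := qform_ge0 (u.2 x) (pQ Dx); have ev := qform_ge0 (v.2 x) (pQ Dx).
have u0 := sqr_ge0 (u.1 x); have v0 := sqr_ge0 (v.1 x).
have f1 := mulr_ge0 (normr_ge0 (opF X x)) u0.
have f2 := mulr_ge0 (normr_ge0 (opF X x)) v0.
have f3 := mulr_ge0 (sqr_ge0 (coef x)) u0.
have f4 := mulr_ge0 (sqr_ge0 (coef x)) v0.
rewrite /dominant !energy_densE /weight !mulrDl.
by clear h1 h2 h3; lra.
Qed.

Lemma form_dens_le u v : nonneg_sym (opP X x) -> 0 < C1 ->
  `|form_dens u v x| <= (C1 + 2) * (dominant u x + dominant v x).
Proof.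
move=> pP C10; rewrite form_densE.
have h1 := neg_dens_le u v.
have h2 := young_drift (u.1 x) (drift_le v).
have h3 := qform_amgm (v.2 x) (u.2 x) pP.
have /andP[_ h4] := sx.1 (v.2 x); have /andP[_ h5] := sx.1 (u.2 x).
apply: (le_trans (ler_normD _ _)).
apply: (le_trans (lerD (ler_normD _ _) h2)).
have eu := qform_ge0 (u.2 x) (pQ Dx); have ev := qform_ge0 (v.2 x) (pQ Dx).
have u0 := sqr_ge0 (u.1 x); have v0 := sqr_ge0 (v.1 x).
have w0 := weight_ge0 x.
have f1 := mulr_ge0 w0 u0; have f2 := mulr_ge0 w0 v0.
have f3 : coef x ^+ 2 * u.1 x ^+ 2 <= weight x * u.1 x ^+ 2.
  by rewrite ler_wpM2r// lerDr.
have d1 : qform (Q x) (u.2 x) (u.2 x) <= dominant u x.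
  by rewrite /dominant !energy_densE -addrA [u.1 x ^+ 2 + _]addrC -addrA lerDl addr_ge0.
have d2 : qform (Q x) (v.2 x) (v.2 x) <= dominant v x.
  by rewrite /dominant !energy_densE -addrA [v.1 x ^+ 2 + _]addrC -addrA lerDl addr_ge0.
have d3 : weight x * u.1 x ^+ 2 <= dominant u x.
  by rewrite /dominant !energy_densE lerDr addr_ge0.
have C1u := ler_wpM2l (ltW C10) d1; have C1v := ler_wpM2l (ltW C10) d2.
have s0 : 0 <= dominant u x + dominant v x by apply: le_trans h1.
have t1 : `|qform (opP X x) (v.2 x) (u.2 x)| <= C1 * (dominant u x + dominant v x).
  have := mulr_ge0 (ltW C10) s0; rewrite mulrDr.
  by lra.
have t2 : (coef x ^+ 2 * u.1 x ^+ 2 + qform (Q x) (v.2 x) (v.2 x)) / 2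
    <= dominant u x + dominant v x.
  by lra.
apply: (le_trans (lerD (lerD t1 h1) t2)).
by rewrite mulrDl; lra.
Qed.

End structured_point.
End form.

Section form_on_QH1.
Context {R : realType} {n N : nat}.
Local Notation Rn := 'rV[R]_n.+1.
Local Notation mu := (@lebesgueRn R n).
Variables (D : set Rn) (Q : Rn -> 'M[R]_n.+1) (X : operator R n N).
Local Notation pair := ((Rn -> R) * (Rn -> Rn))%type.
Implicit Types u v : pair.
Local Notation energy := (energy D Q).
Local Notation form_dens := (form_dens X).
Local Notation neg_dens := (neg_dens X).
Local Notation drift := (drift X).
Local Notation coef := (coef X).
Local Notation weight := (weight X).
Local Notation dominant := (dominant Q X).

Hypothesis oD : open D.
Hypothesis pQ : forall x, D x -> nonneg_sym (Q x).
Hypothesis mQ : forall i j, measurable_fun D (fun x => Q x i j).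
Let mD : measurable D. Proof. exact: open_measurableRn. Qed.
Hypothesis hX : rough_operator Q D X.

Variables (omega C4 : R).
Hypothesis omega1 : 1 < omega.
Hypothesis C40 : 0 < C4.
Hypothesis sobolev : forall f, Lip_Q Q D f ->
  (Lnorm_on D (2 * omega)%:E f.1 <= C4%:E * QH1norm Q D f)%E.
Local Notation p := (omega / (omega - 1)).
Hypothesis iw : Intg mu D (fun x => weight x `^ p).

Let p0 : 0 < p.
Proof. by rewrite divr_gt0 ?subr_gt0// (lt_trans _ omega1). Qed.

Let finQH1 u : QH1 Q D u -> finite_energy D Q u.
Proof. exact: (QH1_finite oD pQ mQ). Qed.

Lemma measurable_tapp (g : 'I_N -> Rn -> R) (W : 'I_N -> Rn -> Rn) u :
  (forall i, measurable_fun D (g i)) -> (forall i, measurable_field D (W i)) ->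
  measurable_field D u.2 -> measurable_fun D (tapp g W u).
Proof.
move=> mg mW mu2; apply: measurable_sum => i.
exact: measurable_funM (mg i) (measurable_dotv (mW i) mu2).
Qed.

Let mG i : measurable_fun D (opG X i). Proof. by have [_ _ _ h _] := hX; case: (h i). Qed.
Let mH i : measurable_fun D (opH X i). Proof. by have [_ _ _ h _] := hX; case: (h i). Qed.
Let mF : measurable_fun D (opF X). Proof. by have [_ _ _ _ h] := hX. Qed.
Let mR i : measurable_field D (opR X i).
Proof. by have [_ _ h _ _] := hX; case: (h i) => -[]. Qed.
Let mS i : measurable_field D (opS X i).
Proof. by have [_ _ h _ _] := hX; case: (h i) => _ []. Qed.
Let mP i j : measurable_fun D (fun x => opP X x i j).
Proof. by have [[_ h _] _ _ _ _] := hX. Qed.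
Let pP x : D x -> nonneg_sym (opP X x).
Proof. by have [[h _ _] _ _ _ _] := hX; exact: h. Qed.

Let mHR u : measurable_pair D u -> measurable_fun D (tapp (opH X) (opR X) u).
Proof. by case=> _ mu2; exact: measurable_tapp. Qed.
Let mGS u : measurable_pair D u -> measurable_fun D (tapp (opG X) (opS X) u).
Proof. by case=> _ mu2; exact: measurable_tapp. Qed.

Lemma measurable_coef : measurable_fun D coef.
Proof.
apply: measurable_sum => i.
have m1 : measurable_fun D (fun x => `|opG X i x|) by exact: measurableT_comp.
have m2 : measurable_fun D (fun x => `|opH X i x|) by exact: measurableT_comp.
exact: measurable_funD m1 m2.
Qed.

Lemma measurable_weight : measurable_fun D weight.
Proof.
have m1 : measurable_fun D (fun x => `|opF X x|) by exact: measurableT_comp.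
exact: measurable_funD m1 (measurable_funX 2 measurable_coef).
Qed.

Lemma measurable_neg_dens u v : measurable_pair D u -> measurable_pair D v ->
  measurable_fun D (neg_dens u v).
Proof.
move=> mu_ mv; rewrite (_ : neg_dens u v = fun x => opF X x * u.1 x * v.1 x +
    (u.1 x * tapp (opH X) (opR X) v x + v.1 x * tapp (opH X) (opR X) u x)).
  have m1 := measurable_funM (measurable_funM mF mu_.1) mv.1.
  have m2 := measurable_funM mu_.1 (mHR mv).
  have m3 := measurable_funM mv.1 (mHR mu_).
  exact: measurable_funD m1 (measurable_funD m2 m3).
by apply/funext => x; rewrite neg_densE.
Qed.

Lemma measurable_drift u : measurable_pair D u -> measurable_fun D (drift u).
Proof. by move=> mu_; exact: measurable_funB (mGS mu_) (mHR mu_). Qed.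

Lemma measurable_form_dens u v : measurable_pair D u -> measurable_pair D v ->
  measurable_fun D (form_dens u v).
Proof.
move=> mu_ mv; rewrite (_ : form_dens u v = fun x =>
    qform (opP X x) (v.2 x) (u.2 x) + neg_dens u v x + u.1 x * drift v x).
  have m1 := measurable_qform mP mv.2 mu_.2.
  have m2 := measurable_neg_dens mu_ mv.
  have m3 := measurable_funM mu_.1 (measurable_drift mv).
  exact: measurable_funD (measurable_funD m1 m2) m3.
by apply/funext => x; rewrite form_densE.
Qed.

(** A bound of the [L^p] norm of the weight; the [+ 1] keeps it positive. *)
Definition weight_theta : R := (I mu D (fun x => weight x `^ p) + 1) `^ p^-1.

Lemma weight_theta_gt0 : 0 < weight_theta.
Proof.
by apply: powR_gt0; rewrite ltr_wpDl// I_ge0// => x _; exact: powR_ge0.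
Qed.

Definition dom_const : R := 1 + weight_const omega C4 * weight_theta.

Lemma dom_const_gt0 : 0 < dom_const.
Proof.
rewrite ltr_pwDl// mulr_ge0// ltW//; [exact: weight_const_gt0|].
exact: weight_theta_gt0.
Qed.

Lemma dominant_QH1 u : QH1 Q D u ->
  Intg mu D (dominant u) /\ I mu D (dominant u) <= dom_const * energy u.
Proof.
move=> qu; have [mu_ iu] := finQH1 qu.
have [ii le] := weight_QH1 oD pQ mQ omega1 C40 sobolev measurable_weight
  (fun x _ => weight_ge0 X x) weight_theta_gt0 iw
  ltac:(by rewrite /weight_theta -powRrM mulVf ?gt_eqF// powRr1 ?lerDl//
     addr_ge0// I_ge0// => x _; exact: powR_ge0) qu.
split; first exact: IntgD.
by rewrite (ID mD iu ii) /dom_const mulrDl mul1r lerD2l.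
Qed.

Lemma Intg_form u v : QH1 Q D u -> QH1 Q D v -> Intg mu D (form_dens u v).
Proof.
move=> qu qv; have [mu_ _] := finQH1 qu; have [mv _] := finQH1 qv.
have [c1 [C1 [c10 C10 st]]] := structure_ae hX.
have [iu _] := dominant_QH1 qu; have [iv _] := dominant_QH1 qv.
apply: (Intg_le_ae mD (measurable_form_dens mu_ mv)
  (IntgZ mD (C1 + 2) (IntgD mD iu iv))).
apply: filterS st => x + Dx => /(_ Dx) sx.
exact: (form_dens_le pQ Dx sx u v (pP Dx) C10).
Qed.

Lemma Intg_neg u v : QH1 Q D u -> QH1 Q D v -> Intg mu D (neg_dens u v).
Proof.
move=> qu qv; have [mu_ _] := finQH1 qu; have [mv _] := finQH1 qv.
have [c1 [C1 [c10 C10 st]]] := structure_ae hX.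
have [iu _] := dominant_QH1 qu; have [iv _] := dominant_QH1 qv.
apply: (Intg_le_ae mD (measurable_neg_dens mu_ mv) (IntgD mD iu iv)).
apply: filterS st => x + Dx => /(_ Dx) sx.
exact: (neg_dens_le pQ Dx sx u v).
Qed.

Lemma form_bound : exists2 K : R, 0 <= K & forall u v, QH1 Q D u -> QH1 Q D v ->
  `|I mu D (form_dens u v)| <= K * (energy u + energy v).
Proof.
have [c1 [C1 [c10 C10 st]]] := structure_ae hX.
have C1p : 0 <= C1 + 2 by rewrite addr_ge0// ltW.
exists ((C1 + 2) * dom_const); first by rewrite mulr_ge0// ltW// dom_const_gt0.
move=> u v qu qv; have iuv := Intg_form qu qv.
have [iu lu] := dominant_QH1 qu; have [iv lv] := dominant_QH1 qv.
apply: (le_trans (norm_I_le mD iuv)).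
apply: (@le_trans _ _ ((C1 + 2) * (I mu D (dominant u) + I mu D (dominant v)))).
  rewrite -(ID mD iu iv) -(IZ mD _ (IntgD mD iu iv)).
  apply: le_I_ae => //.
  - exact: integrable_norm.
  - exact: IntgZ (IntgD mD iu iv).
  apply: filterS st => x + Dx => /(_ Dx) sx.
  exact: (form_dens_le pQ Dx sx u v (pP Dx) C10).
by rewrite -mulrA ler_wpM2l// mulrDr lerD.
Qed.

Lemma I_form_linl c u v w : QH1 Q D u -> QH1 Q D v -> QH1 Q D w ->
  I mu D (form_dens (c *: u + v) w) =
  c * I mu D (form_dens u w) + I mu D (form_dens v w).
Proof.
move=> qu qv qw; have i1 := Intg_form qu qw; have i2 := Intg_form qv qw.
rewrite -(IZ mD _ i1) -(ID mD (IntgZ mD c i1) i2).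
by apply: eq_I => x _; exact: form_dens_linl.
Qed.

Lemma I_form_linr c u v w : QH1 Q D u -> QH1 Q D v -> QH1 Q D w ->
  I mu D (form_dens w (c *: u + v)) =
  c * I mu D (form_dens w u) + I mu D (form_dens w v).
Proof.
move=> qu qv qw; have i1 := Intg_form qw qu; have i2 := Intg_form qw qv.
rewrite -(IZ mD _ i1) -(ID mD (IntgZ mD c i1) i2).
by apply: eq_I => x _; exact: form_dens_linr.
Qed.

End form_on_QH1.

(** * The arctangent as a test nonlinearity *)

Section arctangent.
Context {R : realType}.

Definition datan (x : R) : R := (1 + x ^+ 2)^-1.

Lemma datan_gt0 (x : R) : 0 < 1 + x ^+ 2.
Proof. by rewrite ltr_pwDl// sqr_ge0. Qed.

Lemma datan01 x : 0 <= datan x <= 1.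
Proof.
rewrite invr_ge0 ltW ?datan_gt0//= invf_le1 ?datan_gt0//.
by rewrite lerDl sqr_ge0.
Qed.

Lemma atan_lip (y z : R) : `|atan y - atan z| <= `|y - z|.
Proof.
wlog yz : y z / y <= z.
  by move=> H; have [|/ltW] := leP y z; [exact: H | rewrite distrC (distrC y); exact: H].
have [x _ e] := @MVT_segment R atan datan y z yz (fun x _ => is_derive1_atan x)
   ltac:(by apply: continuous_subspaceT => x; exact: continuous_atan).
rewrite distrC e (distrC y) normrM ler_piMl//.
by have /andP[d0 d1] := datan01 x; rewrite ger0_norm.
Qed.

Lemma datan_lip (y z : R) : `|datan y - datan z| <= `|y - z|.
Proof.
have y0 := datan_gt0 y; have z0 := datan_gt0 z.
have -> : datan y - datan z = (z - y) * ((z + y) / ((1 + y ^+ 2) * (1 + z ^+ 2))).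
  by rewrite /datan; field; rewrite !gt_eqF.
have w0 : 0 < (1 + y ^+ 2) * (1 + z ^+ 2) by exact: mulr_gt0.
rewrite normrM (distrC y) ler_piMr// normrM normfV (gtr0_norm w0).
rewrite ler_pdivrMr// mul1r ler_norml.
have h1 := sqr_ge0 (y + 1); have h2 := sqr_ge0 (z + 1).
have h3 := sqr_ge0 (y - 1); have h4 := sqr_ge0 (z - 1).
have h5 : 0 <= y ^+ 2 * z ^+ 2 by rewrite mulr_ge0 ?sqr_ge0.
have h6 := sqr_ge0 y; have h7 := sqr_ge0 z.
by apply/andP; split; lra.
Qed.

Lemma measurable_atan : measurable_fun [set: R] (@atan R).
Proof. by apply: continuous_measurable_fun => x; exact: continuous_atan. Qed.

Lemma measurable_datan : measurable_fun [set: R] datan.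
Proof.
apply: measurable_funV => [|x _]; last by rewrite gt_eqF ?datan_gt0.
by apply: measurable_funD => //; exact: measurable_funX.
Qed.

Lemma mulr_atan_norm (x : R) : x * atan x = `|x| * atan `|x|.
Proof. by have [x0|x0] := ger0P x => //; rewrite atanN mulrNN. Qed.

Lemma mulr_atan_ge0 (x : R) : 0 <= x * atan x.
Proof.
rewrite mulr_atan_norm mulr_ge0//.
by rewrite -(@atan0 R) le_atan.
Qed.

Lemma sqr_atan_le (x : R) : atan x ^+ 2 <= x * atan x.
Proof.
rewrite -[x * _]ger0_norm ?mulr_atan_ge0// -[leLHS]ger0_norm ?sqr_ge0//.
rewrite expr2 !normrM ler_wpM2r//.
by have := atan_lip x 0; rewrite atan0 !subr0.
Qed.

Lemma atan1_gt0 : 0 < atan 1 :> R.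
Proof. by rewrite atan1 divr_gt0// pi_gt0. Qed.

Lemma mulr_atan_ge (K x : R) : 1 <= K -> K <= `|x| -> K * atan 1 <= x * atan x.
Proof.
move=> K1 Kx; rewrite mulr_atan_norm; apply: ler_pM => //.
- by rewrite (le_trans _ K1).
- exact: ltW atan1_gt0.
- exact: (le_atan (le_trans K1 Kx)).
Qed.

End arctangent.

(** * The a priori estimate *)

Lemma sqrt_le_linear (R : realType) (T k : R) : 0 < k -> 0 <= T ->
  Num.sqrt T <= k * T + k^-1 / 4.
Proof.
move=> k0 T0; have := sqr_ge0 (k * Num.sqrt T - 2^-1).
rewrite sqrrB exprMn sqr_sqrtr// => h.
rewrite -(ler_pM2l k0) mulrDr mulrA -expr2 mulrA divff ?gt_eqF//.
by move: h; move: (Num.sqrt T) => r h; lra.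
Qed.

Section a_priori.
Context {R : realType} {n N : nat}.
Local Notation Rn := 'rV[R]_n.+1.
Local Notation mu := (@lebesgueRn R n).
Variables (D : set Rn) (Q : Rn -> 'M[R]_n.+1) (X : operator R n N).
Local Notation pair := ((Rn -> R) * (Rn -> Rn))%type.
Implicit Types u v : pair.
Local Notation ip_dens := (ip_dens Q).
Local Notation form_dens := (form_dens X).
Local Notation neg_dens := (neg_dens X).
Local Notation drift := (drift X).
Local Notation coef := (coef X).
Local Notation weight := (weight X).

Hypothesis oD : open D.
Hypothesis pQ : forall x, D x -> nonneg_sym (Q x).
Hypothesis mQ : forall i j, measurable_fun D (fun x => Q x i j).
Let mD : measurable D. Proof. exact: open_measurableRn. Qed.
Hypothesis hX : rough_operator Q D X.

Variables (omega C4 : R).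
Hypothesis omega1 : 1 < omega.
Hypothesis C40 : 0 < C4.
Hypothesis sobolev : forall f, Lip_Q Q D f ->
  (Lnorm_on D (2 * omega)%:E f.1 <= C4%:E * QH1norm Q D f)%E.
Local Notation p := (omega / (omega - 1)).
Hypothesis iw : Intg mu D (fun x => weight x `^ p).

Variable eps : R.
Hypothesis eps0 : 0 < eps.
Hypothesis neg : forall u v, QH1 Q D u -> QH1 Q D v ->
  {ae mu, forall x, D x -> 0 <= u.1 x * v.1 x} ->
  eps * I mu D (fun x => u.1 x * v.1 x) <= I mu D (neg_dens u v).

Let finQH1 u : QH1 Q D u -> finite_energy D Q u.
Proof. exact: (QH1_finite oD pQ mQ). Qed.

Local Notation grad_dens u x := (qform (Q x) (u.2 x) (u.2 x)).

(** Joins the inner product, at [s = 0], to the form of the operator, at [s =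
    1]. *)
Definition path_form (s : R) u v : R :=
  (1 - s) * I mu D (ip_dens u v) + s * I mu D (form_dens u v).

Lemma Intg_mul u v : QH1 Q D u -> QH1 Q D v ->
  Intg mu D (fun x => u.1 x * v.1 x).
Proof.
move=> qu qv; have [[mu1 _] iu] := finQH1 qu; have [[mv1 _] iv] := finQH1 qv.
apply: (Intg_le mD (measurable_funM mu1 mv1) (IntgD mD iu iv)) => x Dx.
have eu := qform_ge0 (u.2 x) (pQ Dx); have ev := qform_ge0 (v.2 x) (pQ Dx).
have := sqr_ge0 (`|u.1 x| - `|v.1 x|).
rewrite normrM sqrrB !real_normK ?num_real// !energy_densE.
have := sqr_ge0 (u.1 x); have := sqr_ge0 (v.1 x); lra.
Qed.

(** The test functions below, [atan u] and [u], have the gradient [ph grad u]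
    with [0 <= ph <= 1] and the sign of [u].  The drift term is then at most
    [ph |u| coef |sqrt Q grad u|]; half of the principal part absorbs it up to
    [ph * weight * u^2], and the rest of the form is bounded below by the
    negativity condition. *)
Lemma energy_lower : exists2 c : R, 0 < c <= 1 &
  forall u v (ph : Rn -> R) s, QH1 Q D u -> QH1 Q D v ->
    measurable_fun D ph -> (forall x, D x -> 0 <= ph x <= 1) ->
    (forall x, D x -> v.2 x = ph x *: u.2 x) ->
    (forall x, D x -> 0 <= u.1 x * v.1 x) -> 0 <= s <= 1 ->
  [/\ Intg mu D (fun x => ph x * grad_dens u x),
      Intg mu D (fun x => ph x * (weight x * u.1 x ^+ 2)) &
      c / 2 * I mu D (fun x => ph x * grad_dens u x)
      + Num.min 1 eps * I mu D (fun x => u.1 x * v.1 x)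
      <= path_form s u v
         + (2 * c)^-1 * I mu D (fun x => ph x * (weight x * u.1 x ^+ 2))].
Proof.
have [c1 [C1 [c10 C10 st]]] := structure_ae hX.
pose c := Num.min 1 c1.
have c0 : 0 < c by rewrite lt_min ltr01 c10.
have c_le1 : c <= 1 by rewrite ge_min lexx.
have c_lec1 : c <= c1 by rewrite ge_min lexx orbT.
exists c; first by rewrite c0.
move=> u v ph s qu qv mph ph01 vE uv0 /andP[s0 s1].
have [mu_ iu] := finQH1 qu; have [mv _] := finQH1 qv.
have [idom _] := dominant_QH1 oD pQ mQ hX omega1 C40 sobolev iw qu.
have mw := measurable_weight hX.
have iA : Intg mu D (fun x => ph x * grad_dens u x).
  apply: (Intg_le mD (measurable_funM mph (measurable_qform mQ mu_.2 mu_.2)) iu).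
  move=> x Dx; have /andP[h0 h1] := ph01 x Dx.
  have eu := qform_ge0 (u.2 x) (pQ Dx).
  rewrite ger0_norm ?mulr_ge0//; apply: (@le_trans _ _ (grad_dens u x)).
    by rewrite ler_piMl.
  by rewrite lerDr sqr_ge0.
have iW : Intg mu D (fun x => ph x * (weight x * u.1 x ^+ 2)).
  apply: (Intg_le mD (measurable_funM mph
    (measurable_funM mw (measurable_funX 2 mu_.1))) idom).
  move=> x Dx; have /andP[h0 h1] := ph01 x Dx.
  have w0 := weight_ge0 X x.
  have wu0 : 0 <= weight x * u.1 x ^+ 2 by rewrite mulr_ge0 ?sqr_ge0.
  rewrite ger0_norm; last exact: mulr_ge0.
  apply: (@le_trans _ _ (weight x * u.1 x ^+ 2)); first by rewrite ler_piMl.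
  by rewrite lerDr (energy_dens_ge0 pQ).
have iB := Intg_mul qu qv.
have iN := Intg_neg oD pQ mQ hX omega1 C40 sobolev iw qu qv.
have iF := Intg_form oD pQ mQ hX omega1 C40 sobolev iw qu qv.
split=> //.
set A := I mu D _; set B := I mu D _; set W := I mu D _.
have A0 : 0 <= A.
  apply: I_ge0 => x Dx; have /andP[h0 _] := ph01 x Dx.
  by rewrite mulr_ge0// qform_ge0//; exact: pQ.
have B0 : 0 <= B by apply: I_ge0.
have W0 : 0 <= W.
  apply: I_ge0 => x Dx; have /andP[h0 _] := ph01 x Dx.
  by apply: mulr_ge0 => //; apply: mulr_ge0; [exact: weight_ge0 | exact: sqr_ge0].
have ipE : I mu D (ip_dens u v) = B + A.
  rewrite -(ID mD iB iA); apply: eq_I => x Dx.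
  by rewrite !ip_densE vE// qformZr.
have NB : eps * B <= I mu D (neg_dens u v).
  by apply: neg => //; exact: aeW.
have k0 : 0 <= (2 * c)^-1 by rewrite invr_ge0 mulr_ge0// ltW.
have FB : c / 2 * A + eps * B <= I mu D (form_dens u v) + (2 * c)^-1 * W.
  apply: (@le_trans _ _ (c / 2 * A + I mu D (neg_dens u v))); first by rewrite lerD2l.
  rewrite -lerBlDr /A /W -(IZ mD _ iA) -(IZ mD _ iW).
  have j1 := IntgZ mD (c / 2) iA; have j2 := IntgZ mD (2 * c)^-1 iW.
  rewrite -(ID mD j1 iN) -(IB mD (IntgD mD j1 iN) j2).
  apply: le_I_ae => //; first exact: IntgB (IntgD mD j1 iN) j2.
  apply: filterS st => x + Dx => /(_ Dx) sx.
  have /andP[h0 h1] := ph01 x Dx.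
  rewrite form_densE vE// qformZl.
  have -> : drift v x = ph x * drift u x.
    rewrite !driftE /tapp mulrBr !mulr_sumr; congr (_ - _);
      by apply: eq_bigr => i _; rewrite /vapp vE// dotvZr; ring.
  have eu := qform_ge0 (u.2 x) (pQ Dx).
  have /andP[l1 _] := sx.1 (u.2 x).
  have l2 : c * grad_dens u x <= qform (opP X x) (u.2 x) (u.2 x).
    by apply: le_trans l1; rewrite ler_wpM2r.
  have l3 : - (c / 2 * grad_dens u x + (2 * c)^-1 * (weight x * u.1 x ^+ 2))
      <= u.1 x * drift u x.
    have w1 : coef x ^+ 2 <= weight x by rewrite lerDr.
    have := drift_le pQ Dx sx u.
    have -> : grad_dens u x = grad_norm Q u x ^+ 2 by rewrite (sqr_grad_norm pQ).
    move=> hd.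
    have h : `|u.1 x * drift u x| <= `|u.1 x| * (coef x * grad_norm Q u x).
      by rewrite normrM ler_wpM2l.
    have sq := sqr_ge0 (c * grad_norm Q u x - coef x * `|u.1 x|).
    have h' : `|u.1 x| * (coef x * grad_norm Q u x) <=
        c / 2 * grad_norm Q u x ^+ 2 + (2 * c)^-1 * (coef x ^+ 2 * u.1 x ^+ 2).
      rewrite -(ler_pM2l (mulr_gt0 (ltr0n _ 2) c0)) mulrDr.
      rewrite [X in _ <= _ + X]mulrA divff ?gt_eqF ?mulr_gt0// mul1r.
      move: sq; rewrite -[u.1 x ^+ 2]real_normK ?num_real//.
      move: (grad_norm Q u x) (coef x) (`|u.1 x|) => a b d.
      by rewrite sqrrB !exprMn => sq; lra.
    have h'' : (2 * c)^-1 * (coef x ^+ 2 * u.1 x ^+ 2) <=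
        (2 * c)^-1 * (weight x * u.1 x ^+ 2).
      by rewrite ler_wpM2l// ler_wpM2r// sqr_ge0.
    have := le_trans h h'; rewrite ler_norml => /andP[h3 _].
    by apply: le_trans h3; rewrite lerN2 lerD2l.
  have l4 := ler_wpM2l h0 l2; have l5 := ler_wpM2l h0 l3.
  by lra.
have m1 : Num.min 1 eps <= 1 by rewrite ge_min lexx.
have me : Num.min 1 eps <= eps by rewrite ge_min lexx orbT.
have q1 : Num.min 1 eps * B <= B by rewrite ler_piMl.
have q2 : Num.min 1 eps * B <= eps * B by rewrite ler_wpM2r.
have q3 : c / 2 * A <= A by rewrite ler_piMl//; lra.
rewrite /path_form ipE.
have e1 : c / 2 * A + Num.min 1 eps * B <= I mu D (form_dens u v) + (2 * c)^-1 * W.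
  by apply: le_trans FB; rewrite lerD2l.
have e2 : c / 2 * A + Num.min 1 eps * B <= B + A by rewrite addrC lerD.
have s1' : 0 <= 1 - s by rewrite subr_ge0.
have := ler_wpM2l s0 e1; have := ler_wpM2l s1' e2.
have : s * ((2 * c)^-1 * W) <= (2 * c)^-1 * W by rewrite ler_piMl// mulr_ge0.
move: (c / 2 * A + _) (B + A) (I mu D _) (_^-1 * W) => a b d e.
by lra.
Qed.

End a_priori.

Section a_priori_bound.
Context {R : realType} {n N : nat}.
Local Notation Rn := 'rV[R]_n.+1.
Local Notation mu := (@lebesgueRn R n).
Variables (D : set Rn) (Q : Rn -> 'M[R]_n.+1) (X : operator R n N).
Local Notation pair := ((Rn -> R) * (Rn -> Rn))%type.
Implicit Types u v : pair.
Local Notation energy := (energy D Q).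
Local Notation neg_dens := (neg_dens X).
Local Notation weight := (weight X).

Hypothesis oD : open D.
Hypothesis pQ : forall x, D x -> nonneg_sym (Q x).
Hypothesis mQ : forall i j, measurable_fun D (fun x => Q x i j).
Let mD : measurable D. Proof. exact: open_measurableRn. Qed.
Hypothesis Doo : (mu D < +oo)%E.
Hypothesis hX : rough_operator Q D X.

Variables (omega C4 : R).
Hypothesis omega1 : 1 < omega.
Hypothesis C40 : 0 < C4.
Hypothesis sobolev : forall f, Lip_Q Q D f ->
  (Lnorm_on D (2 * omega)%:E f.1 <= C4%:E * QH1norm Q D f)%E.
Local Notation p := (omega / (omega - 1)).
Hypothesis iw : Intg mu D (fun x => weight x `^ p).

Variable eps : R.
Hypothesis eps0 : 0 < eps.
Hypothesis neg : forall u v, QH1 Q D u -> QH1 Q D v ->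
  {ae mu, forall x, D x -> 0 <= u.1 x * v.1 x} ->
  eps * I mu D (fun x => u.1 x * v.1 x) <= I mu D (neg_dens u v).

Let p0 : 0 < p.
Proof. by rewrite divr_gt0 ?subr_gt0// (lt_trans _ omega1). Qed.

Let finQH1 u : QH1 Q D u -> finite_energy D Q u.
Proof. exact: (QH1_finite oD pQ mQ). Qed.

Local Notation grad_dens u x := (qform (Q x) (u.2 x) (u.2 x)).

Let chain_QH1 u : QH1 Q D u -> QH1 Q D (chain (@atan R) datan u).
Proof.
exact: (QH1_chain oD pQ mQ (@is_derive1_atan R) (@atan0 R) (@atan_lip R)
  (@measurable_atan R) (@measurable_datan R) (@datan01 R) (@datan_lip R)).
Qed.

Definition tested_by_path s u : Prop := forall v, QH1 Q D v ->
  `|path_form D Q X s u v| <= Num.sqrt (energy v).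

(** Test with [v = atan u], so that [ph = 1 / (1 + u^2)]: the error
    [ph * weight * u^2 <= weight] is integrable uniformly in [u].  What the test
    controls bounds the energy of [v], so that the inequality closes, and
    [u atan u >= K atan 1] where [|u| > K]. *)
Lemma superlevel_bound : exists2 T0 : R, 0 <= T0 &
  forall s u, 0 <= s <= 1 -> QH1 Q D u -> tested_by_path s u ->
  forall K : nat, (0 < K)%N ->
    I mu D (fun x => (K%:R < `|u.1 x|)%R%:R) <= T0 / K%:R.
Proof.
have [c /andP[c0 c1] lower] := energy_lower oD pQ mQ hX omega1 C40 sobolev iw neg.
have mw := measurable_weight hX; have w0 := weight_ge0 X.
have iwt : Intg mu D weight.
  apply: (Intg_le mD mw (IntgD mD (Intg_cst mD 1 Doo) iw)) => x Dx.
  rewrite ger0_norm// -[leLHS]powRr1// powR_le_powR//.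
  by rewrite ler_pdivlMr ?subr_gt0// mul1r gerBl.
pose k := Num.min (c / 2) (Num.min 1 eps).
have k0 : 0 < k by rewrite !lt_min divr_gt0//= ltr01 eps0.
pose B0 := (2 * c)^-1 * I mu D weight.
have B00 : 0 <= B0.
  rewrite mulr_ge0 ?I_ge0// invr_ge0 mulr_ge0// ltW//.
have k2 : 0 < k / 2 by rewrite divr_gt0.
pose T1 := (B0 + (k / 2)^-1 / 4) / (k / 2).
have T10 : 0 <= T1.
  by rewrite divr_ge0 ?(ltW k2)// addr_ge0// divr_ge0// invr_ge0 ltW.
have a1 := @atan1_gt0 R.
exists (T1 / atan 1); first by rewrite divr_ge0// ltW.
move=> s u s01 qu tu K K0.
have [[mu1 mu2] iu] := finQH1 qu.
have qv := chain_QH1 qu; set v := chain _ _ u in qv.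
have mph : measurable_fun D (fun x => datan (u.1 x)).
  exact: measurableT_comp (@measurable_datan R) mu1.
have [||||iA iW low] := lower u v (fun x => datan (u.1 x)) s qu qv mph.
- by move=> x _; exact: datan01.
- by [].
- by move=> x _; exact: mulr_atan_ge0.
- exact: s01.
have iB := Intg_mul oD pQ mQ qu qv.
set A := I mu D _ in low; set B := I mu D _ in low; set W := I mu D _ in low.
have WB : (2 * c)^-1 * W <= B0.
  rewrite ler_wpM2l ?invr_ge0 ?mulr_ge0 ?(ltW c0)//.
  apply: le_I => // x Dx; rewrite mulrCA ler_piMr//.
  by rewrite /datan mulrC ler_pdivrMr ?datan_gt0// mul1r lerDr.
have A0 : 0 <= A.
  apply: I_ge0 => x Dx; have /andP[h0 _] := datan01 (u.1 x).
  by rewrite mulr_ge0// qform_ge0//; exact: pQ.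
have B0' : 0 <= B by apply: I_ge0 => x Dx; exact: mulr_atan_ge0.
have Ev : energy v <= A + B.
  rewrite -(ID mD iA iB); apply: (le_I mD).
  - by have [] := finQH1 qv.
  - exact: (IntgD mD iA iB).
  move=> x Dx; rewrite !energy_densE addrC; apply: lerD; last exact: sqr_atan_le.
  rewrite /= qformZl qformZr; have eu := qform_ge0 (u.2 x) (pQ Dx).
  have /andP[h0 h1] := datan01 (u.1 x).
  by rewrite ler_wpM2l// ler_piMl.
have kT : k * (A + B) <= B0 + Num.sqrt (A + B).
  have := tu v qv; rewrite ler_norml => /andP[_ pv].
  have kA : k * A <= c / 2 * A by rewrite ler_wpM2r// ge_min lexx.
  have kB : k * B <= Num.min 1 eps * B by rewrite ler_wpM2r// ge_min lexx orbT.
  have sv : Num.sqrt (energy v) <= Num.sqrt (A + B).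
    by rewrite ler_sqrt// addr_ge0.
  by rewrite mulrDr; lra.
have AB0 : 0 <= A + B by exact: addr_ge0.
have AB : A + B <= T1.
  have := sqrt_le_linear k2 AB0.
  rewrite /T1 ler_pdivlMr//; move: kT.
  by move: (A + B) ((k / 2)^-1) (Num.sqrt _) => z y r; lra.
have iK : Intg mu D (fun x => (K%:R < `|u.1 x|)%R%:R).
  have mn : measurable_fun D (fun x => `|u.1 x|) by exact: measurableT_comp.
  apply: (Intg_le mD (measurable_superlevel K%:R mn) (Intg_cst mD 1 Doo)).
  by move=> x Dx; rewrite ger0_norm// lern1 leq_b1.
have Kp : 0 < K%:R :> R by rewrite ltr0n.
have Ka : 0 < K%:R * atan 1 :> R by exact: mulr_gt0.
have -> : T1 / atan 1 / K%:R = T1 / (K%:R * atan 1) by field; rewrite !gt_eqF.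
rewrite ler_pdivlMr// [leLHS]mulrC -(IZ mD _ iK); apply: (le_trans _ AB).
apply: (@le_trans _ _ B); last by rewrite lerDr.
apply: le_I => //; first exact: IntgZ.
move=> x Dx; case: (ltP K%:R `|u.1 x|) => uK /=; last first.
  by rewrite mulr0; exact: mulr_atan_ge0.
rewrite mulr1; apply: mulr_atan_ge; last exact: ltW.
by rewrite ler1n.
Qed.

(** Testing with [u] itself: the lower-order term is split according to whether
    the weight, or else [|u|], is large; both contributions are small multiples
    of the energy. *)
Lemma a_priori_bound : exists2 C : R, 0 <= C &
  forall s u, 0 <= s <= 1 -> QH1 Q D u -> tested_by_path s u ->
    Num.sqrt (energy u) <= C.
Proof.
have [c /andP[c0 c1] lower] := energy_lower oD pQ mQ hX omega1 C40 sobolev iw neg.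
have [T0 T00 level] := superlevel_bound.
have mw := measurable_weight hX; have w0 := weight_ge0 X.
have Cw0 := @weight_const_gt0 R omega C4; set Cw := weight_const omega C4 in Cw0.
pose k := Num.min (c / 2) (Num.min 1 eps).
have k0 : 0 < k by rewrite !lt_min divr_gt0//= ltr01 eps0.
have p_ge0 := ltW p0.
(* Each of the two large parts of [int weight u^2] may take the share [d] of the
   energy: multiplied by [1 / (2 c)] they add up to [k / 4] of it. *)
pose d := k * c / 4.
have d0 : 0 < d by rewrite !(mulr_gt0, divr_gt0).
pose th1 := d / Cw.
have th10 : 0 < th1 by rewrite divr_gt0.
have [M HM] := I_superlevel_small mD mw iw (fun x _ => powR_ge0 _ _)
  (powR_gt0 p th10).
(* Where [weight <= M] the set [|u| > K] enters with the weight [M], whence the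
   further division. *)
pose th2 := d / Cw / (M%:R + 1).
have M0 : 0 <= M%:R :> R by exact: ler0n.
have M1 : 0 < M%:R + 1 :> R by rewrite ltr_wpDl.
have th20 : 0 < th2 by rewrite divr_gt0.
have t2p := powR_gt0 p th20.
pose K := (Num.truncn (T0 / th2 `^ p)).+1.
have K0 : (0 < K)%N by [].
have Kp : 0 < K%:R :> R by rewrite ltr0n.
have KT : T0 / K%:R <= th2 `^ p.
  rewrite ler_pdivrMr// mulrC -ler_pdivrMr//; apply: ltW.
  exact: truncnS_gt.
pose C1 := (2 * c)^-1 * (M%:R * K%:R ^+ 2 * fine (mu D)).
have C10 : 0 <= C1.
  by rewrite !mulr_ge0 ?invr_ge0 ?mulr_ge0 ?sqr_ge0 ?fine_ge0 ?(ltW c0).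
pose C2 := (C1 + (k / 4)^-1 / 4) / (k / 2).
exists (Num.sqrt C2); first exact: sqrtr_ge0.
move=> s u s01 qu tu; have [[mu1 mu2] iu] := finQH1 qu.
have [||||iA iW low] := lower u u (cst 1) s qu qu (measurable_cst _).
- by move=> x _; rewrite ler01 lexx.
- by move=> x _; rewrite scale1r.
- by move=> x _; rewrite -expr2 sqr_ge0.
- exact: s01.
have iB := Intg_mul oD pQ mQ qu qu.
pose g1 x := (M%:R < weight x)%R%:R * weight x.
pose g2 x : R := (K%:R < `|u.1 x|)%R%:R.
have mn : measurable_fun D (fun x => `|u.1 x|) by exact: measurableT_comp.
have mg1 : measurable_fun D g1.
  exact: measurable_funM (measurable_superlevel M%:R mw) mw.
have mg2 : measurable_fun D g2 by exact: measurable_superlevel.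
have g10 x : D x -> 0 <= g1 x by move=> _; rewrite mulr_ge0.
have g20 x : D x -> 0 <= g2 x by [].
have g1p x : g1 x `^ p = (M%:R < weight x)%R%:R * weight x `^ p.
  rewrite /g1; case: ltP => _ /=; rewrite ?mul1r// !mul0r powR0//.
  by rewrite gt_eqF.
have g2p x : g2 x `^ p = g2 x.
  by rewrite /g2; case: ltP => _ /=; rewrite ?powR1// powR0// gt_eqF.
have ig1 : Intg mu D (fun x => g1 x `^ p).
  apply: (eq_Intg mD (f := fun x => (M%:R < weight x)%R%:R * weight x `^ p)).
    by move=> x _; rewrite g1p.
  by apply: Intg_superlevel => // x _; exact: powR_ge0.
have Ig1 : I mu D (fun x => g1 x `^ p) <= th1 `^ p.
  by apply: le_trans HM; rewrite le_eqVlt; apply/orP/or_introl/eqP/eq_I.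
have ig2' : Intg mu D g2.
  apply: (Intg_le mD mg2 (Intg_cst mD 1 Doo)).
  by move=> x Dx; rewrite ger0_norm// lern1 leq_b1.
have ig2 : Intg mu D (fun x => g2 x `^ p).
  by apply: (eq_Intg mD (f := g2)) => // x _; rewrite g2p.
have Ig2 : I mu D (fun x => g2 x `^ p) <= th2 `^ p.
  rewrite (@eq_I _ _ _ _ _ _ g2); last by move=> x _; rewrite g2p.
  exact: le_trans (level s u s01 qu tu K K0) KT.
have [i1 W1] := weight_QH1 oD pQ mQ omega1 C40 sobolev mg1 g10 th10 ig1 Ig1 qu.
have [i2 W2] := weight_QH1 oD pQ mQ omega1 C40 sobolev mg2 g20 th20 ig2 Ig2 qu.
have E0 : 0 <= energy u by exact: energy_ge0.
have split_weight : I mu D (fun x => 1 * (weight x * u.1 x ^+ 2)) <=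
    2 * d * energy u + M%:R * K%:R ^+ 2 * fine (mu D).
  have j2 := IntgZ mD M%:R i2; have j3 := Intg_cst mD (M%:R * K%:R ^+ 2) Doo.
  apply: (@le_trans _ _ (I mu D (fun x => g1 x * u.1 x ^+ 2 +
      (M%:R * (g2 x * u.1 x ^+ 2) + M%:R * K%:R ^+ 2)))).
    apply: le_I => //; first exact: IntgD i1 (IntgD mD j2 j3).
    move=> x Dx; rewrite mul1r /g1 /g2; have u0 := sqr_ge0 (u.1 x).
    case: (ltP M%:R (weight x)) => hM /=.
      rewrite mul1r lerDl; apply: addr_ge0; last by rewrite mulr_ge0// sqr_ge0.
      by apply: mulr_ge0 => //; exact: mulr_ge0.
    rewrite !mul0r add0r -mulrDr; apply: ler_pM => //.
    case: (ltP K%:R `|u.1 x|) => hK /=; first by rewrite mul1r lerDl sqr_ge0.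
    rewrite mul0r add0r -[u.1 x ^+ 2]real_normK ?num_real//.
    by rewrite ler_sqr ?nnegrE// ltW.
  rewrite (ID mD i1 (IntgD mD j2 j3)) (ID mD j2 j3) (IZ mD _ i2) I_cst//.
  rewrite addrA lerD2r.
  have a1 : Cw * th1 * energy u = d * energy u.
    by rewrite /th1 mulrCA divff ?gt_eqF// mulr1.
  have a2 : M%:R * (Cw * th2 * energy u) <= d * energy u.
    rewrite mulrA ler_wpM2r// /th2.
    have -> : M%:R * (Cw * (d / Cw / (M%:R + 1))) = d * (M%:R / (M%:R + 1)).
      by field; rewrite !gt_eqF.
    by rewrite ler_piMr ?(ltW d0)// ler_pdivrMr// mul1r lerDl.
  rewrite -mulrA [2 * _]mulr_natl mulr2n; apply: lerD; first by rewrite -a1.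
  by apply: le_trans a2; rewrite ler_wpM2l.
have k4 : 0 < k / 4 by rewrite divr_gt0.
have := tu u qu; rewrite ler_norml => /andP[_ pu].
have sq := sqrt_le_linear k4 E0.
have kE : k * energy u <= c / 2 * I mu D (fun x => 1 * grad_dens u x) +
    Num.min 1 eps * I mu D (fun x => u.1 x * u.1 x).
  apply: (@le_trans _ _ (k * I mu D (fun x => 1 * grad_dens u x) +
      k * I mu D (fun x => u.1 x * u.1 x))).
    rewrite -mulrDr -(ID mD iA iB) ler_wpM2l ?(ltW k0)// le_eqVlt.
    apply/orP/or_introl/eqP/eq_I => x Dx.
    by rewrite !energy_densE mul1r addrC expr2.
  apply: lerD; apply: ler_wpM2r.
  - by apply: I_ge0 => x Dx; rewrite mul1r qform_ge0//; exact: pQ.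
  - by rewrite ge_min lexx.
  - by apply: I_ge0 => x Dx; rewrite -expr2 sqr_ge0.
  - by rewrite ge_min lexx orbT.
have cW : (2 * c)^-1 * I mu D (fun x => 1 * (weight x * u.1 x ^+ 2)) <=
    k / 4 * energy u + C1.
  have -> : k / 4 * energy u + C1 =
      (2 * c)^-1 * (2 * d * energy u + M%:R * K%:R ^+ 2 * fine (mu D)).
    by rewrite mulrDr; congr (_ + _); rewrite /d; field; rewrite gt_eqF.
  by rewrite ler_wpM2l// invr_ge0 mulr_ge0// ltW.
rewrite ler_sqrt; last first.
  apply: divr_ge0; last by rewrite divr_ge0// ltW.
  by rewrite addr_ge0// divr_ge0// invr_ge0 ltW.
rewrite ler_pdivlMr ?divr_gt0//; move: kE low cW pu sq.
rewrite /=.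
by move: (energy u) ((k / 4)^-1) (C1) (Num.sqrt _) => E y z r; lra.
Qed.

End a_priori_bound.

(** * Subspaces as modules *)

Section subspace.
Context {R : realType} {V : lmodType R}.

(** Turns a propositional predicate into an lmodType, to which the results on
    bilinear forms apply. *)
Record subspace := Subspace {
  carrier :> V -> Prop;
  subspace0 : carrier 0;
  subspace_lin : forall c u v, carrier u -> carrier v -> carrier (c *: u + v)
}.

Variable S : subspace.

Definition mem_subspace : {pred V} := fun u => `[< S u >].

Lemma subspace_submod_closed : submod_closed mem_subspace.
Proof.
split; first by apply/asboolP; exact: subspace0.
by move=> c u v /asboolP Su /asboolP Sv; apply/asboolP; exact: subspace_lin.
Qed.

HB.instance Definition _ := GRing.isSubmodClosed.Build R V mem_subspace
  subspace_submod_closed.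

Record subspace_of := SubspaceOf {
  subspace_val : V;
  subspace_valP : subspace_val \in mem_subspace
}.

HB.instance Definition _ := [isSub for subspace_val].
HB.instance Definition _ := [Choice of subspace_of by <:].
HB.instance Definition _ := [SubChoice_isSubLmodule of subspace_of by <:].

Lemma subspace_valS (u : subspace_of) : S (\val u).
Proof. exact: asboolW (valP u). Qed.

Lemma subspace_val_lin c (u v : subspace_of) :
  \val (c *: u + v) = c *: \val u + \val v.
Proof. by rewrite linearP. Qed.

Lemma subspace_valB (u v : subspace_of) : \val (u - v) = \val u - \val v.
Proof. by rewrite linearB. Qed.

Definition in_subspace (u : V) (Su : S u) : subspace_of :=
  SubspaceOf (asboolT Su).

End subspace.

(** * Unique solvability of the variational problem *)

Section well_posed.
Context {R : realType} {n N : nat}.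
Local Notation Rn := 'rV[R]_n.+1.
Local Notation mu := (@lebesgueRn R n).
Variables (D : set Rn) (Q : Rn -> 'M[R]_n.+1) (X : operator R n N).
Local Notation pair := ((Rn -> R) * (Rn -> Rn))%type.
Local Notation energy := (energy D Q).

Hypothesis oD : open D.
Hypothesis pQ : forall x, D x -> nonneg_sym (Q x).
Hypothesis mQ : forall i j, measurable_fun D (fun x => Q x i j).
Let mD : measurable D. Proof. exact: open_measurableRn. Qed.
Hypothesis Doo : (mu D < +oo)%E.
Variables (omega C4 : R).
Hypothesis omega1 : 1 < omega.
Hypothesis C40 : 0 < C4.
Hypothesis sobolev : forall f, Lip_Q Q D f ->
  (Lnorm_on D (2 * omega)%:E f.1 <= C4%:E * QH1norm Q D f)%E.
Local Notation p := (omega / (omega - 1)).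

Let finQH1 (u : pair) : QH1 Q D u -> finite_energy D Q u.
Proof. exact: (QH1_finite oD pQ mQ). Qed.

Definition QH1_subspace : @subspace R pair :=
  Subspace (QH1_0 oD pQ mQ) (QH1_lin oD pQ mQ).

Local Notation H := (subspace_of QH1_subspace).

Let valQ (u : H) : QH1 Q D (\val u). Proof. exact: (subspace_valS u). Qed.

Definition QH1_ip (u v : H) : R := I mu D (ip_dens Q (\val u) (\val v)).

Lemma QH1_ipC u v : QH1_ip u v = QH1_ip v u.
Proof.
apply: eq_I => x Dx; rewrite /ip_dens mulrC qformC//.
by have [] := pQ Dx.
Qed.

Lemma QH1_ip_lin w : linear_form (QH1_ip^~ w).
Proof.
move=> c u v; have qu := finQH1 (valQ u).
have qv := finQH1 (valQ v); have qw := finQH1 (valQ w).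
have i1 := Intg_ip_dens oD pQ mQ qu qw; have i2 := Intg_ip_dens oD pQ mQ qv qw.
rewrite /QH1_ip -(IZ mD _ i1) -(ID mD (IntgZ mD c i1) i2).
rewrite subspace_val_lin; apply: eq_I => x _; rewrite /ip_dens.
rewrite -[(c *: \val u + \val v).1 x]/(c * (\val u).1 x + (\val v).1 x).
rewrite -[(c *: \val u + \val v).2 x]/(c *: (\val u).2 x + (\val v).2 x).
by rewrite qformDl qformZl; ring.
Qed.

Lemma QH1_ipE u : QH1_ip u u = energy (\val u).
Proof. by apply: eq_I => x _; rewrite /ip_dens -expr2. Qed.

Lemma QH1_ip_ge0 u : 0 <= QH1_ip u u.
Proof. by rewrite QH1_ipE; exact: energy_ge0. Qed.

Lemma QH1_ip_complete (z : nat -> H) (S : R) :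
  (forall j, QH1_ip (z j.+1 - z j) (z j.+1 - z j) <= S / 16 ^+ j) ->
  exists l, QH1_ip (z j - l) (z j - l) @[j --> \oo] --> (0 : R).
Proof.
move=> zS.
have [||u [C [qu zu]]] := @QH1_complete R n D Q oD pQ mQ (fun j => \val (z j)) S.
- by move=> j; exact: valQ.
- by move=> j; have := zS j; rewrite QH1_ipE subspace_valB.
exists (@in_subspace _ _ QH1_subspace u qu).
have lim : C * 4^-1 ^+ j @[j --> \oo] --> (0 : R).
  rewrite -(mulr0 C); apply: cvgMr; apply: cvg_expr.
  by rewrite ger0_norm ?invr_ge0// invf_lt1//; lra.
apply: (squeeze_cvgr _ (cvg_cst 0) lim); apply: nearW => j /=.
rewrite QH1_ip_ge0 QH1_ipE subspace_valB exprVn.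
exact: zu.
Qed.

Section operator.
Variable Y : operator R n N.
Hypothesis hY : rough_operator Q D Y.
Hypothesis iw : Intg mu D (fun x => weight Y x `^ p).

Definition QH1_form (u v : H) : R := I mu D (form_dens Y (\val u) (\val v)).

Lemma QH1_form_bilinear : bilinear QH1_form.
Proof.
split=> w c u v; rewrite /QH1_form subspace_val_lin.
  by apply: (I_form_linl oD pQ mQ hY omega1 C40 sobolev iw); exact: valQ.
by apply: (I_form_linr oD pQ mQ hY omega1 C40 sobolev iw); exact: valQ.
Qed.

Lemma QH1_form_bounded : exists2 M, 0 <= M & bounded_form QH1_ip QH1_form M.
Proof.
have [K K0 HK] := form_bound oD pQ mQ hY omega1 C40 sobolev iw.
exists (2 * K); first by rewrite mulr_ge0.
apply: (bounded_form_quadratic QH1_ipC QH1_ip_lin QH1_ip_ge0 QH1_form_bilinear K0).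
by move=> u v; rewrite !QH1_ipE; apply: HK; exact: valQ.
Qed.

Variable eps : R.
Hypothesis eps0 : 0 < eps.
Hypothesis neg : forall u v, QH1 Q D u -> QH1 Q D v ->
  {ae mu, forall x, D x -> 0 <= u.1 x * v.1 x} ->
  eps * I mu D (fun x => u.1 x * v.1 x) <= I mu D (neg_dens Y u v).

(** The a priori bound, normalized to data of norm [1], gives the uniform lower
    bound along the path from the inner product to the form. *)
Lemma QH1_form_solvable : exists M C, [/\ 0 <= C, bounded_form QH1_ip QH1_form M,
  bounded_below QH1_ip QH1_form C & solvable_form QH1_ip QH1_form].
Proof.
have [C C0 HC] := a_priori_bound oD pQ mQ Doo hY omega1 C40 sobolev iw eps0 neg.
have [M M0 HM] := QH1_form_bounded.
have [fl fr] := QH1_form_bilinear.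
have lower s : 0 <= s <= 1 -> bounded_below QH1_ip
    (fun u v => (1 - s) * QH1_ip u v + s * QH1_form u v) C.
  move=> s01; apply: (bounded_below_normalized QH1_ipC QH1_ip_lin) => //.
    by move=> w c u v; rewrite QH1_ip_lin fl; ring.
  move=> u tu; rewrite /ipnorm QH1_ipE.
  apply: (HC s _ s01 (valQ u)) => v qv.
  have := tu (@in_subspace _ _ QH1_subspace v qv).
  by rewrite /ipnorm QH1_ipE.
exists M, C; split=> //.
  have := lower 1; rewrite ler01 lexx => /(_ isT) low u K K0 uK.
  by apply: low => // v; rewrite subrr mul0r add0r mul1r.
exact: (solvable_continuation QH1_ipC QH1_ip_lin QH1_ip_ge0 QH1_ip_complete
  QH1_form_bilinear HM M0 C0 lower).
Qed.

End operator.

Lemma form_dens_swap (u v : pair) x : D x -> (opP X x)^T = opP X x ->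
  form_dens (swap_operator X) u v x = form_dens X v u x.
Proof.
move=> Dx sP; rewrite /form_dens /=.
rewrite -![dotv _ (mxact _ _)]/(qform _ _ _) (qformC _ _ sP); ring.
Qed.

Lemma rough_operator_swap : rough_operator Q D X ->
  rough_operator Q D (swap_operator X).
Proof.
move=> [hP PQ RS GH F]; split=> // i.
  by have [] := RS i.
by have [] := GH i.
Qed.

Lemma coef_swap x : coef (swap_operator X) x = coef X x.
Proof. by apply: eq_bigr => i _; rewrite addrC. Qed.

Hypothesis hX : rough_operator Q D X.
Hypothesis iw : Intg mu D (fun x => weight X x `^ p).
Hypothesis neg : negativity_condition Q D X.

(** The alternative of the negativity condition with [H] and [R] is the one
    solved by continuation; the alternative with [G] and [S] is the same one
    for the swapped operator, whose form is the transposed form. *)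
Theorem well_posed : exists2 C : R, 0 <= C &
  forall (l : pair -> R) (M : R),
    (forall c u v, QH1 Q D u -> QH1 Q D v -> l (c *: u + v) = c * l u + l v) ->
    0 <= M -> (forall v, QH1 Q D v -> `|l v| <= M * Num.sqrt (energy v)) ->
    (exists2 u, QH1 Q D u &
       forall v, QH1 Q D v -> bilinear_form D X u v = l v) /\
    (forall u, QH1 Q D u ->
       (forall v, QH1 Q D v -> bilinear_form D X u v = l v) ->
       Num.sqrt (energy u) <= C * M).
Proof.
have [eps eps0 neg12] := neg.
have [C [C0 lower solv]] : exists C, [/\ 0 <= C,
    bounded_below QH1_ip (QH1_form X) C & solvable_form QH1_ip (QH1_form X)].
  case: neg12 => [negG|negH]; last first.
    by have [M [C [C0 _ low sol]]] := QH1_form_solvable hX iw eps0 negH; exists C.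
  have iwS : Intg mu D (fun x => weight (swap_operator X) x `^ p).
    apply: eq_Intg iw => // x _; rewrite /weight coef_swap//.
  have [M [C [C0 HM low sol]]] :=
    QH1_form_solvable (rough_operator_swap hX) iwS eps0 negG.
  have swapE : QH1_form X = fun u v => QH1_form (swap_operator X) v u.
    apply/funext => u; apply/funext => v; apply: eq_I => x Dx.
    rewrite form_dens_swap//; have [[hP _ _] _ _ _ _] := hX.
    by have [] := hP x Dx.
  exists C; rewrite swapE; split=> //.
    exact: (bounded_below_transpose QH1_ipC QH1_ip_lin QH1_ip_ge0 C0 low sol).
  apply: (solvable_transpose QH1_ipC QH1_ip_lin QH1_ip_ge0 QH1_ip_complete _ HM low sol).
  exact: (QH1_form_bilinear (rough_operator_swap hX) iwS).
exists C => // l M ll M0 lM; split.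
  have [||u uP] := solv (fun v : H => l (\val v)).
  - by move=> c u v; rewrite subspace_val_lin ll//; exact: valQ.
  - exists M => v; rewrite /ipnorm QH1_ipE; apply: lM; exact: valQ.
  exists (\val u); first exact: valQ.
  by move=> v qv; exact: (uP (@in_subspace _ _ QH1_subspace v qv)).
move=> u qu hu.
have := lower (@in_subspace _ _ QH1_subspace u qu) M M0.
rewrite /ipnorm QH1_ipE; apply => v.
rewrite /QH1_form -[I _ _ _]/(bilinear_form D X u (\val v)) hu; last exact: valQ.
by rewrite QH1_ipE; apply: lM; exact: valQ.
Qed.

End well_posed.

(** * Data of the Neumann problem *)

Section data.
Context {R : realType} {n : nat}.
Local Notation Rn := 'rV[R]_n.+1.
Local Notation mu := (@lebesgueRn R n).
Variables (D : set Rn) (Q : Rn -> 'M[R]_n.+1).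
Local Notation pair := ((Rn -> R) * (Rn -> Rn))%type.
Implicit Types u v : pair.
Local Notation energy := (energy D Q).
Hypothesis oD : open D.
Hypothesis pQ : forall x, D x -> nonneg_sym (Q x).
Hypothesis mQ : forall i j, measurable_fun D (fun x => Q x i j).
Let mD : measurable D. Proof. exact: open_measurableRn. Qed.

Lemma Intg_powRD (f g : Rn -> R) r : 0 < r ->
  measurable_fun D f -> measurable_fun D g ->
  (forall x, D x -> 0 <= f x) -> (forall x, D x -> 0 <= g x) ->
  Intg mu D (fun x => f x `^ r) -> Intg mu D (fun x => g x `^ r) ->
  Intg mu D (fun x => (f x + g x) `^ r).
Proof.
move=> r0 mf mg f0 g0 If Ig.
apply: (Intg_le mD _ (IntgZ mD (2 `^ r) (IntgD mD If Ig))).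
  exact: (measurableT_comp (measurable_powR r) (measurable_funD mf mg)).
move=> x Dx; rewrite ger0_norm ?powR_ge0//.
have fx := f0 x Dx; have gx := g0 x Dx.
have le2 (a b : R) : 0 <= a -> a <= b -> (a + b) `^ r <= 2 `^ r * (a `^ r + b `^ r).
  move=> a0 ab; have b0 := le_trans a0 ab.
  apply: (@le_trans _ _ ((2 * b) `^ r)).
    by apply: ge0_ler_powR; rewrite ?nnegrE ?(ltW r0) ?addr_ge0 ?mulr_ge0//; lra.
  by rewrite powRM// ler_wpM2l ?powR_ge0// lerDr powR_ge0.
have [fg|/ltW gf] := leP (f x) (g x); first exact: le2.
by rewrite addrC [_ `^ r + _]addrC; exact: le2.
Qed.

Lemma Intg_powR_sum (I0 : finType) (h : I0 -> Rn -> R) r : 0 < r ->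
  (forall i, measurable_fun D (h i)) -> (forall i x, D x -> 0 <= h i x) ->
  (forall i, Intg mu D (fun x => h i x `^ r)) ->
  Intg mu D (fun x => (\sum_i h i x) `^ r).
Proof.
move=> r0 mh h0 Ih; elim: (index_enum I0) => [|i s IH].
  apply: (eq_Intg mD (f := cst 0)) => [x _|]; last exact: integrable0.
  by rewrite big_nil powR0 ?gt_eqF.
apply: (eq_Intg mD (f := fun x => (h i x + \sum_(j <- s) h j x) `^ r)).
  by move=> x _; rewrite big_cons.
have s0 x : D x -> 0 <= \sum_(j <- s) h j x.
  by move=> Dx; apply: sumr_ge0 => j _; exact: h0.
exact: (Intg_powRD r0 (mh i) (measurable_sum s mh) (h0 i) s0 (Ih i) IH).
Qed.

(** On a set of finite measure, [t > p] and [q > 2 p] put [|F|] and the square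
    of the first-order coefficients in [L^p]. *)
Lemma Intg_weight N (X : operator R n N) (p : R) (t q : \bar R) :
  (mu D < +oo)%E -> 0 < p -> (p%:E < t)%E -> ((2 * p)%:E < q)%E ->
  Lp_on D t (opF X) ->
  (forall i, Lp_on D q (opG X i) /\ Lp_on D q (opH X i)) ->
  Intg mu D (fun x => weight X x `^ p).
Proof.
move=> Doo p0 pt pq hF hGH.
have nm (f : Rn -> R) : measurable_fun D f -> measurable_fun D (fun x => `|f x|).
  by move=> mf; exact: measurableT_comp.
have mG i := nm _ (hGH i).1.1; have mH i := nm _ (hGH i).2.1.
have p2 : 0 < 2 * p by rewrite mulr_gt0.
have mc : measurable_fun D (coef X).
  by apply: measurable_sum => i; exact: measurable_funD (mG i) (mH i).
have Ic : Intg mu D (fun x => (coef X x ^+ 2) `^ p).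
  apply: (eq_Intg mD (f := fun x => coef X x `^ (2 * p))).
    by move=> x _; rewrite powRrM powR_mulrn// coef_ge0.
  apply: (Intg_powR_sum p2) => i.
  - exact: measurable_funD (mG i) (mH i).
  - by move=> x _; rewrite addr_ge0.
  apply: (Intg_powRD p2 (mG i) (mH i)) => [x _|x _||].
  - exact: normr_ge0.
  - exact: normr_ge0.
  - exact: (Lp_on_Intg_lower mD Doo p2 pq (hGH i).1).
  - exact: (Lp_on_Intg_lower mD Doo p2 pq (hGH i).2).
exact: (Intg_powRD p0 (nm _ hF.1) (measurable_funX 2 mc) (fun x _ => normr_ge0 _)
  (fun x _ => sqr_ge0 _) (Lp_on_Intg_lower mD Doo p0 pt hF) Ic).
Qed.

Lemma sqr_sum_le K (a : 'I_K -> R) :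
  (\sum_i a i) ^+ 2 <= K%:R * \sum_i a i ^+ 2.
Proof.
have -> : (\sum_i a i) ^+ 2 = \sum_i \sum_j a i * a j.
  by rewrite expr2 mulr_suml; apply: eq_bigr => i _; rewrite mulr_sumr.
apply: (@le_trans _ _ (\sum_i \sum_j (a i ^+ 2 + a j ^+ 2) / 2)).
  apply: ler_sum => i _; apply: ler_sum => j _.
  by have := sqr_ge0 (a i - a j); rewrite sqrrB; lra.
rewrite (eq_bigr (fun i => (K%:R * a i ^+ 2 + \sum_j a j ^+ 2) / 2)); last first.
  move=> i _; rewrite -mulr_suml big_split /= sumr_const card_ord.
  by rewrite -[_ *+ K]mulr_natl.
rewrite -mulr_suml big_split /= -mulr_sumr sumr_const card_ord -[_ *+ K]mulr_natl.
by lra.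
Qed.

(** The optimal [th] is the quotient of the roots of [B] and [A], which has to be
    perturbed if one of them vanishes. *)
Lemma optimize_amgm (x A B : R) : 0 <= A -> 0 <= B ->
  (forall th, 0 < th -> x <= th / 2 * A + (2 * th)^-1 * B) ->
  x <= Num.sqrt A * Num.sqrt B.
Proof.
move=> A0 B0 h; apply/ler_addgt0Pr => e e0.
set a := Num.sqrt A; set b := Num.sqrt B.
have a0 : 0 <= a by exact: sqrtr_ge0.
have b0 : 0 <= b by exact: sqrtr_ge0.
(* Chosen so that [(a + d) (b + d) <= a b + e]. *)
pose d := e / (a + b + e + 1).
have s0 : 0 < a + b + e + 1 by lra.
have d0 : 0 < d by rewrite divr_gt0.
have d1 : d * (a + b + e + 1) = e by rewrite divfK ?gt_eqF.
have d_le : d <= 1 by rewrite ler_pdivrMr// mul1r; lra.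
have ad : 0 < a + d by lra.
have bd : 0 < b + d by lra.
have := h ((b + d) / (a + d)); rewrite divr_gt0// => /(_ isT) hx.
apply: (le_trans hx).
have sA : A <= (a + d) ^+ 2.
  by rewrite -(sqr_sqrtr A0) -/a ler_sqr ?nnegrE ?lerDl ?addr_ge0 ?(ltW d0).
have sB : B <= (b + d) ^+ 2.
  by rewrite -(sqr_sqrtr B0) -/b ler_sqr ?nnegrE ?lerDl ?addr_ge0 ?(ltW d0).
apply: (@le_trans _ _ ((a + d) * (b + d))).
  apply: (@le_trans _ _ ((b + d) / (a + d) / 2 * (a + d) ^+ 2 +
      (2 * ((b + d) / (a + d)))^-1 * (b + d) ^+ 2)).
    apply: lerD; rewrite ler_wpM2l//.
      by rewrite !divr_ge0 ?ltW.
    by rewrite invr_ge0 mulr_ge0// divr_ge0 ?ltW.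
  rewrite le_eqVlt; apply/orP; left; apply/eqP; field.
  by rewrite !gt_eqF.
have : d * d <= d by rewrite ler_piMl// ltW.
have := mulr_ge0 (ltW d0) (ltW e0).
by move: d1; rewrite !mulrDr !mulrDl mulr1; lra.
Qed.

Section functional.
Variables (f : Rn -> R) (K : nat) (T : 'I_K -> Rn -> Rn) (g : 'I_K -> Rn -> R).
Hypothesis fTg : neumann_data Q D f T g.

Definition data_dens v x : R := f x * v.1 x + tapp g T v x.

(** The factor [K], from the Cauchy-Schwarz inequality over the components of
    [g], is the source of [sqrt K] in the final estimate. *)
Definition data_sqr x : R := f x ^+ 2 + K%:R * \sum_i g i x ^+ 2.

Let If2 : Intg mu D (fun x => f x ^+ 2).
Proof. by have [hf _ _] := fTg; have [] := Lnorm_on2 mD hf. Qed.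

Let Ig2 i : Intg mu D (fun x => g i x ^+ 2).
Proof. by have [_ _ hg] := fTg; have [] := Lnorm_on2 mD (hg i). Qed.

Let Isum : Intg mu D (fun x => \sum_i g i x ^+ 2).
Proof.
elim: (index_enum _) => [|i s IH].
  apply: (eq_Intg mD (f := cst 0)) => [x _|]; last exact: integrable0.
  by rewrite big_nil.
apply: (eq_Intg mD (f := fun x => g i x ^+ 2 + \sum_(j <- s) g j x ^+ 2)).
  by move=> x _; rewrite big_cons.
exact: (IntgD mD (Ig2 i) IH).
Qed.

Let Idata : Intg mu D data_sqr.
Proof. exact: (IntgD mD If2 (IntgZ mD K%:R Isum)). Qed.

Let finQH1 v : QH1 Q D v -> finite_energy D Q v.
Proof. exact: (QH1_finite oD pQ mQ). Qed.

Lemma measurable_data_dens v : measurable_pair D v -> measurable_fun D (data_dens v).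
Proof.
move=> [mv1 mv2]; have [[mf _] hT hg] := fTg.
apply: (measurable_funD (measurable_funM mf mv1)).
apply: measurable_sum => i.
exact: (measurable_funM (hg i).1 (measurable_dotv (hT i).1 mv2)).
Qed.

Lemma data_dens_le v th : 0 < th -> {ae mu, forall x, D x ->
  `|data_dens v x| <= th / 2 * data_sqr x + (2 * th)^-1 * energy_dens Q v x}.
Proof.
move=> th0; have [_ hT _] := fTg.
have aeT : {ae mu, forall x, forall i, D x ->
    forall xi, dotv (T i x) xi ^+ 2 <= qform (Q x) xi xi}.
  by apply: filter_forall => i; have [_] := hT i.
apply: filterS aeT => x hTx Dx.
have amgm (a b : R) : a * b <= th / 2 * a ^+ 2 + (2 * th)^-1 * b ^+ 2.
  rewrite -subr_ge0.
  have -> : th / 2 * a ^+ 2 + (2 * th)^-1 * b ^+ 2 - a * b =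
    (2 * th)^-1 * (th * a - b) ^+ 2 by field; rewrite gt_eqF.
  by rewrite mulr_ge0 ?sqr_ge0// invr_ge0 mulr_ge0// ltW.
have gT : `|tapp g T v x| <= (\sum_i `|g i x|) * grad_norm Q v x.
  rewrite /tapp mulr_suml; apply: (le_trans (ler_norm_sum _ _ _)).
  apply: ler_sum => i _; rewrite normrM ler_wpM2l//.
  by apply: (norm_dotv_le pQ) => // xi; exact: hTx.
rewrite /data_dens; apply: (le_trans (ler_normD _ _)).
rewrite normrM; apply: (le_trans (lerD (amgm _ _) (le_trans gT (amgm _ _)))).
have nK (a : R) : `|a| ^+ 2 = a ^+ 2 by rewrite real_normK ?num_real.
rewrite (sqr_grad_norm pQ v Dx) (nK (f x)) (nK (v.1 x)).
have : (\sum_i `|g i x|) ^+ 2 <= K%:R * \sum_i g i x ^+ 2.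
  under [in leRHS]eq_bigr do rewrite -nK.
  exact: sqr_sum_le.
rewrite /data_sqr /energy_dens => hs.
have := ler_wpM2l (divr_ge0 (ltW th0) (ler0n R 2)) hs.
by rewrite !mulrDr; lra.
Qed.

Lemma Intg_data v : QH1 Q D v -> Intg mu D (data_dens v).
Proof.
move=> qv; have [mv iv] := finQH1 qv.
apply: (Intg_le_ae mD (measurable_data_dens mv)
  (IntgD mD (IntgZ mD (1 / 2) Idata) (IntgZ mD (2 * 1)^-1 iv))).
exact: data_dens_le.
Qed.

Lemma I_data_lin c u v : QH1 Q D u -> QH1 Q D v ->
  I mu D (data_dens (c *: u + v)) = c * I mu D (data_dens u) + I mu D (data_dens v).
Proof.
move=> qu qv; have iu := Intg_data qu; have iv := Intg_data qv.
rewrite -(IZ mD _ iu) -(ID mD (IntgZ mD c iu) iv); apply: eq_I => x _.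
rewrite /data_dens /tapp -[(c *: u + v).1 x]/(c * u.1 x + v.1 x).
have -> : \sum_i g i x * vapp (T i) (c *: u + v) x =
    c * (\sum_i g i x * vapp (T i) u x) + \sum_i g i x * vapp (T i) v x.
  rewrite mulr_sumr -big_split /=; apply: eq_bigr => i _; rewrite /vapp.
  by rewrite -[(c *: u + v).2 x]/(c *: u.2 x + v.2 x) dotvDr dotvZr; ring.
by ring.
Qed.

(** Integrate the weighted pointwise inequality [data_dens_le] and optimize its
    parameter. *)
Lemma I_data_bound v : QH1 Q D v ->
  `|I mu D (data_dens v)| <= Num.sqrt (I mu D data_sqr) * Num.sqrt (energy v).
Proof.
move=> qv; have [mv iv] := finQH1 qv; have id := Intg_data qv.
apply: optimize_amgm; [|exact: energy_ge0|].
  by apply: I_ge0 => x _; rewrite addr_ge0 ?sqr_ge0// mulr_ge0// sumr_ge0// => i _; rewrite sqr_ge0.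
move=> th th0; apply: (le_trans (norm_I_le mD id)).
have i1 := IntgZ mD (th / 2) Idata; have i2 := IntgZ mD (2 * th)^-1 iv.
rewrite -(IZ mD _ Idata) energyE -(IZ mD _ iv) -(ID mD i1 i2).
apply: le_I_ae => //; first exact: integrable_norm.
  exact: (IntgD mD i1 i2).
exact: data_dens_le.
Qed.

Lemma data_norm : ((Num.sqrt (I mu D data_sqr))%:E <=
   Lnorm_on D 2%:E f + (Num.sqrt K%:R)%:E *
     Lnorm_on D 2%:E (fun x => Num.sqrt (\sum_(i < K) g i x ^+ 2)))%E.
Proof.
have [hf _ _] := fTg; have [_ ->] := Lnorm_on2 mD hf.
have sum0 x : 0 <= \sum_(i < K) g i x ^+ 2 by apply: sumr_ge0 => i _; exact: sqr_ge0.
have -> : Lnorm_on D 2%:E (fun x => Num.sqrt (\sum_(i < K) g i x ^+ 2)) =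
    (Num.sqrt (I mu D (fun x => \sum_i g i x ^+ 2)))%:E.
  rewrite Lnorm_onE//.
  under eq_integral do rewrite powR_mulrn// ger0_norm ?sqrtr_ge0// sqr_sqrtr//.
  by rewrite -EFin_I// poweR_EFin powR12_sqrt// I_ge0.
rewrite -EFinM -EFinD lee_fin -sqrtrM ?ler0n//.
rewrite (ID mD If2 (IntgZ mD K%:R Isum)) (IZ mD _ Isum).
set a := I mu D _; set b := _ * _.
have a0 : 0 <= a by apply: I_ge0 => x _; exact: sqr_ge0.
have b0 : 0 <= b by rewrite mulr_ge0// I_ge0.
rewrite -ler_sqr ?nnegrE ?addr_ge0 ?sqrtr_ge0// sqrrD !sqr_sqrtr ?addr_ge0//.
by rewrite addrAC lerDl mulrn_wge0// mulr_ge0 ?sqrtr_ge0.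
Qed.

End functional.

Lemma energy0_QH1_eq u v : finite_energy D Q u -> finite_energy D Q v ->
  energy (u - v) = 0 -> QH1_eq Q D u v.
Proof.
move=> fu fv e0; have [muv iuv] := finite_energyB oD pQ mQ fu fv.
have ae0 := I_eq0_ae mD iuv (fun x => energy_dens_ge0 pQ (u - v) (x := x)) e0.
apply: filterS ae0 => x + Dx => /(_ Dx) /eqP.
rewrite paddr_eq0 ?sqr_ge0 ?qform_ge0//; last exact: pQ.
move=> /andP[]; rewrite sqrf_eq0 => /eqP h1 /eqP h2; split.
  by apply/eqP; rewrite -subr_eq0; exact/eqP.
apply: dotv_eq0; rewrite -sqr_enorm sqr_enorm_sqrtmx//; exact: pQ.
Qed.

End data.

Theorem corollary2p17 (R : realType) (n N : nat)
    (Omega Theta : set 'rV[R]_n.+1)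
    (rho : 'rV[R]_n.+1 -> 'rV[R]_n.+1 -> R)
    (Q : 'rV[R]_n.+1 -> 'M[R]_n.+1)
    (r1 : 'rV[R]_n.+1 -> R)
    (X : operator R n N) (omega : R) (t q : \bar R)
    (hOmega : geometric_homogeneous_space Omega rho)
    (hTheta : bounded_domain Theta)
    (hThetaOmega : closure Theta `<=` Omega)
    (hQ : degenerate_matrix Omega Q)
    (hr1_cont : {within Omega, continuous (r1 : 'rV[R]_n.+1 -> R^o)})
    (hr1_pos : forall x, Omega x -> 0 < r1 x)
    (hlocal : local_poincare Q Omega rho r1 2)
    (homega : 1 < omega)
    (hglobal : global_weak_poincare Q Theta omega)
    (hX : rough_operator Q Theta X)
    (hneg : negativity_condition Q Theta X)
    (ht : ((omega / (omega - 1))%:E < t)%E)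
    (hF : Lp_on Theta t (opF X))
    (hq : ((2 * (omega / (omega - 1)))%:E < q)%E)
    (hGH : forall i, Lp_on Theta q (opG X i) /\ Lp_on Theta q (opH X i)) :
  [/\ ~ real_eigenvalues Q Theta X 0,
      forall f K (T : 'I_K -> 'rV[R]_n.+1 -> 'rV[R]_n.+1) g,
        neumann_data Q Theta f T g ->
        unique_in_QH1 Q Theta (weak_solution Q Theta X f T g)
    & exists2 C : R, 0 < C &
        forall f K (T : 'I_K -> 'rV[R]_n.+1 -> 'rV[R]_n.+1) g u,
          neumann_data Q Theta f T g ->
          weak_solution Q Theta X f T g u ->
          (QH1norm Q Theta u <=
             C%:E * (Lnorm_on Theta 2%:E f
               + (Num.sqrt K%:R)%:E *
                 Lnorm_on Theta 2%:E
                   (fun x => Num.sqrt (\sum_(i < K) g i x ^+ 2))))%E].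
Proof.
have [oT _ _ bT] := hTheta; have [[oO _] _ _ _ _] := hOmega.
have TO : Theta `<=` Omega := subset_trans (@subset_closure _ Theta) hThetaOmega.
have [pQO mQO _] := hQ.
have pQ x : Theta x -> nonneg_sym (Q x) by move=> /TO; exact: pQO.
have mQ i j : measurable_fun Theta (fun x => Q x i j).
  exact: (measurable_funS (open_measurableRn oO) TO (mQO i j)).
have Doo := lebesgue_bounded bT.
have [C4 C40 sobolev] := hglobal.
have p0 : 0 < omega / (omega - 1) by rewrite divr_gt0; lra.
have iw := Intg_weight oT Doo p0 ht hq hF hGH.
have [C C0 wp] := well_posed oT pQ mQ Doo homega C40 sobolev hX iw hneg.
have fin u : QH1 Q Theta u -> finite_energy Theta Q u.
  exact: (QH1_finite oT pQ mQ).
have solve f K (T : 'I_K -> 'rV[R]_n.+1 -> 'rV[R]_n.+1) g :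
    neumann_data Q Theta f T g ->
    (exists u, weak_solution Q Theta X f T g u) /\
    (forall u, weak_solution Q Theta X f T g u -> Num.sqrt (energy Theta Q u) <=
       C * Num.sqrt (I lebesgueRn Theta (data_sqr f g))).
  move=> fTg.
  have [[u qu hu] low] := wp (fun v => I lebesgueRn Theta (data_dens f T g v))
    (Num.sqrt (I lebesgueRn Theta (data_sqr f g)))
    (fun c u v => I_data_lin oT pQ mQ fTg c (u := u) (v := v)) (sqrtr_ge0 _)
    (fun v => I_data_bound oT pQ mQ fTg (v := v)).
  by split; [exists u | move=> w [qw hw]; exact: low].
have uniq f K (T : 'I_K -> 'rV[R]_n.+1 -> 'rV[R]_n.+1) g :
    neumann_data Q Theta f T g ->
    unique_in_QH1 Q Theta (weak_solution Q Theta X f T g).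
  move=> fTg; have [[u [qu hu]] _] := solve _ _ _ _ fTg; exists u => // w [qw hw].
  have qd : QH1 Q Theta (u - w).
    by rewrite -scaleN1r addrC; exact: (QH1_lin oT pQ mQ).
  have zero_bound v : QH1 Q Theta v -> `|0 : R| <= 0 * Num.sqrt (energy Theta Q v).
    by rewrite normr0 mul0r.
  have zero_lin c v w' : QH1 Q Theta v -> QH1 Q Theta w' ->
      0 = c * 0 + 0 :> R by rewrite mulr0 addr0.
  (* [u - w] solves the problem with zero data *)
  have [_ low] := wp (fun=> 0) 0 zero_lin (lexx 0) zero_bound.
  apply: (energy0_QH1_eq oT pQ mQ (fin _ qu) (fin _ qw)); apply/eqP.
  rewrite eq_le energy_ge0// andbT -sqrtr_eq0 eq_le sqrtr_ge0 andbT.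
  rewrite -[leRHS](mulr0 C); apply: low => // v qv.
  have := I_form_linl oT pQ mQ hX homega C40 sobolev iw (- 1) qw qu qv.
  rewrite scaleN1r addrC -[I _ _ _]/(bilinear_form Theta X (u - w) v) => ->.
  by rewrite -![I _ _ _]/(bilinear_form Theta X _ v) hu// hw// mulN1r addNr.
split=> //.
- move=> eig; apply: eig => f K T g fTg.
  have E u : weak_solution_shift Q Theta X 0 f T g u <-> weak_solution Q Theta X f T g u.
    split=> -[qu hu]; split=> // v qv; rewrite hu//; apply: eq_I => x _;
      by rewrite !mul0r add0r.
  have [u su uu] := uniq _ _ _ _ fTg; exists u; first exact/E.
  by move=> w /E; exact: uu.
exists (C + 1) => [|f K T g u fTg su]; first lra.
have [_ low] := solve _ _ _ _ fTg.
rewrite (QH1norm_real oT pQ mQ (fin _ su.1)).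
apply: (@le_trans _ _ ((C + 1)%:E * (Num.sqrt (I lebesgueRn Theta (data_sqr f g)))%:E)%E).
  rewrite -EFinM lee_fin (le_trans (low _ su))// ler_wpM2r ?sqrtr_ge0//; lra.
by rewrite lee_wpmul2l ?lee_fin ?(data_norm oT fTg)//; lra.
Qed.
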